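(* For each $A\in\mathcal{B}(\mathbb{R}^d_0)$ with $0\notin\bar A$ (and each $t>0$), the integral $\phi\mapsto\int_A\phi(z)L(t,dz)$ is a continuous operator from the space $\mathbb{L}^1_b(A,\mathcal{V})$ to $\mathbb{L}^1_b(\Omega_t)$.
   Context: Setting. $\mathbb{R}^d_0:=\mathbb{R}^d\setminus\{0\}$; $\mathcal{M}(\mathbb{R}^d_0)$ is the set of Borel measures on it. Fix a nonempty $\mathcal{U}\subset\mathcal{M}(\mathbb{R}^d_0)\times\mathbb{R}^d\times\mathbb{R}^{d\times d}$ with $\sup_{(v,p,Q)\in\mathcal{U}}\{\int_{\mathbb{R}^d_0}|z|v(dz)+|p|+\mathrm{tr}[QQ^T]\}<\infty$ and put $\mathcal{V}:=\{v\colon\exists(p,Q),\,(v,p,Q)\in\mathcal{U}\}$. Standing assumption: there is $q<1$ with $\sup_{v\in\mathcal{V}}\int_{\{0<|z|<1\}}|z|^qv(dz)<\infty$. $\Omega:=\mathbb{D}(\mathbb{R}^+,\mathbb{R}^d)$ is the space of càdlàg functions with the Skorohod topology, $X_t(\omega)=\omega_t$ the canonical process, $\Delta X_t=X_t-X_{t-}$, $\Omega_T:=\{\omega_{\cdot\wedge T}\colon\omega\in\Omega\}$. Sublinear expectation. Let $\mu$ be a Lévy measure on $\mathbb{R}^d_0$, absolutely continuous with respect to Lebesgue measure, $\mu(\mathbb{R}^d_0)=\infty$, $\int|z|\mu(dz)<\infty$. For $v\in\mathcal{V}$ let $g_v:\mathbb{R}^d\to\mathbb{R}^d$ be Borel with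 $g_v(0)=0$ and $v(B)=\mu(g_v^{-1}(B))$ for $B\in\mathcal{B}(\mathbb{R}^d_0)$, chosen so that for every $\epsilon>0$ there is $\eta>0$ with $g_v^{-1}(B(0,\epsilon)^c)\subset B(0,\eta)^c$ for all $v\in\mathcal{V}$. Let $(\tilde\Omega,\mathcal{G},\mathbb{P}_0)$ carry a $d$-dimensional Brownian motion $W$ and an independent Lévy process with triplet $(0,0,\mu)$ and Poisson random measure $N(dt,dz)$; $\mathbb{G}$ is the $\mathbb{P}_0$-completed filtration generated by $W$ and $N_t:=\int_{\mathbb{R}^d_0}zN(]0,t],dz)$. Let $\mathcal{A}$ be the set of $\theta=(\theta^d,\theta^{1,c},\theta^{2,c})$ on $]0,\infty[$ with $(\theta^{1,c},\theta^{2,c})$ $\mathbb{G}$-adapted, $\theta^d$ a $\mathbb{G}$-predictable random field on $]0,\infty[\times\mathbb{R}^d$, $(\theta^d(s,\cdot),\theta^{1,c}_s,\theta^{2,c}_s)\in\{(g_v,p,Q)\colon(v,p,Q)\in\mathcal{U}\}$ for $\mathbb{P}_0$-a.a. $\omega$ and a.e. $s$, and $\mathbb{E}^{\mathbb{P}_0}\int_0^T[|\theta^{1,c}_s|+|\theta^{2,c}_s|^2+\int|\theta^d(s,z)|\mu(dz)]ds<\infty$ for all $T<\infty$. Let $\mathbb{P}^\theta$ be the law on $\Omega$ of $B^{\theta}_t=\int_0^t\theta^{1,c}_sds+\int_0^t\theta^{2,c}_sdW_s+\int_{]0,t]}\int_{\mathbb{R}^d_0}\theta^d(s,z)N(ds,dz)$,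 $\mathfrak{P}:=\{\mathbb{P}^\theta\colon\theta\in\mathcal{A}\}$, $\hat{\mathbb{E}}[Y]:=\sup_{\mathbb{P}\in\mathfrak{P}}\mathbb{E}^{\mathbb{P}}[Y]$. $\mathbb{L}^1_b(\Omega_T)$ is the completion, under the norm $\hat{\mathbb{E}}[|\cdot|]$, of the space of bounded random variables on $\Omega_T$. Function space. For $0\notin\bar A$, $\mathbb{L}^1_b(A,\mathcal{V})$ is the completion of the space $B_b(A)$ of bounded Borel functions on $\mathbb{R}^d$ vanishing outside $A$ under the norm $\|f\|_{1,A,\mathcal{V}}:=\sup_{v\in\mathcal{V}}\int_A|f(z)|v(dz)$ (functions equal outside a set $B$ with $\sup_{v\in\mathcal{V}}v(B)=0$ are identified). Poisson integral. For $0\notin\bar A$, $\int_A\phi(z)L(t,dz):=\sum_{0<u\le t}\phi(\Delta X_u)\mathbf{1}_A(\Delta X_u)$. *)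

(* Defs.v *)
From HB Require Import structures.
From mathcomp Require Import all_boot all_order all_algebra.
From mathcomp Require Import all_classical all_reals all_analysis.
From mathcomp Require Import measurable_realfun.

Set Implicit Arguments.
Unset Strict Implicit.
Unset Printing Implicit Defensive.

Import Order.TTheory GRing.Theory Num.Theory.
Import numFieldNormedType.Exports.

Local Open Scope classical_set_scope.
Local Open Scope ring_scope.

Definition borel (T : ptopologicalType) := g_sigma_algebraType (@open T).
(* The library norm on matrices is the sup norm. *)
Definition enorm {R : realType} {d : nat} (z : 'rV[R]_d) : R :=
  Num.sqrt (\sum_(i < d) z 0 i ^+ 2).

Definition dotp {R : realType} {d : nat} (u z : 'rV[R]_d) : R :=
  \sum_(i < d) u 0 i * z 0 i.

Definition frob2 {R : realType} {d : nat} (Q : 'M[R]_d) : R := \tr (Q *m Q^T).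

(* Measurability, on D, for a sigma-algebra S of subsets of D. *)
Definition measurable_wrt {T : Type} {d'} {T' : measurableType d'}
    (S : set (set T)) (D : set T) (f : T -> T') : Prop :=
  forall C, measurable C -> S (D `&` f @^-1` C).

Section cadlag_paths.
Context (R : realType) (d : nat).

(* A function on [0, +oo[ is encoded as the function on R that extends it by
   its value at 0; thus it has no jump at 0 and equality of paths is equality
   on [0, +oo[. *)
Record cadlag := Cadlag {
  path :> R -> 'rV[R]_d ;
  path_neg : forall s, s < 0 -> path s = path 0 ;
  path_rcont : forall s, path r @[r --> s^'+] --> path s ;
  path_llim : forall s, cvg (path r @[r --> s^'-]) }.

HB.instance Definition _ := gen_eqMixin cadlag.
HB.instance Definition _ := gen_choiceMixin cadlag.

Lemma cst0_rcont (s : R) : (0 : 'rV[R]_d) @[r --> s^'+] --> (0 : 'rV[R]_d).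
Proof. exact: cvg_cst. Qed.

Lemma cst0_llim (s : R) : cvg ((0 : 'rV[R]_d) @[r --> s^'-]).
Proof. exact: is_cvg_cst. Qed.

HB.instance Definition _ := isPointed.Build cadlag
  (@Cadlag (fun=> 0) (fun _ _ => erefl) cst0_rcont cst0_llim).

Definition time_change (lam : R -> R) : Prop :=
  [/\ lam 0 = 0, forall s r, 0 <= s -> s < r -> lam s < lam r &
      set_bij `[0, +oo[ `[0, +oo[ lam].

Definition skorohod_nbhd (w : cadlag) (T e : R) : set cadlag :=
  [set w' | exists lam, [/\ time_change lam,
     (forall s, 0 <= s -> `|lam s - s| < e) &
     (forall s, 0 <= s <= T -> enorm (w' (lam s) - w s) < e)]].

(* A sequence w_n eventually enters every skorohod_nbhd w T e iff there are
   time changes lam_n with sup_s |lam_n s - s| --> 0 and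
   sup_(s <= T) |w_n (lam_n s) - w s| --> 0 for all T.  The following open sets
   are therefore those of the (metrizable) Skorohod J1 topology. *)
Definition skorohod_open : set_system cadlag :=
  [set O | forall w, O w ->
     exists T e, 0 < e /\ skorohod_nbhd w T e `<=` O].

Lemma skorohod_openT : skorohod_open setT.
Proof. by move=> w _; exists 1, 1. Qed.

Lemma skorohod_nbhdS w T1 e1 T2 e2 : T1 <= T2 -> e2 <= e1 ->
  skorohod_nbhd w T2 e2 `<=` skorohod_nbhd w T1 e1.
Proof.
move=> T12 e21 w' [lam [tc le lw]]; exists lam; split=> // s.
  by move=> s0; exact: lt_le_trans (le s s0) e21.
case/andP=> s0 sT; apply: lt_le_trans (lw s _) e21.
by rewrite s0 (le_trans sT).
Qed.

Lemma skorohod_openI : setI_closed skorohod_open.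
Proof.
move=> O1 O2 o1 o2 w [/o1[T1 [e1 [e10 s1]]] /o2[T2 [e2 [e20 s2]]]].
exists (Num.max T1 T2), (Num.min e1 e2); split; first by rewrite lt_min e10.
move=> w' w'P; split; [apply: s1|apply: s2]; apply: skorohod_nbhdS w'P;
  by rewrite ?le_max ?ge_min ?lexx ?orbT.
Qed.

Lemma skorohod_open_bigU (I : Type) (f : I -> set cadlag) :
  (forall i, skorohod_open (f i)) -> skorohod_open (\bigcup_i f i).
Proof.
move=> of_ w [i _ /of_[T [e [e0 se]]]]; exists T, e; split=> // w' /se fw'.
by exists i.
Qed.

HB.instance Definition _ := isOpenTopological.Build cadlag
  skorohod_openT skorohod_openI skorohod_open_bigU.

Definition jump (w : cadlag) (s : R) : 'rV[R]_d :=
  w s - lim (w r @[r --> s^'-]).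

Section stopped_path.
Variables (T : R) (w : cadlag).
Let f (s : R) := w (Num.min s T).

Lemma stopped_neg s : s < 0 -> f s = f 0.
Proof.
move=> s0; rewrite /f.
have neg r : r <= 0 -> w r = w 0.
  by rewrite le_eqVlt => /predU1P[->//|]; exact: path_neg.
have [T0|T0] := leP T 0.
  by rewrite !neg// ge_min (ltW s0).
by rewrite neg// ge_min (ltW s0).
Qed.

Lemma stopped_rcont s : f r @[r --> s^'+] --> f s.
Proof.
rewrite /f; have [sT|Ts] := ltP s T.
  apply: (@cvg_trans _ (w r @[r --> s^'+])); last exact: path_rcont.
  apply: near_eq_cvg; near=> r.
  by rewrite min_l//; apply: ltW; near: r; exact: nbhs_right_lt.
apply: (@cvg_trans _ (w T @[r --> s^'+])); last exact: cvg_cst.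
apply: near_eq_cvg; near=> r.
rewrite min_r//; apply: le_trans Ts _; apply: ltW; near: r.
exact: nbhs_right_gt.
Unshelve. all: by end_near. Qed.

Lemma stopped_llim s : cvg (f r @[r --> s^'-]).
Proof.
rewrite /f; have [sT|Ts] := leP s T.
  have /cvg_ex[l wl] := @path_llim w s.
  apply: (@cvgP _ _ l); apply: (@cvg_trans _ (w r @[r --> s^'-])); last exact: wl.
  apply: near_eq_cvg; near=> r.
  rewrite min_l//; apply: le_trans sT; apply: ltW; near: r.
  exact: nbhs_left_lt.
apply: (@cvgP _ _ (w T)).
apply: (@cvg_trans _ (w T @[r --> s^'-])); last exact: cvg_cst.
apply: near_eq_cvg; near=> r.
by rewrite min_r//; apply: ltW; near: r; exact: nbhs_left_gt.
Unshelve. all: by end_near. Qed.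

Definition stopped := Cadlag stopped_neg stopped_rcont stopped_llim.
End stopped_path.

End cadlag_paths.
Arguments jump {R d}.
Arguments stopped {R d}.

Section upper_integral.
Context {d} {T : measurableType d} {R : realType}.
Variable M : set {measure set T -> \bar R}.
Local Open Scope ereal_scope.

Definition upper_norm (D : set T) (f : T -> R) : \bar R :=
  ereal_sup [set \int[m]_(x in D) `|f x|%:E | m in M].

Definition qs_eq (f g : T -> R) : Prop :=
  exists B, [/\ measurable B, (forall m, M m -> m B = 0) &
                forall x, ~ B x -> f x = g x].

(* Completion of the bounded elements of the vector space S of measurable
   functions under upper_norm D, realized inside S as their closure; elements
   are functions, to be identified when they are equal in the sense of qs_eq.
   By the Riesz-Fischer argument the quotient is complete. *)
Definition L1b (D : set T) (S : set (T -> R)) : set (T -> R) :=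
  [set f | S f /\ forall e : R, (0 < e)%R -> exists g,
     [/\ S g, (exists K : R, forall x, (`|g x| <= K)%R) &
         upper_norm D (f \- g)%R < e%:E]].

End upper_integral.

(* I is a continuous linear operator between the quotients by qs_eq of the
   seminormed spaces E and E'. *)
Definition continuous_operator {d d'} {T : measurableType d}
    {T' : measurableType d'} {R : realType}
    (M : set {measure set T -> \bar R}) (D : set T) (E : set (T -> R))
    (M' : set {measure set T' -> \bar R}) (D' : set T') (E' : set (T' -> R))
    (I : (T -> R) -> T' -> R) : Prop :=
  [/\ forall f, E f -> E' (I f),
      forall f g, E f -> E g -> qs_eq M f g -> qs_eq M' (I f) (I g),
      forall (a b : R) f g, E f -> E g ->
        qs_eq M' (I (fun x => a * f x + b * g x))
                 (fun y => a * I f y + b * I g y) &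
      forall f, E f -> forall e : R, 0 < e -> exists2 delta : R, 0 < delta &
        forall g, E g -> (upper_norm M D (f \- g)%R < delta%:E)%E ->
          (upper_norm M' D' (I f \- I g)%R < e%:E)%E].

Section noise.
Context (R : realType) (d : nat) {dO} {Ot : measurableType dO}.
Variable P0 : probability Ot R.
Local Notation Rd := (borel 'rV[R]_d).
Local Notation leb := (@lebesgue_measure R).

Definition sigma_process (I : set R) (X : R -> Ot -> Rd) : set (set Ot) :=
  <<s \bigcup_(s in I) preimage_set_system setT (X s) measurable >>.

Definition indep (S1 S2 : set (set Ot)) : Prop :=
  forall A B, S1 A -> S2 B -> P0 (A `&` B) = (P0 A * P0 B)%E.

Definition indep_increments (X : R -> Ot -> Rd) : Prop :=
  forall s t, 0 <= s <= t ->
    indep (sigma_process `[0, s] X)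
          (preimage_set_system setT (fun w => X t w - X s w : Rd) measurable).

Definition brownian_motion (W : R -> Ot -> Rd) : Prop :=
  [/\ forall t, 0 <= t -> measurable_fun setT (W t),
      {ae P0, forall w, W 0 w = 0 /\
                        {within `[0, +oo[, continuous (W ^~ w)}},
      indep_increments W &
      forall s t (B : 'I_d -> set R), 0 <= s < t ->
        (forall i, measurable (B i)) ->
        P0 [set w | forall i, B i ((W t w - W s w) 0 i)] =
        (\prod_(i < d) normal_prob 0 (Num.sqrt (t - s)) (B i))%E].

Definition levy_measure (mu : {measure set Rd -> \bar R}) : Prop :=
  mu [set 0] = 0%E /\
  (\int[mu]_(z in [set~ 0%R]) (Num.min 1 (enorm z ^+ 2))%:E < +oo)%E.

Definition levy_process (J : Ot -> cadlag R d) : Prop :=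
  [/\ forall t, 0 <= t -> measurable_fun setT ((fun w => J w t) : Ot -> Rd),
      {ae P0, forall w, J w 0 = 0},
      indep_increments (fun t w => J w t) &
      forall s t (C : set Rd), 0 <= s <= t -> measurable C ->
        P0 [set w | C (J w t - J w s)] = P0 [set w | C (J w (t - s))]].

(* Levy-Khintchine formula without truncation function, as is possible when
   |z| is mu-integrable: E[exp(i<u, J_t>)] = exp(t psi(u)) with
   psi(u) = \int (exp(i<u, z>) - 1) mu(dz), in real and imaginary parts. *)
Definition triplet_00 (mu : {measure set Rd -> \bar R})
    (J : Ot -> cadlag R d) : Prop :=
  forall (t : R) (u : 'rV[R]_d), 0 <= t ->
    let re := \int[mu]_(z in [set~ 0%R]) (cos (dotp u z) - 1) in
    let im := \int[mu]_(z in [set~ 0%R]) sin (dotp u z) in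
    \int[P0]_w cos (dotp u (J w t)) = expR (t * re) * cos (t * im) /\
    \int[P0]_w sin (dotp u (J w t)) = expR (t * re) * sin (t * im).

(* N = \sum_s \delta_(s, Delta J_s) over the jump times s > 0 of J *)
Definition jump_measure (J : Ot -> cadlag R d)
    (N : Ot -> {measure set (R * Rd) -> \bar R}) : Prop :=
  forall w C, measurable C -> N w C =
    \esum_(s in [set s | [/\ 0 < s, jump (J w) s <> 0 &
                              C (s, jump (J w) s)]]) 1%E.

Definition intensity (mu : {sigma_finite_measure set Rd -> \bar R})
    (C : set (R * Rd)) : \bar R :=
  (leb \x mu)%E (C `&` (`]0, +oo[ `*` [set~ 0%R])).

Definition poisson_random_measure (nu : set (R * Rd) -> \bar R)
    (N : Ot -> {measure set (R * Rd) -> \bar R}) : Prop :=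
  [/\ forall C, measurable C -> measurable_fun setT (fun w => N w C),
      forall C, measurable C -> (nu C < +oo)%E -> forall k : nat,
        P0 [set w | N w C = k%:R%:E] =
        (expR (- fine (nu C)) * fine (nu C) ^+ k / k`!%:R)%:E,
      forall C, measurable C -> nu C = +oo%E -> {ae P0, forall w, N w C = +oo%E} &
      forall n (C : 'I_n -> set (R * Rd)) (B : 'I_n -> set (\bar R)),
        (forall i, measurable (C i)) -> trivIset setT C ->
        (forall i, measurable (B i)) ->
        P0 [set w | forall i, B i (N w (C i))] =
        (\prod_(i < n) P0 [set w | B i (N w (C i))])%E].

Definition jump_integral (N : Ot -> {measure set (R * Rd) -> \bar R})
    (f : R -> Ot -> Rd -> Rd) (t : R) (w : Ot) : 'rV[R]_d :=
  \row_i \int[N w]_(x in `]0, t] `*` [set~ 0%R]) (f x.1 w x.2 : 'rV[R]_d) 0 i.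

Definition driving_noise (mu : {sigma_finite_measure set Rd -> \bar R})
    (W : R -> Ot -> Rd) (J : Ot -> cadlag R d)
    (N : Ot -> {measure set (R * Rd) -> \bar R}) : Prop :=
  [/\ brownian_motion W,
      levy_process J /\ triplet_00 mu J,
      indep (sigma_process `[0, +oo[ W)
            (sigma_process `[0, +oo[ (fun t w => J w t)),
      jump_measure J N /\ poisson_random_measure (intensity mu) N &
      {ae P0, forall w t, 0 <= t -> J w t = jump_integral N (fun _ _ z => z) t w}].

Variables (W : R -> Ot -> Rd) (J : Ot -> cadlag R d).

(* Completed by the null sets of the sigma-algebra of Ot, so that P0 itself need
   not be complete *)
Definition filtration (t : R) : set (set Ot) :=
  <<s sigma_process `[0, t] W `|` sigma_process `[0, t] (fun s w => J w s)
      `|` [set F | measurable F /\ P0 F = 0%E] >>.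

(* Product of the predictable sigma-algebra on ]0, +oo[ x Ot with the Borel
   sigma-algebra of R^d *)
Definition predictable_field_sigma : set (set (R * Ot * Rd)) :=
  <<s (`]0, +oo[ `*` setT) `*` setT,
      [set G | exists s t F C, [/\ 0 <= s <= t, filtration s F, measurable C &
         G = (`]s, t] `*` F) `*` C]] >>.

Definition predictable_field (f : R -> Ot -> Rd -> Rd) : Prop :=
  measurable_wrt predictable_field_sigma ((`]0, +oo[ `*` setT) `*` setT)
    (fun x => f x.1.1 x.1.2 x.2).

(* Adapted, and jointly measurable so that its time integrals make sense *)
Definition adapted {T : ptopologicalType} (f : R -> Ot -> borel T) : Prop :=
  (forall s, 0 < s -> measurable_wrt (filtration s) setT (f s)) /\
  measurable_fun (`]0, +oo[ `*` setT : set (R * Ot)) (fun x : R * Ot => f x.1 x.2).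

(* \sum_(k < n) xi_k 1_]t_k, t_(k+1)] *)
Record simple_process := SimpleProcess {
  sp_n : nat ;
  sp_t : nat -> R ;
  sp_xi : nat -> Ot -> 'M[R]_d }.

Definition sp_adapted (H : simple_process) : Prop :=
  [/\ 0 <= sp_t H 0,
      forall k, sp_t H k <= sp_t H k.+1,
      forall k, measurable_wrt (filtration (sp_t H k)) setT
                  (sp_xi H k : Ot -> borel 'M[R]_d) &
      exists K : R, forall k w, frob2 (sp_xi H k w) <= K].

Definition sp_val (H : simple_process) (s : R) (w : Ot) : 'M[R]_d :=
  \sum_(k < sp_n H) \1_(`]sp_t H k, sp_t H k.+1]) s *: sp_xi H k w.

(* Vectors are rows: Q dW is written dW *m Q^T. *)
Definition sp_integral (H : simple_process) (t : R) (w : Ot) : 'rV[R]_d :=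
  \sum_(k < sp_n H)
    (W (Num.min (sp_t H k.+1) t) w - W (Num.min (sp_t H k) t) w)
      *m (sp_xi H k w)^T.

(* I is (a continuous adapted version of) the Ito integral of f against W: the
   L^2 limit of the integrals of simple processes that approximate f in
   L^2(P0 (x) dt) on every ]0, T]. *)
Definition ito_integral (f : R -> Ot -> 'M[R]_d) (I : R -> Ot -> Rd) : Prop :=
  [/\ forall t, 0 <= t -> measurable_wrt (filtration t) setT (I t),
      forall w, {within `[0, +oo[, continuous (I ^~ w)} &
      exists H : nat -> simple_process,
      [/\ forall n, sp_adapted (H n),
          forall T : R, (\int[P0]_w \int[leb]_(s in `]0%R, T])
            (frob2 (sp_val (H n) s w - f s w)%R)%:E)%E @[n --> \oo] --> 0%E &
          forall t : R, 0 <= t ->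
            (\int[P0]_w (enorm (sp_integral (H n) t w - I t w)%R ^+ 2)%:E)%E
              @[n --> \oo] --> 0%E]].

End noise.

Section uncertainty.
Context (R : realType) (d : nat).
Local Notation Rd := (borel 'rV[R]_d).
Local Notation leb := (@lebesgue_measure R).
Local Notation triple := ({measure set Rd -> \bar R} * 'rV[R]_d * 'M[R]_d)%type.

Definition levy_part (U : set triple) : set {measure set Rd -> \bar R} :=
  [set v | exists p Q, U (v, p, Q)].

(* A measure on R^d \ {0} is encoded as a measure on R^d that does not charge
   {0}. *)
Definition uncertainty_set (U : set triple) : Prop :=
  [/\ U !=set0,
      forall v, levy_part U v -> v [set 0] = 0%E,
      (ereal_sup [set \int[u.1.1]_(z in [set~ 0%R]) (enorm z)%:E +
                      (enorm u.1.2)%:E + (frob2 u.2)%:E | u in U] < +oo)%E &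
      exists2 q : R, q < 1 &
        (ereal_sup [set \int[v]_(z in [set z : 'rV[R]_d | (0 < enorm z < 1)%R])
                     (enorm z `^ q)%:E | v in levy_part U] < +oo)%E].

(* Lebesgue outer measure on R^d, by countable covers with boxes *)
Definition lebesgue_outer (S : set 'rV[R]_d) : \bar R :=
  ereal_inf [set r | exists a b : nat -> 'rV[R]_d,
    [/\ forall k i, a k 0 i <= b k 0 i,
        S `<=` \bigcup_k [set z | forall i, a k 0 i <= z 0 i <= b k 0 i] &
        r = (\sum_(0 <= k <oo) (\prod_(i < d) (b k 0 i - a k 0 i))%:E)%E]].

Definition reference_measure (mu : {measure set Rd -> \bar R}) : Prop :=
  [/\ levy_measure mu,
      forall C : set Rd, measurable C -> lebesgue_outer C = 0%E -> mu C = 0%E,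
      mu [set~ 0%R] = +oo%E &
      (\int[mu]_(z in [set~ 0%R]) (enorm z)%:E < +oo)%E].

Definition transport_family (V : set {measure set Rd -> \bar R})
    (mu : {measure set Rd -> \bar R})
    (g : {measure set Rd -> \bar R} -> Rd -> Rd) : Prop :=
  (forall v, V v ->
     [/\ measurable_fun setT (g v), g v 0 = 0 &
         forall C : set Rd, measurable C -> ~ C 0 -> v C = mu (g v @^-1` C)]) /\
  (forall e : R, 0 < e -> exists2 eta : R, 0 < eta &
     forall v z, V v -> e <= enorm (g v z) -> eta <= enorm z).

Context {dO} {Ot : measurableType dO} (P0 : probability Ot R).
Variables (W : R -> Ot -> Rd) (J : Ot -> cadlag R d)
  (N : Ot -> {measure set (R * Rd) -> \bar R}) (mu : {measure set Rd -> \bar R})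
  (U : set triple) (g : {measure set Rd -> \bar R} -> Rd -> Rd).

Definition admissible (thd : R -> Ot -> Rd -> Rd) (th1 : R -> Ot -> 'rV[R]_d)
    (th2 : R -> Ot -> 'M[R]_d) : Prop :=
  [/\ adapted P0 W J (th1 : R -> Ot -> borel 'rV[R]_d),
      adapted P0 W J (th2 : R -> Ot -> borel 'M[R]_d),
      predictable_field P0 W J thd,
      {ae P0, forall w, {ae leb, forall s, 0 < s -> exists v p Q,
         [/\ U (v, p, Q), thd s w = g v, th1 s w = p & th2 s w = Q]}} &
      forall T : R, (\int[P0]_w \int[leb]_(s in `]0%R, T])
        ((enorm (th1 s w))%:E + (frob2 (th2 s w))%:E +
         \int[mu]_(z in [set~ 0%R]) (enorm (thd s w z))%:E) < +oo)%E].

(* B is a version of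
   \int_0^t th1_s ds + \int_0^t th2_s dW_s + \int_]0,t] \int thd(s, z) N(ds, dz) *)
Definition levy_ito_integral (thd : R -> Ot -> Rd -> Rd)
    (th1 : R -> Ot -> 'rV[R]_d) (th2 : R -> Ot -> 'M[R]_d)
    (B : Ot -> cadlag R d) : Prop :=
  exists2 I : R -> Ot -> Rd, ito_integral P0 W J th2 I &
  {ae P0, forall w (t : R), 0 <= t ->
    B w t = \row_i (\int[leb]_(s in `]0, t]) th1 s w 0 i)
            + I t w + jump_integral N thd t w}.

Definition laws : set {measure set (borel (cadlag R d)) -> \bar R} :=
  [set P | exists thd th1 th2 (B : Ot -> borel (cadlag R d)),
     [/\ admissible thd th1 th2,
         measurable_fun setT B,
         levy_ito_integral thd th1 th2 B &
         forall C, measurable C -> P C = P0 (B @^-1` C)]].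

(* Random variables on Omega_T, identified with random variables on Omega by
   composition with w |-> w_(. /\ T) *)
Definition rv_on (T : R) : set (borel (cadlag R d) -> R) :=
  [set Y : borel (cadlag R d) -> R |
     measurable_fun setT Y /\ forall w, Y (stopped T w) = Y w].

Definition L1b_Omega (T : R) : set (borel (cadlag R d) -> R) :=
  L1b laws setT (rv_on T).

Definition L1b_levy (A : set Rd) : set (Rd -> R) :=
  L1b (levy_part U) A
    [set f : Rd -> R | measurable_fun setT f /\ forall z, ~ A z -> f z = 0].

(* The sum over u is finitely supported when 0 is not adherent to A. *)
Definition poisson_integral (A : set Rd) (t : R) (phi : Rd -> R)
    (w : borel (cadlag R d)) : R :=
  \sum_(u \in `]0, t]) phi (jump w u) * \1_A (jump w u).

End uncertainty.

(* Main.v *)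
Require Import Defs.
From HB Require Import structures.
From mathcomp Require Import all_boot all_order all_algebra.
From mathcomp Require Import all_classical all_reals all_analysis.
From mathcomp Require Import finmap measurable_realfun ring lra.

Set Implicit Arguments.
Unset Strict Implicit.
Unset Printing Implicit Defensive.

Import Order.TTheory GRing.Theory Num.Theory.
Import numFieldNormedType.Exports.
Import HBNNSimple.

Local Open Scope classical_set_scope.
Local Open Scope ring_scope.

(** Everything rests on one inequality. For a law [P] of the family, a measurable
    [phi >= 0] and [I] the Poisson integral over [A] up to time [t],
      [E^P (I phi) <= t * sup_v \int_A phi dv],
    the supremum being over the Levy measures of the uncertainty set
    ([mean_jumps_le], [mean_poisson_integral_le]). As [I] is linear and
    [|I f| <= I |f|], it gives continuity with modulus [e / t]; applied to the
    indicator function of an exceptional set it shows that [I] respects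
    quasi-sure equality.

    The inequality holds because a controlled process jumps only when the noise
    does: the drift and the Ito integral are continuous, so the jump at time [u]
    is the image of the noise jump by the control at that time
    ([controlled_jump]). The jumps in [A] up to [t] are then dominated by the
    noise jumps that the control sends into [A]. Since the control is predictable,
    compensation replaces the jump measure in the mean by [dt mu(dz)]
    ([mean_jump_integral]); at almost every time the control is a transport map
    [g v], and its image of [mu] is [v] away from the origin
    ([transport_integral]).

    The compensation formula is proved for predictable sets ([compensation]): for
    a rectangle it says that the number of noise jumps in [`]s, t] `*` C] is
    a Poisson variable independent of the past of [s], and Dynkin's lemma extends
    it within a window where both measures are finite. Independence
    ([indep_filtration]) needs two facts: that number is measurable with respect
    to the increments of the noise after [s] ([measurable_jump_count], which
    detects jumps by increments over short rational intervals), and these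
    increments are generated by those over dyadic grids, for which independence
    follows one step at a time ([indep_future]).

    It remains to see that [I f] lies in the closure of the bounded random
    variables. By the inequality [f] may be taken bounded, but [I f] is then only
    bounded by a multiple of the number of jumps in [A]. The transport maps send
    into [A] only points at a distance at least [eta] from the origin, with [eta]
    common to all of them. So the number of jumps in [A] is dominated, under all
    laws at once, by the number of noise jumps of size at least [eta] up to [t],
    an integrable variable ([large_noise_jumps], [jump_count_le_noise]); cutting
    [I f] off where there are many jumps costs little, uniformly over the laws
    ([poisson_integral_truncation]). *)

(** * Borel measurability in Euclidean space *)

Section borel_euclidean.
Context {R : realType} {d : nat}.
Local Notation Rd := (borel 'rV[R]_d).

Lemma continuous_borel (T : ptopologicalType) (f : T -> R) :
  continuous f -> measurable_fun setT (f : borel T -> R).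
Proof.
move=> /continuousP cf; apply: (measurability _ (RGenOpens.measurableE R)).
move=> _ [_ [a [b ->]] <-]; rewrite setTI; apply: sub_sigma_algebra.
exact/cf/interval_open.
Qed.

Lemma measurable_coord i : measurable_fun setT (fun z : Rd => z 0 i).
Proof. by apply: continuous_borel => z; exact: coord_continuous. Qed.

Lemma measurable_normV : measurable_fun setT (fun z : Rd => `|z : 'rV[R]_d|).
Proof. by apply: continuous_borel => z; exact: norm_continuous. Qed.

Lemma closed_borel (C : set 'rV[R]_d) :
  closed C -> measurable (C : set Rd).
Proof.
move=> cC; rewrite -(setCK C); apply: measurableC; apply: sub_sigma_algebra.
exact: closed_openC.
Qed.

Lemma open_borel (O : set 'rV[R]_d) : open O -> measurable (O : set Rd).
Proof. by move=> oO; apply: sub_sigma_algebra. Qed.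

Lemma borel_set1 (z : 'rV[R]_d) : measurable ([set z] : set Rd).
Proof. apply: closed_borel; exact/accessible_closed_set1/hausdorff_accessible/norm_hausdorff. Qed.

Lemma coord_le_norm (z : 'rV[R]_d) i : `|z 0 i| <= `|z|.
Proof. by rewrite [leRHS]mx_normrE; apply: (le_bigmax _ _ (0, i)). Qed.

Lemma norm_leP (z : 'rV[R]_d) (r : R) : 0 <= r ->
  reflect (forall i, `|z 0 i| <= r) (`|z| <= r).
Proof.
move=> r0; apply: (iffP idP) => [zr i|zr]; first exact: le_trans (coord_le_norm _ _) zr.
by rewrite [leLHS]mx_normrE; apply/bigmax_leP; split=> // -[i j] _; rewrite ord1.
Qed.

Lemma norm_ltP (z : 'rV[R]_d) (r : R) : 0 < r ->
  reflect (forall i, `|z 0 i| < r) (`|z| < r).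
Proof.
move=> r0; apply: (iffP idP) => [zr i|zr]; first exact: le_lt_trans (coord_le_norm _ _) zr.
by rewrite [ltLHS]mx_normrE; apply/bigmax_ltP; split=> // -[i j] _; rewrite ord1.
Qed.

Lemma norm_le_enorm (z : 'rV[R]_d) : `|z| <= enorm z.
Proof.
apply/norm_leP; first exact: sqrtr_ge0.
move=> i; rewrite -sqrtr_sqr ler_wsqrtr// (bigD1 i)//= lerDl.
by apply: sumr_ge0 => j _; exact: sqr_ge0.
Qed.

Lemma measurable_enorm : measurable_fun setT (fun z : Rd => enorm z).
Proof.
have ms : measurable_fun setT (fun z : Rd => \sum_(i < d) z 0 i ^+ 2).
  by apply: measurable_sum => i; apply: measurable_funX; exact: measurable_coord.
apply: (measurableT_comp _ ms); apply: continuous_measurable_fun.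
exact: sqrt_continuous.
Qed.

Definition rat_box (c : 'rV[rat]_d) (n : nat) : set 'rV[R]_d :=
  [set z | `|z - map_mx ratr c| <= n.+1%:R^-1].

Lemma rat_box_nbhs (O : set 'rV[R]_d) x : open O -> O x -> exists c n,
  `|x - map_mx ratr c| < n.+1%:R^-1 /\ rat_box c n `<=` O.
Proof.
move=> oO Ox; have /nbhs_ballP[e /= e0 eO] := open_nbhs_nbhs (conj oO Ox).
have e2 : 0 < e / 2 by rewrite divr_gt0.
have [n ne] := ltr_add_invr e2.
rewrite add0r in ne.
have n0 : 0 < n.+1%:R^-1 :> R by rewrite invr_gt0.
have /choice[c cP] (i : 'I_d) :
    exists q : rat, `|x 0 i - ratr q| < n.+1%:R^-1 :> R.
  have /rat_in_itvoo[q] : x 0 i - n.+1%:R^-1 < x 0 i by rewrite ltrBlDr ltrDl.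
  rewrite in_itv /= => /andP[q1 q2].
  by exists q; rewrite ger0_norm ?subr_ge0 ?ltW// ltrBlDl -ltrBlDr.
exists (\row_i c i), n; have xc : `|x - map_mx ratr (\row_i c i)| < n.+1%:R^-1.
  by apply/norm_ltP => // i; rewrite !mxE.
split=> // z zc; apply: eO; rewrite -ball_normE /=.
rewrite -(subrK (map_mx ratr (\row_i c i)) x) -addrA -(opprB z).
apply: le_lt_trans (ler_normD _ _) _; rewrite normrN (splitr e) ltrD//.
  exact: lt_trans xc ne.
exact: le_lt_trans zc ne.
Qed.

Lemma rat_box_closed c n : closed (rat_box c n).
Proof.
have -> : rat_box c n = (fun z => `|z - map_mx ratr c|) @^-1`
    [set r : R | r <= n.+1%:R^-1] by [].
apply: (preimage_closed _ (@closed_le _ _)) => z _; apply: continuous_comp; last exact: norm_continuous.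
apply: (@cvgB R 'rV[R]_d _ (nbhs z) (nbhs_filter z) id (fun=> map_mx ratr c)); first exact: (@cvg_id _ (nbhs z)).
exact: cvg_cst.
Qed.

(** Open sets are unions of closed rational boxes, so that it is enough to
    control countably many boxes. *)
Lemma measurable_open_boxes {dT} {T : measurableType dT} (X : T -> 'rV[R]_d) :
  (forall c n, measurable (X @^-1` rat_box c n)) ->
  measurable_fun setT (X : T -> Rd).
Proof.
move=> mX; apply: (measurability (open : set_system Rd)) => //.
move=> _ [V oV <-]; rewrite setTI.
have -> : X @^-1` V = \bigcup_(cn : 'rV[rat]_d * nat)
    [set w | rat_box cn.1 cn.2 (X w) /\ rat_box cn.1 cn.2 `<=` V].
  apply/seteqP; split => w /=.
    move=> /(rat_box_nbhs oV)[c [n [xc cO]]]; exists (c, n) => //.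
    by split=> //; exact: ltW.
  by case=> -[c n] _ /= [xc]; exact.
apply: countable_bigcupT_measurable => // -[c n].
have [cO|cO] := pselect (rat_box c n `<=` V); last first.
  rewrite [X in measurable X](_ : _ = set0)//.
  by apply/seteqP; split=> w // -[].
rewrite [X in measurable X](_ : _ = X @^-1` rat_box c n)//.
by apply/seteqP; split=> [w []//|w] /=.
Qed.

Lemma measurable_rV {dT} {T : measurableType dT} (X : T -> 'rV[R]_d) :
  (forall i, measurable_fun setT (fun w => X w 0 i)) ->
  measurable_fun setT (X : T -> Rd).
Proof.
move=> mX; apply: measurable_open_boxes => c n.
rewrite [X in measurable X](_ : _ = \bigcap_(i in [set: 'I_d])
    ((fun w => `|X w 0 i - ratr (c 0 i)|) @^-1` [set` `]-oo, n.+1%:R^-1]])).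
  apply: fin_bigcap_measurable => // i _; rewrite -[X in measurable X]setTI.
  apply: (measurableT_comp (@normr_measurable _ setT)) => //.
  by apply: measurable_funB => //; exact: measurable_cst.
apply/seteqP; split=> w /=.
  by move=> /norm_leP h i _; have := h _ i; rewrite /= in_itv /= !mxE; apply.
move=> h; apply/norm_leP => // i; have := h i I.
by rewrite /= in_itv /= !mxE.
Qed.

Lemma measurable_subV {dT} {T : measurableType dT} (X Y : T -> Rd) :
  measurable_fun setT X -> measurable_fun setT Y ->
  measurable_fun setT (fun w => X w - Y w : Rd).
Proof.
move=> mX mY; apply: measurable_rV => i.
under eq_fun do rewrite !mxE.
by apply: measurable_funB; exact: (measurableT_comp (measurable_coord i)).
Qed.

Lemma measurable_addV {dT} {T : measurableType dT} (X Y : T -> Rd) :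
  measurable_fun setT X -> measurable_fun setT Y ->
  measurable_fun setT (fun w => X w + Y w : Rd).
Proof.
move=> mX mY; apply: measurable_rV => i.
under eq_fun do rewrite !mxE.
by apply: measurable_funD; exact: (measurableT_comp (measurable_coord i)).
Qed.

Lemma measurable_limV {dT} {T : measurableType dT} (X : nat -> T -> Rd)
    (Y : T -> Rd) :
  (forall n, measurable_fun setT (X n)) ->
  (forall w, (X n w : 'rV[R]_d) @[n --> \oo] --> (Y w : 'rV[R]_d)) ->
  measurable_fun setT Y.
Proof.
move=> mX XY; apply: measurable_rV => i.
apply: (@measurable_fun_cvg _ T R setT (fun n w => X n w 0 i : R)) => [n|w _].
  exact: (measurableT_comp (measurable_coord i)).
exact: (cvg_comp _ (fun z : 'rV[R]_d => z 0 i) (XY w) (@coord_continuous _ _ _ 0 i _)).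
Qed.

End borel_euclidean.

(** * Coordinate maps of the Skorohod space *)

Section coordinates.
Context {R : realType} {d : nat}.
Local Notation Rd := (borel 'rV[R]_d).
Local Notation path_space := (borel (cadlag R d)).

Lemma near_right_itv (s : R) (P : set R) : (\forall r \near s^'+, P r) ->
  exists2 e, 0 < e & forall r, s < r < s + e -> P r.
Proof.
rewrite near_withinE => /nbhs_ballP[e /= e0 eP]; exists e => // r /andP[sr rse].
by apply: eP => //; rewrite /ball /= ltr_distlC; apply/andP; split=> //; lra.
Qed.

Lemma near_left_itv (s : R) (P : set R) : (\forall r \near s^'-, P r) ->
  exists2 e, 0 < e & forall r, s - e < r < s -> P r.
Proof.
rewrite near_withinE => /nbhs_ballP[e /= e0 eP]; exists e => // r /andP[sr rse].
by apply: eP => //; rewrite /ball /= ltr_distlC; apply/andP; split=> //; lra.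
Qed.

(** A time change in a Skorohod neighbourhood moves a visit of the open set [O]
    by less than its distance to the end points of the time interval. *)
Lemma open_visit (a b : R) (O : set 'rV[R]_d) : 0 <= a -> open O ->
  open [set w : cadlag R d | exists2 r, a < r < b & O (w r)].
Proof.
move=> a0 oO; suff : skorohod_open [set w : cadlag R d | exists2 r, a < r < b & O (w r)] by [].
move=> w [r /andP[ar rb] Owr].
have /nbhs_ballP[e /= e0 eO] := open_nbhs_nbhs (conj oO Owr).
exists r, (Num.min e (Num.min (r - a) (b - r))).
split; first by rewrite !lt_min e0 !subr_gt0 ar.
move=> w' [lam [_ lamP ww']]; have r0 : 0 <= r by rewrite (le_trans a0) ?ltW.
have := lamP r r0; rewrite !lt_min => /and3P[_ /ltr_normlP[l1 _] /ltr_normlP[_ l2]].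
exists (lam r).
  by move: l1 l2; rewrite opprB ltrBrDr => l1; rewrite ltrBlDr subrK => ->; lra.
apply: eO; rewrite -ball_normE /=.
have := ww' r; rewrite r0 lexx => /(_ isT); rewrite lt_min => /andP[h _].
by rewrite distrC; apply: le_lt_trans h; exact: norm_le_enorm.
Qed.

(** By right continuity, [w s] lies in an open set iff [w] stays in one of its
    closed rational boxes just after [s]. *)
Lemma measurable_path s : 0 <= s ->
  measurable_fun setT (fun w : path_space => (w : cadlag R d) s : Rd).
Proof.
move=> s0; apply: (measurability (open : set_system Rd)) => //.
move=> _ [V oV <-]; rewrite setTI.
pose E (x : 'rV[rat]_d * nat * nat) : set path_space :=
  [set w | forall r, s < r < s + x.2.+1%:R^-1 -> rat_box x.1.1 x.1.2 ((w : cadlag R d) r)].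
have mE x : measurable (E x).
  rewrite [E x](_ : _ = ~` [set w : cadlag R d | exists2 r,
      s < r < s + x.2.+1%:R^-1 & (~` @rat_box R d x.1.1 x.1.2) (w r)]); last first.
    apply/seteqP; split=> w /= h; first by move=> [r /h].
    by move=> r rs; apply: contrapT => nr; apply: h; exists r.
  apply: measurableC; apply: sub_sigma_algebra; apply: open_visit => //.
  exact/closed_openC/rat_box_closed.
rewrite (_ : _ @^-1` V = \bigcup_(x : 'rV[rat]_d * nat * nat)
    [set w | E x w /\ @rat_box R d x.1.1 x.1.2 `<=` V]).
  apply: countable_bigcupT_measurable => // x.
  have [xV|xV] := pselect (@rat_box R d x.1.1 x.1.2 `<=` V); last first.
    by rewrite [X in measurable X](_ : _ = set0)// -subset0 => w [].
  by rewrite [X in measurable X](_ : _ = E x)//; apply/seteqP; split=> [w []|].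
apply/seteqP; split=> w /=.
  move=> /(rat_box_nbhs oV)[c [n [wc cV]]].
  have [m mP] : exists m : nat, forall r, s < r < s + m.+1%:R^-1 ->
      rat_box c n ((w : cadlag R d) r).
    have e0 : 0 < n.+1%:R^-1 - `|(w : cadlag R d) s - map_mx ratr c| by rewrite subr_gt0.
    have /cvgrPdist_lt/(_ _ e0)/near_right_itv[e e1 eP] := @path_rcont _ _ w s.
    have [m me] := ltr_add_invr e1; rewrite add0r in me.
    exists m => r /andP[sr rs]; rewrite /rat_box /=.
    rewrite -(subrK ((w : cadlag R d) s) ((w : cadlag R d) r)) -addrA.
    apply: le_trans (ler_normD _ _) _; rewrite -lerBrDr distrC ltW// eP// sr.
    by apply: lt_trans rs _; rewrite ltrD2l.
  by exists (c, n, m).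
move=> [[[c n] m] _ /= [Ew]]; apply.
apply: (@closed_cvg _ _ s^'+ _ (fun r => (w : cadlag R d) r) _ (@rat_box_closed R d c n)).
  near=> r; apply: Ew; apply/andP; split.
    by near: r; exact: nbhs_right_gt.
  near: r; apply: nbhs_right_lt; rewrite ltrDl invr_gt0//.
exact: path_rcont.
Unshelve. all: by end_near. Qed.

End coordinates.

(** * Jumps of cadlag paths *)

Section jumps.
Context {R : realType} {d : nat}.
Local Notation Rd := (borel 'rV[R]_d).
Implicit Types (w : cadlag R d) (u a b e : R).

Lemma subr_shift (V : zmodType) (x y z j : V) :
  (x - y) - j = (x - z) - (y - (z - j)).
Proof. by rewrite opprB addrA subrKA addrAC. Qed.

Lemma left_limitE w u : w r @[r --> u^'-] --> w u - jump w u.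
Proof. by rewrite /jump opprB addrC subrK; exact: path_llim. Qed.

Arguments left_limitE : clear implicits.

Lemma jump_unique w u (x : 'rV[R]_d) :
  w r @[r --> u^'-] --> w u - x -> jump w u = x.
Proof.
move=> /(cvg_lim (@norm_hausdorff _ _)) h.
by rewrite /jump h opprB addrC subrK.
Qed.

Lemma jump_stopped w (T u : R) : u <= T -> jump (stopped T w) u = jump w u.
Proof.
move=> uT; apply: jump_unique; rewrite /= (min_l uT).
apply: (@cvg_trans _ (w r @[r --> u^'-])); last exact: left_limitE.
apply: near_eq_cvg; near=> r.
rewrite min_l//; apply: le_trans uT; apply: ltW; near: r.
exact: nbhs_left_lt.
Unshelve. all: by end_near. Qed.

Lemma jump_stopped_gt w (T u : R) : T < u -> jump (stopped T w) u = 0.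
Proof.
move=> uT; apply: jump_unique; rewrite /= (min_r (ltW uT)) subr0.
apply: cvg_near_cst; near=> r.
by rewrite min_r//; apply: ltW; near: r; exact: nbhs_left_gt.
Unshelve. all: by end_near. Qed.

Lemma oscillation w u e : 0 < e -> exists2 delta, 0 < delta &
  (forall p, u - delta < p < u -> `|w p - (w u - jump w u)| < e) /\
  (forall q, u <= q < u + delta -> `|w q - w u| < e).
Proof.
move=> e0.
have /cvgrPdist_lt/(_ _ e0)/near_left_itv[e1 e10 e1P] := left_limitE w u.
have /cvgrPdist_lt/(_ _ e0)/near_right_itv[e2 e20 e2P] := @path_rcont _ _ w u.
exists (Num.min e1 e2); first by rewrite lt_min e10.
split=> [p /andP[up pu]|q /andP[]].
  rewrite distrC; apply: e1P; rewrite pu andbT; apply: le_lt_trans up.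
  by rewrite lerD2l lerN2 ge_min lexx.
rewrite le_eqVlt => /predU1P[<-|uq] qu; first by rewrite subrr normr0.
rewrite distrC; apply: e2P; rewrite uq; apply: lt_le_trans qu _.
by rewrite lerD2l ge_min lexx orbT.
Qed.

Lemma small_jump w a b e (z : 'rV[R]_d) :
  (forall p, a < p < b -> `|w p - z| < e) ->
  forall v, a < v < b -> `|jump w v| <= e *+ 2.
Proof.
move=> wz v /[dup] vab /andP[av vb].
have : `|w r - w v| @[r --> v^'-] --> `|jump w v|.
  rewrite -normrN (_ : - jump w v = w v - jump w v - w v); last first.
    by rewrite addrAC subrr add0r.
  by apply: cvg_norm; apply: cvgB; [exact: left_limitE|exact: cvg_cst].
move/cvgr_to_le; apply; near=> r.
rewrite (_ : w r - w v = (w r - z) - (w v - z)); last by rewrite opprB addrA subrK.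
apply: le_trans (ler_normB _ _) _; rewrite mulr2n lerD// ltW ?wz//.
apply/andP; split.
  by near: r; exact: nbhs_left_gt.
by apply: lt_trans vb; near: r; exact: nbhs_left_lt.
Unshelve. all: by end_near. Qed.

(** Around each point the oscillation on either side is small, so that large
    jumps are isolated; conclude by compactness. *)
Lemma finite_large_jumps w a b e : 0 < e ->
  finite_set [set u | a <= u <= b /\ e <= `|jump w u|].
Proof.
move=> e0; have e4 : 0 < e / 4 by rewrite divr_gt0.
have /choice[del delP] u : exists del, 0 < del /\
    ((forall p, u - del < p < u -> `|w p - (w u - jump w u)| < e / 4) /\
     (forall q, u <= q < u + del -> `|w q - w u| < e / 4)).
  by have [del ? ?] := oscillation w u e4; exists del.
have := @segment_compact R a b; rewrite compact_cover.
move=> /(_ R setT (fun u => ball u (del u))) [u _|u _|D _ abD].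
- exact: ball_open.
- by exists u => //; apply: ballxx; have [] := delP u.
apply: (sub_finite_set _ (finite_fset D)) => u [uab ju].
have [v vD vu] := abD u uab; have [uv|uv] := eqVneq u v; first by rewrite uv.
exfalso; have [_ [oscl oscr]] := delP v.
have : `|jump w u| <= (e / 4) *+ 2.
  move: vu; rewrite /ball /= ltr_distlC => /andP[vu1 vu2].
  have [{}uv|{}uv|//] := ltgtP u v; last by move/eqP: uv.
    by apply: small_jump oscl _ _; rewrite vu1.
  apply: (small_jump (a := v) (b := v + del v) (z := w v)) => [q /andP[vq qv]|]; last by apply/andP; split.
  by apply: oscr; rewrite (ltW vq).
by apply/negP; rewrite -ltNge; apply: lt_le_trans ju; lra.
Qed.

(** The short intervals accumulate at some time [u]. Increments over intervals on
    one side of [u] are too small to lie in [F]; those over intervals that straddle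
    [u] come close to the jump at [u], and [F] is closed. *)
Lemma short_increment_jump w a b (F : set 'rV[R]_d) : closed F -> ~ F 0 ->
  (forall n : nat, exists p q, [/\ a < p, p < q, q < b, q - p < n.+1%:R^-1 &
     F (w q - w p)]) ->
  exists2 u, a < u < b & F (jump w u).
Proof.
move=> cF F0 /choice[p /choice[q pq]].
have ab n : p n \in `[a, b].
  have [ap pq' qb _ _] := pq n.
  by rewrite in_itv /= (ltW ap) (ltW (lt_trans pq' qb)).
have [u [_ cu]] : `[a, b] `&` cluster (p @ \oo) !=set0.
  by apply: segment_compact; exists 0%N => // n _; exact: ab.
have oF : nbhs (0 : 'rV[R]_d) (~` F) by apply: open_nbhs_nbhs; split => //; exact: closed_openC.
have [e0 /= e00 e0P] := (nbhs_ballP _ _).1 oF.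
have small (x y z : 'rV[R]_d) e : e <= e0 -> `|x - z| < e / 2 -> `|y - z| < e / 2 -> ~ F (x - y).
  move=> ee0 xz yz; apply: e0P; rewrite -ball_normE /= sub0r normrN.
  rewrite (_ : x - y = (x - z) - (y - z)); last by rewrite opprB addrA subrK.
  apply: le_lt_trans (ler_normB _ _) _; apply: lt_le_trans ee0.
  by rewrite (splitr e) ltrD.
have key e : 0 < e -> e <= e0 -> a < u < b /\ exists z, F z /\ `|z - jump w u| < e.
  move=> e_gt0 ee0; have e2 : 0 < e / 2 by rewrite divr_gt0.
  have [del del0 [oscl oscr]] := oscillation w u e2.
  have del2 : 0 < del / 2 by rewrite divr_gt0.
  have [N NP] := ltr_add_invr del2; rewrite add0r in NP.
  have [] := cu [set p n | n in [set n | (N <= n)%N]] (ball u (del / 2)).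
  - by exists N => // n /= Nn; exists n.
  - exact: nbhsx_ballx.
  move=> _ [[n /= Nn <-]].
  have [ap pq' qb qp Fpq] := pq n.
  rewrite /ball /= ltr_distlC => /andP[upl upr].
  have qp' : q n - p n < del / 2.
    apply: lt_trans NP; apply: lt_le_trans qp _.
    by rewrite lef_pV2 ?posrE// ler_nat.
  have [pu|up] := ltP (p n) u; last first.
    exfalso; apply: small ee0 (oscr (q n) _) (oscr (p n) _) Fpq.
      by apply/andP; split; lra.
    by apply/andP; split; lra.
  have [qu|uq] := ltP (q n) u.
    exfalso; apply: small ee0 (oscl (q n) _) (oscl (p n) _) Fpq.
      by apply/andP; split; lra.
    by apply/andP; split; lra.
  split; first by apply/andP; split; lra.
  exists (w (q n) - w (p n)); split=> //.
  rewrite (subr_shift _ _ (w u)).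
  apply: le_lt_trans (ler_normB _ _) _; rewrite (splitr e) ltrD//.
    by apply: oscr; apply/andP; split; lra.
  by apply: oscl; apply/andP; split; lra.
exists u; first by have [] := key _ e00 (lexx _).
apply: cF => B /nbhs_ballP[e /= e_gt0 eB].
have m0 : 0 < Num.min e e0 by rewrite lt_min e_gt0.
have [|_ [z [Fz zj]]] := key _ m0; first by rewrite ge_min lexx orbT.
exists z; split=> //; apply: eB; rewrite -ball_normE /= distrC.
by apply: lt_le_trans zj _; rewrite ge_min lexx.
Unshelve. all: by end_near. Qed.

(** The left limit at a jump time and the value there are approached at rational
    times on either side. *)
Lemma jump_short_increment w a b u (V : set 'rV[R]_d) (n : nat) :
  a < u < b -> nbhs (jump w u) V ->
  exists p q : rat, [/\ a < ratr p, ratr p < ratr q :> R, ratr q < b,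
    ratr q - ratr p < n.+1%:R^-1 :> R & V (w (ratr q) - w (ratr p))].
Proof.
move=> /andP[au ub] /nbhs_ballP[e /= e0 eV].
have e2 : 0 < e / 2 by rewrite divr_gt0.
have [del del0 [oscl oscr]] := oscillation w u e2.
have n0 : 0 < n.+1%:R^-1 / 2 :> R by rewrite divr_gt0 ?invr_gt0.
have /rat_in_itvoo[p] : Num.max a (Num.max (u - del) (u - n.+1%:R^-1 / 2)) < u.
  by rewrite !gt_max; apply/and3P; split=> //; rewrite ltrBlDr ltrDl.
rewrite in_itv /= !gt_max => /andP[/and3P[ap dp np] pu].
have /rat_in_itvoo[q] : u < Num.min b (Num.min (u + del) (u + n.+1%:R^-1 / 2)).
  by rewrite !lt_min; apply/and3P; split=> //; rewrite ltrDl.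
rewrite in_itv /= !lt_min => /andP[uq /and3P[qb dq nq]].
exists p, q; split => //; first exact: lt_trans pu uq.
  rewrite (splitr n.+1%:R^-1) -(subrKA u) ltrD//; first by rewrite ltrBlDl.
  by rewrite ltrBlDr -ltrBlDl.
apply: eV; rewrite -ball_normE /= distrC.
rewrite (subr_shift _ _ (w u)).
apply: le_lt_trans (ler_normB _ _) _; rewrite (splitr e) ltrD//.
  by apply: oscr; rewrite (ltW uq).
by apply: oscl; rewrite pu andbT.
Qed.

End jumps.

(** * Counting jumps *)

Section jump_count.
Context {R : realType} {d : nat}.
Local Notation Rd := (borel 'rV[R]_d).
Local Open Scope ereal_scope.

Definition jump_times (I : set R) (w : cadlag R d) (C : set Rd) : set R :=
  [set u | [/\ I u, jump w u <> 0%R & C (jump w u)]].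

Definition jump_count (I : set R) (w : cadlag R d) (C : set Rd) : \bar R :=
  \esum_(u in jump_times I w C) 1.

Section measure.
Variables (I : set R) (w : cadlag R d).

Let count0 : jump_count I w set0 = 0.
Proof.
rewrite /jump_count (_ : jump_times _ _ _ = set0) ?esum_set0//.
by rewrite -subset0 => u [].
Qed.

Let count_ge0 C : 0 <= jump_count I w C.
Proof. by apply: esum_ge0. Qed.

Let count_sigma_additive : semi_sigma_additive (jump_count I w).
Proof.
move=> F mF tF mUF.
rewrite (_ : jump_count I w _ = \sum_(0 <= i <oo) jump_count I w (F i)).
  by apply: is_cvg_nneseries => n _ _; exact: count_ge0.
rewrite /jump_count (_ : jump_times _ _ _ = \bigcup_i jump_times I w (F i)).
  rewrite esum_bigcupT//; first by rewrite nneseries_esumT// => n; exact: esum_ge0.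
  by move=> i j _ _ [u [[_ _ Fi] [_ _ Fj]]]; apply: tF => //; exists (jump w u).
apply/seteqP; split=> u /=; first by move=> [Iu u0 [i _ Fi]]; exists i.
by move=> [i _ [Iu u0 Fi]]; split=> //; exists i.
Qed.

HB.instance Definition _ := isMeasure.Build _ _ _ (jump_count I w)
  count0 count_ge0 count_sigma_additive.
End measure.

Lemma jump_count_finite I w C : finite_set (jump_times I w C) ->
  jump_count I w C = #|` fset_set (jump_times I w C)|%:R%:E.
Proof.
move=> fS; rewrite /jump_count esum_fset// fsbig_finite//= sumEFin.
by rewrite big_const_seq count_predT iter_addr_0.
Qed.

Lemma finite_jump_times w a b e C : (0 < e)%R ->
  (forall z, C z -> (e <= `|z : 'rV[R]_d|)%R) ->
  finite_set (jump_times `]a, b[ w C).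
Proof.
move=> e0 Ce; apply: sub_finite_set (finite_large_jumps w a b e0) => u.
move=> [/= + _ /Ce]; rewrite in_itv /= => /andP[au ub] eu; split=> //.
by rewrite (ltW au) (ltW ub).
Qed.

Lemma seq_has_max (s : seq R) : s != [::] ->
  exists2 m, m \in s & forall x, x \in s -> (x <= m)%R.
Proof.
elim: s => // x [|y s] IH _; first by exists x; rewrite ?inE// => z; rewrite inE => /eqP ->.
have [m ms mP] := IH isT; exists (Num.max x m).
  by rewrite /Num.max; case: ifP; rewrite inE ?ms ?orbT ?eqxx.
move=> z; rewrite inE le_max => /predU1P[->|/mP ->]; first by rewrite lexx.
by rewrite orbT.
Qed.

(** Measurability is required of the increments of [Y] alone, so that the counts
    become measurable for a sigma-algebra that knows only the increments after
    some time: this is what independence of the past calls for. *)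
Section measurable_process.
Context {dT} {T : measurableType dT} (Y : T -> cadlag R d).

Section open_window.
Variables (a b : R) (V : set 'rV[R]_d).
Hypothesis mY : forall p q, (a < p)%R -> (p < q)%R -> (q < b)%R ->
  measurable_fun setT (fun x => Y x q - Y x p : Rd)%R.
Hypotheses (oV : open V) (V0 : ~ V 0%R).

(** A jump in an open set shows up in increments over arbitrarily short rational
    intervals that lie in one closed box inside the set; conversely such
    increments accumulate at a jump in the box. *)
Lemma measurable_jump_in :
  measurable [set x | exists2 u, (a < u < b)%R & V (jump (Y x) u)].
Proof.
pose Z (c : 'rV[rat]_d) (n : nat) := \bigcap_(m : nat) \bigcup_(pq : rat * rat)
  [set x | [/\ a < ratr pq.1, ratr pq.1 < ratr pq.2 :> R, ratr pq.2 < b,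
     ratr pq.2 - ratr pq.1 < m.+1%:R^-1 :> R &
     rat_box c n (Y x (ratr pq.2) - Y x (ratr pq.1))]]%R.
have mZ c n : measurable (Z c n).
  apply: bigcap_measurableType => m _; apply: countable_bigcupT_measurable => // -[p q].
  have [[ap pq qb qpm]|pq] := pselect [/\ a < ratr p, ratr p < ratr q :> R,
     ratr q < b & ratr q - ratr p < m.+1%:R^-1 :> R]%R; last first.
    rewrite [X in measurable X](_ : _ = set0)// -subset0 => x [ap pq' qb qpm _].
    by apply: pq.
  rewrite [X in measurable X](_ : _ =
      (fun x => Y x (ratr q) - Y x (ratr p))%R @^-1` @rat_box R d c n); last first.
    by apply/seteqP; split=> x //= [].
  rewrite -[X in measurable X]setTI; apply: mY => //.
  exact: (closed_borel (@rat_box_closed R d c n)).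
rewrite (_ : [set x | _] = \bigcup_(cn : 'rV[rat]_d * nat)
    [set x | Z cn.1 cn.2 x /\ @rat_box R d cn.1 cn.2 `<=` V]).
  apply: countable_bigcupT_measurable => // -[c n].
  have [cV|cV] := pselect (@rat_box R d c n `<=` V); last first.
    by rewrite [X in measurable X](_ : _ = set0)// -subset0 => x [].
  by rewrite [X in measurable X](_ : _ = Z c n)//; apply/seteqP; split=> [x []|].
apply/seteqP; split=> x /=.
  move=> [u uab Vu]; have [c [n [uc cV]]] := rat_box_nbhs oV Vu.
  exists (c, n) => //; split=> // m _.
  have : nbhs (jump (Y x) u) (@rat_box R d c n).
    have e0 : (0 < n.+1%:R^-1 - `|jump (Y x) u - map_mx ratr c|)%R by rewrite subr_gt0.
    apply/nbhs_ballP; exists (n.+1%:R^-1 - `|jump (Y x) u - map_mx ratr c|)%R => //= z.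
    rewrite -ball_normE /= ltrBrDr => h; apply: ltW; apply: le_lt_trans h.
    by rewrite (distrC _ z) -(subrKA (jump (Y x) u)); exact: ler_normD.
  by move=> /(jump_short_increment m uab)[p [q h]]; exists (p, q).
move=> [[c n] _ /= [Zx cV]].
have [|m|u uab Fu] := @short_increment_jump R d (Y x) a b (rat_box c n) (@rat_box_closed R d c n).
- by move=> /cV.
- have [[p q] _ /= [ap pq qb qpm Fpq]] := Zx m I.
  by exists (ratr p), (ratr q); split.
by exists u => //; exact: cV.
Qed.

End open_window.

Section open_count.
Variables (V : set 'rV[R]_d) (e : R).
Hypotheses (oV : open V) (e0 : (0 < e)%R) (Ve : forall z, V z -> (e <= `|z|)%R).

Let V0 : ~ V 0%R.
Proof. by move=> /Ve; rewrite normr0 leNgt e0. Qed.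

Let S a b x : {fset R} := fset_set (jump_times `]a, b[ (Y x) V).

Let SP a b x u : (u \in S a b x) <-> (a < u < b)%R /\ V (jump (Y x) u).
Proof.
rewrite in_fset_set; last exact: finite_jump_times e0 Ve.
split=> [/set_mem|].
  by rewrite /jump_times /= in_itv /= => -[uab _ Vu]; split.
move=> [uab Vu]; apply/mem_set; rewrite /jump_times /= in_itv /=; split=> //.
by move=> j0; apply: V0; rewrite -j0.
Qed.

(** [k + 1] jumps in an interval can be separated by a rational into [k] jumps
    before it and one jump after it. *)
Lemma measurable_count_ge k a b :
  (forall p q, (a < p)%R -> (p < q)%R -> (q < b)%R ->
    measurable_fun setT (fun x => Y x q - Y x p : Rd)%R) ->
  measurable [set x | (k <= #|` S a b x|)%N].
Proof.
elim: k a b => [|k IH] a b mY; first by rewrite [X in measurable X](_ : _ = setT)//; exact/seteqP.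
rewrite [X in measurable X](_ : _ = \bigcup_(c : rat) [set x | (a < ratr c < b)%R /\
    ((k <= #|` S a (ratr c) x|)%N /\
     exists2 u, (ratr c < u < b)%R & V (jump (Y x) u))]).
  apply: bigcupT_measurable_rat => c.
  have [/andP[ac cb]|nc] := boolP (a < ratr c < b)%R; last first.
    by rewrite [X in measurable X](_ : _ = set0)// -subset0 => x [].
  have := measurableI _ _ (IH a (ratr c) _) (@measurable_jump_in (ratr c) b V _ oV V0).
  rewrite (_ : _ `&` _ = [set x | true /\ ((k <= #|` S a (ratr c) x|)%N /\
     exists2 u, (ratr c < u < b)%R & V (jump (Y x) u))]); last first.
    by apply/seteqP; split=> x /= [] // _ [].
  apply => p q.
    by move=> ap pq qc; apply: mY => //; exact: lt_trans cb.
  by move=> cp pq qb; apply: mY => //; exact: lt_trans cp.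
apply/seteqP; split=> x /=.
  move=> kS; have S0 : (S a b x : seq R) != [::].
    by apply/negP => /eqP h; move: kS; rewrite h.
  have [m mS mP] := seq_has_max S0.
  have /SP[/andP[am mb] Vm] := mS.
  have [M Ms MP] := @seq_has_max (a :: (S a b x `\ m)%fset) isT.
  have /rat_in_itvoo[c] : (M < m)%R.
    move: Ms; rewrite inE => /predU1P[->//|]; rewrite !inE => /andP[im iS].
    by rewrite lt_neqAle im mP.
  rewrite in_itv /= => /andP[Mc cm].
  have ac : (a < ratr c)%R by apply: le_lt_trans Mc; apply: MP; rewrite inE eqxx.
  exists c => //; split; first by rewrite ac (lt_trans cm).
  split; last by exists m => //; rewrite cm.
  move: kS; rewrite (cardfsD1 m) mS ltnS => /leq_trans; apply.
  apply: fsubset_leq_card; apply/fsubsetP => u uS.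
  have uM : (u <= M)%R by apply: MP; rewrite inE uS orbT.
  move: uS; rewrite !inE => /andP[_ /SP[/andP[au _] Vu]].
  by apply/SP; split=> //; rewrite au (le_lt_trans uM).
move=> [c _ [/andP[ac cb] [kS [u /andP[cu ub] Vu]]]].
have uS : u \notin S a (ratr c) x.
  by apply/negP => /SP[/andP[_]]; rewrite ltNge (ltW cu).
have := cardfsU1 u (S a (ratr c) x); rewrite uS add1n => h.
apply: (@leq_trans (#|` S a (ratr c) x|).+1); first by [].
rewrite -h; apply: fsubset_leq_card; apply/fsubsetP => v.
rewrite !inE => /predU1P[->|/SP[/andP[av vc] Vv]].
  by apply/SP; split=> //; rewrite (lt_trans ac cu) ub.
by apply/SP; split=> //; rewrite av (lt_trans vc cb).
Qed.

Lemma measurable_jump_count_open a b :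
  (forall p q, (a < p)%R -> (p < q)%R -> (q < b)%R ->
    measurable_fun setT (fun x => Y x q - Y x p : Rd)%R) ->
  measurable_fun setT (fun x => jump_count `]a, b[ (Y x) V).
Proof.
move=> mY.
rewrite (_ : (fun _ => _) = (fun x => #|` S a b x|%:R%:E)); last first.
  by apply/funext => x; rewrite jump_count_finite//; exact: finite_jump_times e0 Ve.
apply/measurable_EFinP.
have mn : measurable_fun setT (fun x => #|` S a b x|).
  move=> _ B _; rewrite setTI.
  rewrite (_ : _ @^-1` B = \bigcup_(k in B) ([set x | (k <= #|` S a b x|)%N] `\`
      [set x | (k.+1 <= #|` S a b x|)%N])).
    by apply: bigcup_measurable => k _; apply: measurableD; exact: measurable_count_ge.
  apply/seteqP; split=> x /=; first by move=> Bx; exists #|` S a b x| => //=; rewrite ltnn.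
  by move=> [k Bk /= [h1 /negP]]; rewrite -leqNgt => h2; rewrite (_ : #|` S a b x| = k)//; apply/eqP; rewrite eqn_leq h2.
by apply: (@measurableT_comp _ _ _ _ _ _ (fun n : nat => n%:R : R)%R) => // _ B _.
Qed.

End open_count.

Let window (j : nat) : set Rd := [set z | (j.+1%:R^-1 < `|z : 'rV[R]_d|)%R].

Let window_open j : open (window j : set 'rV[R]_d).
Proof.
have -> : window j = (fun z : 'rV[R]_d => `|z|%R) @^-1` [set r | (j.+1%:R^-1 < r)%R] by [].
by apply: open_comp; [move=> z _; exact: norm_continuous|exact: open_gt].
Qed.

Let window_pos j : (0 < j.+1%:R^-1 :> R)%R. Proof. by rewrite invr_gt0. Qed.

(** Finiteness of the counts in a window away from 0 makes them stable under
    complement, so that open sets suffice there; the windows exhaust all jumps. *)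
Lemma measurable_jump_count a b (C : set Rd) :
  (forall p q, (a < p)%R -> (p < q)%R -> (q < b)%R ->
    measurable_fun setT (fun x => Y x q - Y x p : Rd)%R) ->
  measurable C ->
  measurable_fun setT (fun x => jump_count `]a, b[ (Y x) C).
Proof.
move=> mY mC.
have mw j : measurable (window j) by exact: open_borel.
have mj j : measurable_fun setT (fun x => jump_count `]a, b[ (Y x) (C `&` window j)).
  pose P (C : set Rd) := measurable_fun setT (fun x => jump_count `]a, b[ (Y x) (C `&` window j)).
  have mO (V : set 'rV[R]_d) : open V -> P V.
    move=> oV; apply: (@measurable_jump_count_open _ j.+1%:R^-1%R) => //.
      exact: openI.
    by move=> z [_ /ltW].
  apply: (@dynkin_induction _ Rd (open : set_system 'rV[R]_d) P) => //.
  - by move=> A B; exact: openI.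
  - by apply: mO; exact: openT.
  - move=> D mD PD; rewrite /P.
    have -> : (fun x => jump_count `]a, b[ (Y x) (~` D `&` window j)) =
        (fun x => jump_count `]a, b[ (Y x) (setT `&` window j) -
                  jump_count `]a, b[ (Y x) (D `&` window j)).
      apply/funext => x; rewrite setTI.
      have fin E : E `<=` window j -> jump_count `]a, b[ (Y x) E < +oo.
        move=> Ew; rewrite jump_count_finite ?ltry//.
        by apply: finite_jump_times (window_pos j) _ => z /Ew /ltW.
      rewrite (setIC (~` D)) -setDE measureD//; first by rewrite (setIC _ D).
      exact: fin.
    by apply: emeasurable_funB => //; apply: mO; exact: openT.
  - move=> F mF tF PF; rewrite /P.
    have -> : (fun x => jump_count `]a, b[ (Y x) (\bigcup_k F k `&` window j)) =
        (fun x => \sum_(0 <= k <oo) jump_count `]a, b[ (Y x) (F k `&` window j)).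
      apply/funext => x; rewrite setI_bigcupl measure_semi_bigcup//.
      - by move=> k; exact: measurableI.
      - exact: trivIset_setIr.
      - by apply: bigcup_measurable => k _; exact: measurableI.
    by apply: ge0_emeasurable_sum => k *; [exact: measure_ge0|exact: PF].
apply: (emeasurable_fun_cvg (fun j x => jump_count `]a, b[ (Y x) (C `&` window j))) => //.
move=> x _.
rewrite (_ : jump_count `]a, b[ (Y x) C =
   jump_count `]a, b[ (Y x) (\bigcup_j (C `&` window j))).
  apply: nondecreasing_cvg_mu.
  - by move=> j; exact: measurableI.
  - by apply: bigcup_measurable => j _; exact: measurableI.
  - move=> i j ij; apply/subsetPset; apply: setIS => z /=; apply: le_lt_trans.
    by rewrite lef_pV2 ?posrE// ler_nat.
congr esum; apply/seteqP; split=> u /= [Iu u0]; last by move=> [j _ []].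
move=> Cu; split=> //.
have /ltr_add_invr[j] : (0 < `|jump (Y x) u|)%R by rewrite normr_gt0; exact/eqP.
by rewrite add0r => ju; exists j.
Qed.

End measurable_process.
End jump_count.

(** * The Poisson integral along a path *)

Section poisson_path.
Context {R : realType} {d : nat}.
Local Notation Rd := (borel 'rV[R]_d).
Local Notation path_space := (borel (cadlag R d)).

Lemma not_closure_away (A : set 'rV[R]_d) : ~ closure A 0 ->
  exists2 e : R, 0 < e & forall z, A z -> e <= `|z|.
Proof.
move=> A0; have [e e0 eA] : exists2 e : R, 0 < e & ball (0 : 'rV[R]_d) e `&` A = set0.
  apply: contrapT => h; apply: A0 => B /nbhs_ballP[e /= e0 eB].
  apply: contrapT => AB; apply: h; exists e => //; rewrite -subset0 => z [bz Az].
  by apply: AB; exists z; split=> //; exact: eB.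
exists e => // z Az; rewrite leNgt; apply/negP => ze.
have : (ball (0 : 'rV[R]_d) e `&` A) z by split=> //; rewrite -ball_normE /= sub0r normrN.
by rewrite eA.
Qed.

Lemma jump_count_stopped (s t : R) (w : cadlag R d) (C : set Rd) :
  jump_count `]s, t] w C = jump_count `]s, (t + 1)[ (stopped t w) C.
Proof.
congr esum; apply/seteqP; split=> u /=.
  move=> [+ u0 Cu]; rewrite /= in_itv /= => /andP[su ut]; split.
  - by rewrite /= in_itv /= su (le_lt_trans ut)// ltrDl.
  - by rewrite jump_stopped.
  - by rewrite jump_stopped.
move=> [+ + +]; rewrite /= in_itv /= => /andP[su _].
have [ut|tu] := leP u t; last by rewrite jump_stopped_gt.
by rewrite jump_stopped// => u0 Cu; split=> //; rewrite /= in_itv /= su.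
Qed.

Lemma measurable_jump_count_oc {dT} {T : measurableType dT} (Y : T -> cadlag R d)
    s t (C : set Rd) :
  (forall p q, s < p -> p <= q -> q <= t ->
    measurable_fun setT (fun x => Y x q - Y x p : Rd)) ->
  measurable C -> measurable_fun setT (fun x => jump_count `]s, t] (Y x) C).
Proof.
move=> mY mC.
rewrite (_ : (fun _ => _) = (fun x => jump_count `]s, (t + 1)[ (stopped t (Y x)) C)).
  apply: measurable_jump_count => // p q sp pq _.
  rewrite /=.
  have [pt|tp] := leP p t.
    by apply: mY; rewrite ?le_min ?pt ?(ltW pq)// ge_min lexx orbT.
  rewrite min_r ?(ltW (lt_trans tp pq))//.
  under eq_fun do rewrite subrr.
  exact: measurable_cst.
by apply/funext => x; exact: jump_count_stopped.
Qed.

Section fixed_set.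
Variables (A : set Rd) (e : R).
Hypotheses (mA : measurable A) (e0 : 0 < e) (Ae : forall z, A z -> e <= `|z : 'rV[R]_d|).
Variable t : R.
Implicit Types (w : path_space) (f g : Rd -> R).

Local Notation S w := (jump_times `]0, t] (w : cadlag R d) A).
Local Notation I := (poisson_integral A t).

Lemma finite_jumps_in w : finite_set (S w).
Proof.
apply: sub_finite_set (finite_jump_times w 0 (t + 1) e0 Ae) => u.
move=> [+ ? ?]; rewrite /= in_itv /= => /andP[u0 ut]; split=> //.
by rewrite /= in_itv /= u0 (le_lt_trans ut)// ltrDl.
Qed.

Lemma poisson_integralE f w :
  I f w = \sum_(u <- fset_set (S w)) f (jump (w : cadlag R d) u).
Proof.
rewrite -[RHS]fsbig_finite; last exact: finite_jumps_in.
rewrite /poisson_integral.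
rewrite -(fsbig_widen (S w) [set` `]0, t]]).
- by apply: eq_fsbigr => u /set_mem[_ _ Au]; rewrite indicE mem_set// mulr1.
- by move=> u [].
- move=> u [u0t Su] /=; rewrite indicE memNset ?mulr0// => Au; apply: Su.
  by split=> // j0; have := Ae Au; rewrite j0 normr0 leNgt e0.
Qed.

Lemma poisson_integral_lin (a b : R) f g w :
  I (fun z => a * f z + b * g z) w = a * I f w + b * I g w.
Proof. by rewrite !poisson_integralE !mulr_sumr -big_split. Qed.

Lemma poisson_integralB f g w : I (f \- g) w = I f w - I g w.
Proof. by rewrite !poisson_integralE -sumrB. Qed.

Lemma poisson_integral_norm f w : `|I f w| <= I (fun z => `|f z|) w.
Proof. by rewrite !poisson_integralE ler_norm_sum. Qed.

Lemma poisson_integral_stopped f w : I f (stopped t w) = I f w.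
Proof.
apply: eq_fsbigr => u /set_mem; rewrite /= in_itv /= => /andP[_ ut].
by rewrite jump_stopped.
Qed.

(** This form makes the theory of integrals against kernels available. *)
Lemma poisson_integral_jump_count f w : measurable_fun setT f ->
  (forall z, 0 <= f z) ->
  (I f w)%:E = (\int[jump_count `]0%R, t] (w : cadlag R d)]_(z in A) (f z)%:E)%E.
Proof.
move=> mf f0; set s : seq R := fset_set (S w).
pose m k : {measure set Rd -> \bar R} := \d_(jump (w : cadlag R d) (nth 0 s k) : Rd).
have sA k : (k < size s)%N -> A (jump (w : cadlag R d) (nth 0 s k)).
  move=> ks; have : nth 0 s k \in fset_set (S w) by exact: mem_nth.
  by rewrite in_fset_set; [move=> /set_mem[]|exact: finite_jumps_in].
rewrite (@eq_measure_integral _ _ _ A (msum m (size s))).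
  rewrite ge0_integral_measure_sum//; last first.
    by apply/measurable_EFinP; exact: measurable_funTS.
  - by move=> z _; rewrite lee_fin.
  rewrite poisson_integralE (big_nth 0) big_mkord -sumEFin; apply: eq_bigr => k _.
  rewrite integral_dirac//; last by apply/measurable_EFinP; exact: measurable_funTS.
  by rewrite diracE mem_set ?mul1e//; exact: sA.
move=> C mC CA; rewrite /msum -[LHS]/(jump_count `]0, t] (w : cadlag R d) C) /jump_count.
rewrite (_ : jump_times _ _ C = S w `&` [set u | C (jump (w : cadlag R d) u)]).
  rewrite esum_mkcondr esum_fset//; [|exact: finite_jumps_in|by move=> u _; case: ifPn].
  rewrite fsbig_finite/=; last exact: finite_jumps_in.
  rewrite (big_nth 0) big_mkord; apply: eq_bigr => k _.
  rewrite [RHS](_ : _ = \d_(jump (w : cadlag R d) (nth 0 s k) : Rd) C)// diracE; case: ifPn => [/set_mem h|h].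
    by rewrite mem_set.
  by rewrite memNset// => Cj; move/negP: h; apply; apply/mem_set.
apply/seteqP; split=> u; first by move=> [u0t j0 Cj]; split=> //; split=> //; exact: CA.
by move=> [[u0t j0 Aj] Cj]; split.
Qed.

Lemma measurable_jump_count_path (C : set Rd) : measurable C ->
  measurable_fun setT (fun w : path_space => jump_count `]0, t] (w : cadlag R d) C).
Proof.
move=> mC; apply: measurable_jump_count_oc => // p q p0 pq _.
by apply: measurable_subV; apply: measurable_path; rewrite ltW// (lt_le_trans p0).
Qed.

Lemma measurable_poisson_integral f : measurable_fun setT f ->
  measurable_fun setT (I f : path_space -> R).
Proof.
move=> mf.
have mI g : measurable_fun setT g -> (forall z, 0 <= g z) ->
    measurable_fun setT (I g : path_space -> R).
  move=> mg g0; apply/measurable_EFinP.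
  rewrite (_ : _ \o _ = (fun w : path_space =>
      \int[jump_count `]0%R, t] (w : cadlag R d)]_z ((EFin \o g) \_ A) z)%E); last first.
    apply/funext => w /=; rewrite (poisson_integral_jump_count w mg g0).
    by rewrite integral_mkcond.
  apply: measurable_fun_integral_kernel.
  - exact: measurable_jump_count_path.
  - by move=> z; rewrite /patch; case: ifP; rewrite ?lee_fin.
  - by apply/(measurable_restrictT _ mA); apply/measurable_EFinP; exact: measurable_funTS.
have -> : I f = (fun w => I f^\+ w - I f^\- w).
  by apply/funext => w; rewrite -poisson_integralB -[in LHS](funrposBneg f).
apply: measurable_funB; apply: mI => //.
- exact: measurable_funrpos.
- exact: measurable_funrneg.
Qed.

End fixed_set.
End poisson_path.

(** * Mixtures of measures *)

Section mixture.
Context {R : realType} {dX dZ} {X : measurableType dX} {Z : measurableType dZ}.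
Local Open Scope ereal_scope.

(** The measurability proof is an argument so that the measure structure can be
    inferred from the term. *)
Definition mixture (m : {measure set X -> \bar R})
    (k : X -> {measure set Z -> \bar R})
    (mk : forall C, measurable C -> measurable_fun setT (fun x => k x C))
    (C : set Z) : \bar R := \int[m]_x k x C.

Section measure.
Variables (m : {measure set X -> \bar R}) (k : X -> {measure set Z -> \bar R}).
Hypothesis mk : forall C, measurable C -> measurable_fun setT (fun x => k x C).

Let mixture0 : mixture m mk set0 = 0.
Proof. by rewrite /mixture; under eq_integral do rewrite measure0; rewrite integral0. Qed.

Let mixture_ge0 C : 0 <= mixture m mk C.
Proof. by apply: integral_ge0. Qed.

Let mixture_sigma_additive : semi_sigma_additive (mixture m mk).
Proof.
move=> F mF tF mUF.
rewrite (_ : mixture m mk _ = \sum_(0 <= i <oo) mixture m mk (F i)).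
  by apply: is_cvg_nneseries => n _ _; exact: mixture_ge0.
rewrite /mixture -integral_nneseries//; last by move=> n; exact: mk.
by apply: eq_integral => x _; rewrite measure_semi_bigcup.
Qed.

HB.instance Definition _ := isMeasure.Build _ _ _ (mixture m mk)
  mixture0 mixture_ge0 mixture_sigma_additive.

Let integral_mixture_nnsfun (f : {nnsfun Z >-> R}) :
  \int[mixture m mk]_z (f z)%:E = \int[m]_x \int[k x]_z (f z)%:E.
Proof.
rewrite integralT_nnsfun sintegralE.
under [RHS]eq_integral do rewrite integralT_nnsfun sintegralE.
rewrite ge0_integral_fsum//; last 2 first.
- by move=> r; apply: measurable_funeM; exact: mk.
- by move=> r x _; apply: (mulemu_ge0 (fun r => f @^-1` [set r])) => ?; exact: preimage_nnfun0.
apply: eq_fsbigr => _ /set_mem[z _ <-].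
by rewrite ge0_integralZl ?lee_fin//; exact: mk.
Qed.

Lemma integral_mixture (f : Z -> \bar R) : (forall z, 0 <= f z) ->
  measurable_fun setT f ->
  \int[mixture m mk]_z f z = \int[m]_x \int[k x]_z f z.
Proof.
move=> f0 mf; pose f_ := nnsfun_approx measurableT mf.
have fE z : f z = limn (fun n => (f_ n z)%:E).
  by apply/esym/cvg_lim => //; exact: cvg_nnsfun_approx.
have mono z : nondecreasing_seq (fun n => (f_ n z)%:E).
  by move=> a b ab; rewrite lee_fin; exact/lefP/nd_nnsfun_approx.
have f_0 n z : 0 <= (f_ n z)%:E.
  by rewrite lee_fin; have := @fun_ge0 _ _ (f_ n) z.
have mf_ n : measurable_fun setT (fun z => (f_ n z)%:E).
  by apply/measurable_EFinP.
have lim_int (p : {measure set Z -> \bar R}) :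
    \int[p]_z f z = limn (fun n => \int[p]_z (f_ n z)%:E).
  by rewrite (eq_integral _ _ (fun z _ => fE z)) monotone_convergence.
rewrite lim_int; under [RHS]eq_integral do rewrite lim_int.
rewrite /= monotone_convergence//.
- by congr (lim (_ @ \oo)); apply/funext => n; exact: integral_mixture_nnsfun.
- by move=> n; apply: measurable_fun_integral_kernel.
- by move=> n x _; apply: integral_ge0.
- by move=> x _ a b ab; apply: ge0_le_integral => // z _; exact: mono.
Qed.

End measure.
End mixture.

(** Both sides are integrals against mixtures, which are compared on sets; the
    two families may live over different base spaces. *)
Lemma le_integral_kernel {R : realType} {dX dY dZ} {X : measurableType dX}
    {Y : measurableType dY} {Z : measurableType dZ}
    (m : {measure set X -> \bar R}) (n : {measure set Y -> \bar R})
    (k : X -> {measure set Z -> \bar R}) (l : Y -> {measure set Z -> \bar R})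
    (f : Z -> \bar R) :
  (forall C, measurable C -> measurable_fun setT (fun x => k x C)) ->
  (forall C, measurable C -> measurable_fun setT (fun y => l y C)) ->
  (forall C, measurable C -> \int[m]_x k x C <= \int[n]_y l y C)%E ->
  (forall z, 0 <= f z)%E -> measurable_fun setT f ->
  (\int[m]_x \int[k x]_z f z <= \int[n]_y \int[l y]_z f z)%E.
Proof.
move=> mk ml kl f0 mf.
rewrite -(integral_mixture m mk)// -(integral_mixture n ml)//.
by apply: ge0_le_measure_integral => // C mC _; exact: kl.
Qed.

Section image_on.
Context {R : realType} {dX dZ} {X : measurableType dX} {Z : measurableType dZ}.
Local Open Scope ereal_scope.
Variables (B : set X) (f : X -> Z).

(** The point mass at [f x] if [x] lies in [B], the zero measure otherwise:
    its mixtures are image measures of restrictions to [B]. *)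
Definition hit (x : X) : {measure set Z -> \bar R} :=
  if x \in B then [the measure _ _ of \d_(f x)] else [the measure _ _ of mzero].

Lemma hitE x C : hit x C = (\1_(B `&` f @^-1` C) x)%:E.
Proof. by rewrite /hit indicE in_setI; case: ifPn. Qed.

Hypotheses (mB : measurable B) (mf : measurable_fun B f).

Lemma measurable_hit C : measurable C -> measurable_fun setT (fun x => hit x C).
Proof.
move=> mC; under eq_fun do rewrite hitE.
by apply/measurable_EFinP; apply: measurable_indic; exact: mf.
Qed.

Definition image_on (m : {measure set X -> \bar R}) : {measure set Z -> \bar R} :=
  [the measure _ _ of mixture m measurable_hit].

Lemma image_onE m C : measurable C -> image_on m C = m (B `&` f @^-1` C).
Proof.
move=> mC; rewrite /image_on /= /mixture; under eq_integral do rewrite hitE.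
by rewrite integral_indic ?setIT//; exact: mf.
Qed.

Lemma integral_image_on m (phi : Z -> \bar R) : (forall z, 0 <= phi z) ->
  measurable_fun setT phi ->
  \int[image_on m]_z phi z = \int[m]_(x in B) phi (f x).
Proof.
move=> phi0 mphi; rewrite integral_mixture// [RHS]integral_mkcond.
apply: eq_integral => x _; rewrite /hit patchE; case: ifPn => _.
  by rewrite integral_dirac// diracT mul1e.
by rewrite integral_measure_zero.
Qed.

End image_on.
Arguments hit {R dX dZ X Z} B f x.
Arguments image_on {R dX dZ X Z B f} mB mf m.

(** * Independence of the past and of later jumps *)

Section independence.
Context {R : realType} {dO} {Ot : measurableType dO} (P0 : probability Ot R).
Local Open Scope ereal_scope.

Lemma indep_generated (S G : set (set Ot)) :
  (forall A, S A -> measurable A) -> (forall B, G B -> measurable B) ->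
  setI_closed G -> indep P0 S G -> indep P0 S <<s G >>.
Proof.
move=> mS mG GI SG A B SA; have mA := mS _ SA.
pose H := [set B | measurable B /\ P0 (A `&` B) = P0 A * P0 B].
suff GH : <<s G >> `<=` H by move=> /GH[].
apply: lambda_system_subset => //; last by move=> C GC; split; [exact: mG|exact: SG].
apply/dynkin_lambda_system; split.
- by split=> //; rewrite setIT probability_setT mule1.
- move=> C [mC AC]; split; first exact: measurableC.
  rewrite -setDE measureD//; last by rewrite -ge0_fin_numE// fin_num_measure.
  rewrite [X in _ - X]AC probability_setC// muleBr ?fin_num_measure ?mule1//.
- move=> F tF HF; split; first by apply: bigcup_measurable => k _; have [] := HF k.
  have mF k : measurable (F k) by have [] := HF k.
  rewrite setI_bigcupr !measure_semi_bigcup//.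
  + rewrite -(fineK (fin_num_measure P0 A mA)) -nneseriesZl// fineK ?fin_num_measure//.
    by apply: eq_eseriesr => k _; have [_] := HF k; exact.
  + by apply: bigcup_measurable.
  + by move=> k; exact: measurableI.
  + exact: trivIset_setIl.
  + by apply: bigcup_measurable => k _; exact: measurableI.
Qed.

Lemma indep_sym (S G : set (set Ot)) : indep P0 S G -> indep P0 G S.
Proof. by move=> SG A B GA SB; rewrite setIC muleC; exact: SG. Qed.

Lemma g_sigma_algebraI (G : set (set Ot)) A B :
  <<s G >> A -> <<s G >> B -> <<s G >> (A `&` B).
Proof. exact: (@measurableI _ (g_sigma_algebraType G)). Qed.

End independence.

Section past_and_future.
Context {R : realType} {d : nat} {dO} {Ot : measurableType dO}.
Variable P0 : probability Ot R.
Local Notation Rd := (borel 'rV[R]_d).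

Lemma sigma_process_sub (I1 I2 : set R) (X : R -> Ot -> Rd) : I1 `<=` I2 ->
  sigma_process I1 X `<=` sigma_process I2 X.
Proof.
move=> I12; apply: sub_sigma_algebra2.
by move=> A [s /I12 I2s As]; exists s.
Qed.

Lemma sigma_process_measurable (I : set R) (X : R -> Ot -> Rd) :
  (forall s, I s -> measurable_fun setT (X s)) ->
  forall A, sigma_process I X A -> measurable A.
Proof.
move=> mX A; apply; split; first exact: sigma_algebra_measurable.
by move=> _ [s Is [B mB <-]]; exact: mX.
Qed.

Lemma sigma_process_coord (I : set R) (X : R -> Ot -> Rd) s : I s ->
  measurable_fun setT (X s : g_sigma_algebraType
    (\bigcup_(s in I) preimage_set_system setT (X s) measurable) -> Rd).
Proof. by move=> Is _ B mB; apply: sub_sigma_algebra; exists s => //; exists B. Qed.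

Variable J : Ot -> cadlag R d.
Hypothesis mJ : forall t, 0 <= t -> measurable_fun setT ((fun w => J w t) : Ot -> Rd).
Hypothesis iJ : indep_increments P0 (fun t w => J w t).

Section future.
Variables (s : R) (s0 : 0 <= s).

Let tm (n k : nat) : R := s + k%:R * 2 ^- n.

Let tm_ge n k : s <= tm n k.
Proof. by rewrite /tm lerDl mulr_ge0 // invr_ge0 exprn_ge0. Qed.

Let tm_mono n k : tm n k <= tm n k.+1.
Proof. by rewrite /tm lerD2l ler_pM2r ?invr_gt0 ?exprn_gt0// ler_nat. Qed.

Let incr (n k : nat) (w : Ot) : Rd := J w (tm n k.+1) - J w (tm n k).

Let incr_in n (C : nat -> set Rd) (m : nat) : set Ot :=
  \big[setI/setT]_(k < m) (incr n k @^-1` C k).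

(** Events on the increments of J over the dyadic grid of mesh 2^-n after s *)
Let grid_events n : set (set Ot) := [set B | exists m (C : nat -> set Rd),
  (forall k, measurable (C k)) /\ B = incr_in n C m].

Let past_incr n k C : measurable C ->
  sigma_process `[0, tm n k.+1] (fun t w => J w t) (incr n k @^-1` C).
Proof.
move=> mC; rewrite -[_ @^-1` _]setTI.
have h r : 0 <= r -> r <= tm n k.+1 -> measurable_fun setT ((fun w => J w r) :
  g_sigma_algebraType (\bigcup_(u in [set` `[0%R, tm n k.+1]])
    preimage_set_system setT (fun w => J w u : Rd) measurable) -> Rd).
  move=> r0 rt; apply: (@sigma_process_coord _ (fun t w => J w t : Rd)).
  by rewrite /= in_itv /= r0.
have t0 k' : 0 <= tm n k' by rewrite (le_trans s0).
by apply: (measurable_subV (h _ _ _) (h _ _ _)).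
Qed.

Let grid_events_setI n : setI_closed (grid_events n).
Proof.
move=> _ _ [m1 [C1 [mC1 ->]]] [m2 [C2 [mC2 ->]]].
pose C k := (if (k < m1)%N then C1 k else setT) `&` (if (k < m2)%N then C2 k else setT).
exists (maxn m1 m2), C; split.
  by move=> k; apply: measurableI; case: ifP.
apply/seteqP; split=> w; rewrite /incr_in -!(bigcap_mkord _ (fun k => incr n k @^-1` _ k)).
  move=> [h1 h2] k /= km; rewrite /C; split; case: ifPn => // h; [exact: h1|exact: h2].
move=> h; split=> k /= km; have := h k; rewrite /= leq_max km ?orbT => /(_ isT); rewrite /C km;
  by case.
Qed.

Let grid_past n C m : (forall k, measurable (C k)) ->
  sigma_process `[0, tm n m] (fun t w => J w t) (incr_in n C m).
Proof.
move=> mC; elim: m => [|m IH].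
  by rewrite /incr_in big_ord0; exact: (@measurableT _ (g_sigma_algebraType _)).
rewrite /incr_in big_ord_recr /=; apply: g_sigma_algebraI; last exact: past_incr.
apply: sigma_process_sub IH => r /=; rewrite !in_itv /= => /andP[-> rt].
exact: le_trans (tm_mono n m).
Qed.

(** Independent increments, one step of the grid at a time *)
Let grid_indep n : indep P0 (sigma_process `[0, s] (fun t w => J w t)) (grid_events n).
Proof.
move=> F _ Fs [m [C [mC ->]]]; elim: m => [|m IH].
  by rewrite /incr_in big_ord0 setIT probability_setT mule1.
have mt : 0 <= tm n m by rewrite (le_trans s0).
have step A : sigma_process `[0, tm n m] (fun t w => J w t) A ->
    P0 (A `&` (incr n m @^-1` C m)) = (P0 A * P0 (incr n m @^-1` C m))%E.
  move=> At; apply: (iJ (s := tm n m) (t := tm n m.+1)) => //; first by rewrite mt tm_mono.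
  by exists (C m) => //; rewrite setTI.
rewrite /incr_in big_ord_recr /= -/(incr_in n C m) setIA step; last first.
  apply: g_sigma_algebraI; last exact: grid_past.
  apply: sigma_process_sub Fs => r /=; rewrite !in_itv /= => /andP[-> rt].
  exact: le_trans (tm_ge n m).
by rewrite IH step ?muleA//; exact: grid_past.
Qed.

Let incr_measurable n k (G : set (set Ot)) : grid_events n `<=` <<s G >> ->
  measurable_fun setT (incr n k : g_sigma_algebraType G -> Rd).
Proof.
move=> nG _ B mB; rewrite setTI; apply: nG.
pose C j := if j == k then B else setT.
exists k.+1, C; split; first by move=> j; rewrite /C; case: ifP.
apply/seteqP; split=> w; rewrite /incr_in -(bigcap_mkord _ (fun j => incr n j @^-1` C j)) /C.
  by move=> Bw j _ /=; case: eqP => // ->.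
by move=> /(_ k) /=; rewrite ltnSn eqxx; apply.
Qed.

Let tm_double n k : tm n k = tm n.+1 k.*2.
Proof.
rewrite /tm; congr (s + _); rewrite exprS invfM mulrA -muln2 natrM.
by rewrite -!mulrA mulVKf// pnatr_eq0.
Qed.

Let grid_refine n : grid_events n `<=` <<s grid_events n.+1 >>.
Proof.
move=> _ [m [C [mC ->]]].
apply: (@bigsetI_measurable _ (g_sigma_algebraType (grid_events n.+1))) => k _.
have -> : incr n k = (fun w => incr n.+1 k.*2 w + incr n.+1 k.*2.+1 w).
  apply/funext => w; rewrite /incr (tm_double n k.+1) (tm_double n k) doubleS.
  by rewrite [RHS]addrC subrKA.
rewrite -[X in measurable X]setTI.
by apply: measurable_addV => //; apply: incr_measurable; exact: sub_sigma_algebra.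
Qed.

(** The events that depend on the increments of J after s *)
Definition future : set (set Ot) := <<s \bigcup_n <<s grid_events n >> >>.

Let grids_setI : setI_closed (\bigcup_n <<s grid_events n >>).
Proof.
have mono n m : (n <= m)%N -> <<s grid_events n >> `<=` <<s grid_events m >>.
  move=> /subnK <-; elim: (m - n)%N => // k IH A /IH.
  by apply: smallest_sub; [exact: smallest_sigma_algebra|exact: grid_refine].
move=> A B [n _ An] [m _ Bm]; exists (maxn n m) => //.
by apply: g_sigma_algebraI; [apply: mono An|apply: mono Bm]; rewrite ?leq_maxl ?leq_maxr.
Qed.

Let grid_measurable n A : grid_events n A -> measurable A.
Proof.
move=> [m [C [mC ->]]]; apply: bigsetI_measurable => k _.
rewrite -[X in measurable X]setTI.
have mt k' : measurable_fun setT (fun w => J w (tm n k') : Rd).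
  by apply: mJ; rewrite (le_trans s0).
exact: (measurable_subV (mt _) (mt _)).
Qed.

Lemma indep_future : indep P0 (sigma_process `[0, s] (fun t w => J w t)) future.
Proof.
have mp A : sigma_process `[0, s] (fun t w => J w t) A -> measurable A.
  apply: (@sigma_process_measurable _ (fun t w => J w t : Rd)) => r /=.
  by rewrite in_itv /= => /andP[r0 _]; exact: mJ.
apply: indep_generated => //.
  move=> B [n _]; apply; split; first exact: sigma_algebra_measurable.
  exact: grid_measurable.
move=> A B pA [n _ nB]; apply: indep_generated pA nB => //.
exact: grid_measurable.
Qed.

(** J is right continuous, hence determined after s by its values on the grids. *)
Lemma measurable_future r : s <= r ->
  measurable_fun setT ((fun w => J w r - J w s) :
    g_sigma_algebraType (\bigcup_n <<s grid_events n >>) -> Rd).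
Proof.
move=> sr; set T := g_sigma_algebraType _.
have mi n k : measurable_fun setT (incr n k : T -> Rd).
  apply: incr_measurable => A An; apply: sub_sigma_algebra; exists n => //.
  exact: sub_sigma_algebra.
have mt n k : measurable_fun setT ((fun w => J w (tm n k) - J w s) : T -> Rd).
  elim: k => [|k IH].
    rewrite (_ : (fun _ => _) = cst 0); first exact: measurable_cst.
    by apply/funext => w; rewrite /tm mul0r addr0 subrr.
  have -> : (fun w => J w (tm n k.+1) - J w s) =
      (fun w => incr n k w + (J w (tm n k) - J w s)).
    by apply/funext => w; rewrite /incr subrKA.
  exact: measurable_addV.
pose k n := (Num.trunc ((r - s) * 2 ^+ n)).+1.
have rk n : r < tm n (k n) <= r + 2 ^- n.
  have rs0 : 0 <= (r - s) * 2 ^+ n by rewrite mulr_ge0 ?subr_ge0 ?exprn_ge0.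
  have /andP[h1 h2] := trunc_itv rs0.
  rewrite /tm /k; apply/andP; split.
    by rewrite -ltrBlDl ltr_pdivlMr ?exprn_gt0.
  rewrite -lerBrDl addrAC -natr1 mulrDl mul1r lerD2r.
  by rewrite ler_pdivrMr ?exprn_gt0.
apply: (@measurable_limV _ _ _ T (fun n w => J w (tm n (k n)) - J w s)) => // w.
apply: (@cvgB R 'rV[R]_d); last exact: cvg_cst.
have tr : tm n (k n) @[n --> \oo] --> r^'+.
  move=> P /near_right_itv[e e0 eP]; suff : \forall m \near \oo, P (tm m (k m)) by [].
  near=> m; apply: eP; have /andP[-> h] := rk m; apply: le_lt_trans h _.
  rewrite ltrD2l -div1r; near: m; exact: (near_infty_natSinv_expn_lt (PosNum e0)).
apply: cvg_comp tr _; exact: path_rcont.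
Unshelve. all: by end_near. Qed.

Lemma future_jump_count t C (B : set (\bar R)) : measurable C -> measurable B ->
  future ((fun w => jump_count `]s, t] (J w) C) @^-1` B).
Proof.
move=> mC mB; rewrite -[_ @^-1` _]setTI.
set T := g_sigma_algebraType (\bigcup_n <<s grid_events n >>).
suff : measurable_fun setT ((fun w => jump_count `]s, t] (J w) C) : T -> \bar R) by exact.
apply: (@measurable_jump_count_oc _ _ _ T) => // p q sp pq _.
rewrite (_ : (fun _ => _) = (fun w => (J w q - J w s) - (J w p - J w s))); last first.
  by apply/funext => w; rewrite opprB subrKA.
have ? := ltW sp.
by apply: measurable_subV; apply: measurable_future => //; exact: le_trans pq.
Qed.

Lemma future_sub : future `<=` sigma_process `[0, +oo[ (fun t w => J w t).
Proof.
apply: smallest_sub; first exact: smallest_sigma_algebra.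
move=> A [n _]; apply: smallest_sub; first exact: smallest_sigma_algebra.
move=> _ [m [C [mC ->]]]; have : sigma_process `[0, tm n m] (fun t w => J w t) (incr_in n C m) by exact: grid_past.
apply: sigma_process_sub.
by move=> r /=; rewrite !in_itv /= => /andP[->].
Qed.

End future.
End past_and_future.

Section filtration.
Context {R : realType} {d : nat} {dO} {Ot : measurableType dO}.
Variable P0 : probability Ot R.
Local Notation Rd := (borel 'rV[R]_d).
Variables (W : R -> Ot -> Rd) (J : Ot -> cadlag R d).
Hypothesis mW : forall t, 0 <= t -> measurable_fun setT (W t).
Hypothesis mJ : forall t, 0 <= t -> measurable_fun setT ((fun w => J w t) : Ot -> Rd).
Hypothesis iJ : indep_increments P0 (fun t w => J w t).
Hypothesis WJ : indep P0 (sigma_process `[0, +oo[ W)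
  (sigma_process `[0, +oo[ (fun t w => J w t)).

Let sW (s : R) := sigma_process `[0, s] W.
Let sJ (s : R) := sigma_process `[0, s] (fun t w => J w t : Rd).
Let null : set (set Ot) := [set F | measurable F /\ P0 F = 0%E].

Let msW s A : sW s A -> measurable A.
Proof.
by apply: sigma_process_measurable => r /=; rewrite in_itv /= => /andP[r0 _]; exact: mW.
Qed.

Let msJ s A : sJ s A -> measurable A.
Proof.
apply: (@sigma_process_measurable _ _ _ _ _ (fun t w => J w t : Rd)) => r /=.
by rewrite in_itv /= => /andP[r0 _]; exact: mJ.
Qed.

Lemma filtration_measurable s A : filtration P0 W J s A -> measurable A.
Proof.
apply; split; first exact: sigma_algebra_measurable.
by move=> B [[/msW//|/msJ//]|[]].
Qed.

Lemma filtration_le s t : s <= t -> filtration P0 W J s `<=` filtration P0 W J t.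
Proof.
move=> st; have sub : `[0, s] `<=` `[0, t].
  by move=> r /=; rewrite !in_itv /= => /andP[-> rs]; exact: le_trans st.
apply: sub_sigma_algebra2 => A [[AW|AJ]|A0]; last by right.
- by left; left; exact: sigma_process_sub AW.
- by left; right; exact: sigma_process_sub AJ.
Qed.

(** W is independent of all of J, and J has independent increments. *)
Lemma indep_filtration s t (C : set Rd) (B : set (\bar R)) F :
  0 <= s -> measurable C -> measurable B -> filtration P0 W J s F ->
  P0 (F `&` (fun w => jump_count `]s, t] (J w) C) @^-1` B) =
  (P0 F * P0 ((fun w => jump_count `]s, t] (J w) C) @^-1` B))%E.
Proof.
move=> s0 mC mB Fs; set Q := _ @^-1` B.
have fQ : future J s Q by exact: future_jump_count.
have jQ := future_sub s0 fQ.
have mQ : measurable Q.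
  apply: (@sigma_process_measurable _ _ _ _ `[0, +oo[ (fun t w => J w t : Rd)) jQ => r /=.
  by rewrite in_itv /= andbT; exact: mJ.
pose G := [set E | exists A1 A2 A3, [/\ sW s A1, sJ s A2, null A3 \/ A3 = setT &
  E = A1 `&` A2 `&` A3]].
have GT T : sW T setT /\ sJ T setT.
  by split; exact: (@measurableT _ (g_sigma_algebraType _)).
have mG E : G E -> measurable E.
  move=> [A1 [A2 [A3 [/msW m1 /msJ m2 m3 ->]]]]; apply: measurableI.
    exact: measurableI.
  by case: m3 => [[]//|->].
have : <<s G >> F.
  apply: sub_sigma_algebra2 Fs => E [[EW|EJ]|E0].
  - by exists E, setT, setT; split; rewrite ?setIT//; [exact: (GT s).2|right].
  - by exists setT, E, setT; split; rewrite ?setIT ?setTI//; [exact: (GT s).1|right].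
  - exists setT, setT, E; split; rewrite ?setTI//; [exact: (GT s).1|exact: (GT s).2|].
    by left.
move=> GF; apply: indep_sym GF (erefl : [set Q] Q).
apply: indep_generated => //.
- by move=> _ ->.
- move=> _ _ [A1 [A2 [A3 [s1 s2 n3 ->]]]] [B1 [B2 [B3 [t1 t2 u3 ->]]]].
  exists (A1 `&` B1), (A2 `&` B2), (A3 `&` B3); split.
  + exact: g_sigma_algebraI.
  + exact: g_sigma_algebraI.
  + case: n3 => [[m3 P3]|->]; last by rewrite setTI.
    left; split; first by apply: measurableI => //; case: u3 => [[]//|->].
    apply: (@subset_measure0 _ _ _ P0 _ A3) => //.
    by apply: measurableI => //; case: u3 => [[]//|->].
  + by rewrite setIACA; congr (_ `&` _); rewrite setIACA.
move=> _ E -> [A1 [A2 [A3 [s1 s2 n3 ->]]]].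
have m1 := msW s1; have m2 := msJ s2.
case: n3 => [[m3 P3]|->].
  have mA : measurable (A1 `&` A2 `&` A3) by apply: measurableI => //; exact: measurableI.
  have z0 X : measurable X -> X `<=` A3 -> P0 X = 0%E.
    by move=> mX XA; exact: (@subset_measure0 _ _ _ P0 X A3).
  have -> : P0 (A1 `&` A2 `&` A3) = 0%E by apply: z0 => // ? [].
  by rewrite mule0; apply: z0; [exact: measurableI|move=> ? [_ []]].
rewrite setIT setIC -setIA.
have W1 : sigma_process `[0, +oo[ W A1.
  by apply: sigma_process_sub s1 => r /=; rewrite !in_itv /= => /andP[->].
have J2 : sigma_process `[0, +oo[ (fun t w => J w t : Rd) A2.
  by apply: sigma_process_sub s2 => r /=; rewrite !in_itv /= => /andP[->].
rewrite (WJ W1 (g_sigma_algebraI J2 jQ)) (WJ W1 J2).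
by rewrite (indep_future mJ iJ s0 s2 fQ) muleA muleC.
Qed.

End filtration.

Section poisson_mean.
Context {R : realType} {dO} {Ot : measurableType dO}.
Variable P0 : probability Ot R.
Local Open Scope ereal_scope.

Lemma nneseries_exp (l : R) :
  \sum_(0 <= k <oo) (l ^+ k / k`!%:R)%:E = (expR l)%:E :> \bar R.
Proof.
rewrite /expR -EFin_lim; last exact: is_cvg_series_exp_coeff.
by apply/congr_lim/funext => n; rewrite /series /= -sumEFin.
Qed.

Lemma poisson_mean (X : Ot -> \bar R) (l : R) : (0 <= l)%R ->
  measurable_fun setT X -> (forall w, 0 <= X w) ->
  (forall k : nat, P0 [set w | X w = k%:R%:E] =
    (expR (- l) * l ^+ k / k`!%:R)%:E) ->
  \int[P0]_w X w = l%:E.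
Proof.
move=> l0 mX X0 PX; pose E k := [set w | X w = k%:R%:E].
have mE k : measurable (E k).
  by have := mX measurableT _ (emeasurable_set1 (k%:R%:E)); rewrite setTI.
have tE : trivIset setT E.
  move=> i j _ _ [w [Ei Ej]]; have : i%:R%:E = j%:R%:E :> \bar R by rewrite -Ei -Ej.
  by move=> /eqP; rewrite eqe eqr_nat => /eqP.
have mU : measurable (\bigcup_k E k) by exact: bigcup_measurable.
pose p k : R := (expR (- l) * l ^+ k / k`!%:R)%R.
have pE k : (p k)%:E = (expR (- l))%:E * (l ^+ k / k`!%:R)%:E.
  by rewrite -EFinM /p mulrA.
have p0 k : (0 <= l ^+ k / k`!%:R)%R by rewrite divr_ge0// exprn_ge0.
have p_sum : \sum_(0 <= k <oo) (p k)%:E = 1.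
  under eq_eseriesr do rewrite pE.
  rewrite nneseriesZl//; last by move=> k _; rewrite lee_fin.
  by rewrite nneseries_exp// -EFinM expRN mulVf ?gt_eqF ?expR_gt0.
have PU : P0 (~` \bigcup_k E k) = 0.
  rewrite probability_setC// measure_semi_bigcup//.
  rewrite (eq_eseriesr (g := fun k => (p k)%:E)); last by move=> k _; exact: PX.
  by rewrite p_sum subee.
rewrite (ge0_negligible_integral _ _ _ _ PU)//; last exact: measurableC.
rewrite setTD setCK ge0_integral_bigcup//; last exact: measurable_funTS.
rewrite (eq_eseriesr (g := fun k => k%:R%:E * (p k)%:E)); last first.
  move=> k _; rewrite (eq_integral (cst k%:R%:E)); last by move=> w /set_mem.
  by rewrite integral_cst//; congr (_ * _); exact: PX.
rewrite nneseries_recl//; last by move=> k _; rewrite -EFinM lee_fin mulr_ge0// /p -mulrA mulr_ge0 ?expR_ge0.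
rewrite mul0e add0e -nneseries_addn; last first.
  by move=> k; rewrite -EFinM lee_fin mulr_ge0// /p -mulrA mulr_ge0 ?expR_ge0.
rewrite (eq_eseriesr (g := fun k => l%:E * (p k)%:E)).
  rewrite nneseriesZl//; last by move=> k _; rewrite lee_fin /p -mulrA mulr_ge0 ?expR_ge0.
  by rewrite p_sum mule1.
move=> k _; rewrite addn1 -!EFinM /p factS natrM exprS; congr _%:E.
by field; rewrite nat1r !pnatr_eq0 -lt0n fact_gt0.
Qed.

End poisson_mean.

(** * Compensation of the jump measure *)

Section compensation.
Context {R : realType} {d : nat} {dO} {Ot : measurableType dO}.
Variable P0 : probability Ot R.
Local Notation Rd := (borel 'rV[R]_d).
Local Notation leb := (@lebesgue_measure R).
Local Open Scope ereal_scope.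

(** The image by [X] of the restriction of [P0] to [F] is [P0 F] times the law of
    [X]. *)
Lemma integral_indep (X : Ot -> \bar R) (F : set Ot) : measurable F ->
  measurable_fun setT X -> (forall w, 0 <= X w) ->
  (forall B, measurable B -> P0 (F `&` X @^-1` B) = P0 F * P0 (X @^-1` B)) ->
  \int[P0]_(w in F) X w = P0 F * \int[P0]_w X w.
Proof.
move=> mF mX X0 FX.
pose c : {nonneg R} := NngNum (fine_ge0 (measure_ge0 P0 F)).
(* [f] is the identity on the values of [X] and nonnegative everywhere. *)
pose f (z : \bar R) := maxe z 0.
have fX w : f (X w) = X w by rewrite /f max_l.
have f0 z : 0 <= f z by rewrite /f le_max lexx orbT.
have mf : measurable_fun setT f by apply: measurable_maxe => //; exact: measurable_cst.
have mXF : measurable_fun F X by exact: measurable_funTS.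
transitivity (\int[image_on mF mXF P0]_z f z).
  by rewrite integral_image_on//; apply: eq_integral => w _.
rewrite (eq_measure_integral (mscale c (image_on measurableT mX P0))).
  rewrite ge0_integral_mscale// integral_image_on//= fineK ?fin_num_measure//.
  by congr (_ * _); apply: eq_integral => w _.
move=> B mB _; rewrite image_onE// -[RHS]/(c%:num%:E * image_on measurableT mX P0 B).
rewrite image_onE// setTI /= fineK ?fin_num_measure//; exact: FX.
Qed.

Definition at_sample {O : Type} (G : set (R * O * Rd)) (w : O) : set (R * Rd) :=
  [set x | G (x.1, w, x.2)].

Lemma measurable_at_sample (G : set (R * Ot * Rd)) w :
  measurable G -> measurable (at_sample G w).
Proof.
move=> mG; rewrite -[at_sample G w]setTI.
apply: (_ : measurable_fun setT (fun x : R * Rd => (x.1, w, x.2))) => //.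
apply: measurable_fun_pair; last exact: measurable_snd.
by apply: measurable_fun_pair; [exact: measurable_fst|exact: measurable_cst].
Qed.

Section uniqueness.
Variables (k l : Ot -> {measure set (R * Rd) -> \bar R}) (B : set (R * Rd)).
Hypotheses (mB : measurable B) (kB : forall w, k w B < +oo) (lB : forall w, l w B < +oo).
Variables (D : set (R * Ot * Rd)) (G : set (set (R * Ot * Rd))).
Hypotheses (GI : setI_closed G) (mD : measurable D)
  (mG : forall E, G E -> measurable E /\ E `<=` D).

Let H := [set E | [/\ measurable E, E `<=` D,
  measurable_fun setT (fun w => k w (at_sample E w `&` B)),
  measurable_fun setT (fun w => l w (at_sample E w `&` B)) &
  \int[P0]_w k w (at_sample E w `&` B) = \int[P0]_w l w (at_sample E w `&` B)]].

Hypotheses (GH : G `<=` H) (DH : H D) (kD : \int[P0]_w k w (at_sample D w `&` B) < +oo).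

(** Dynkin's argument for two random measures: since they are finite on [B], the
    sets whose sections have the same mean mass in [B] form a lambda-system. *)
Lemma unique_on_samples : <<s D, G >> `<=` H.
Proof.
have fin (m : {measure set (R * Rd) -> \bar R}) E : m B < +oo -> measurable E -> m (E `&` B) \is a fin_num.
  move=> mB' mE; rewrite ge0_fin_numE//; apply: le_lt_trans mB'.
  by apply: le_measure; [apply/mem_set; exact: measurableI|exact/mem_set|exact: subIsetr].
apply: lambda_system_subset => //; last first.
  move=> E DGE; apply: (DGE [set X | X `<=` D]); split; last by move=> F /mG[].
    split; first exact: sub0set.
    - by move=> A AD x [].
    - by move=> F FD x [i _ /FD].
split => //; first by move=> E [].
- move=> E1 E2 E21 [m1 D1 k1 l1 e1] [m2 D2 k2 l2 e2].
  have diff (m : Ot -> {measure set (R * Rd) -> \bar R}) w : m w B < +oo ->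
      m w (at_sample (E1 `\` E2) w `&` B) =
      m w (at_sample E1 w `&` B) - m w (at_sample E2 w `&` B).
    move=> mB'; have M1 := measurable_at_sample w m1; have M2 := measurable_at_sample w m2.
    have -> : at_sample (E1 `\` E2) w `&` B = (at_sample E1 w `&` B) `\` (at_sample E2 w `&` B).
      apply/seteqP; split=> x /=; first by move=> [[h1 h2] Bx]; split=> // -[].
      by move=> [[h1 Bx] h2]; split=> //; split=> // E2x; apply: h2.
    rewrite measureD//; [|exact: measurableI|exact: measurableI|].
      by congr (_ - m w _); rewrite setIidr// => x [h ?]; split=> //; exact: E21.
    by rewrite -ge0_fin_numE//; exact: fin.
  have small (m : Ot -> {measure set (R * Rd) -> \bar R}) E : (forall w, m w B < +oo) ->
      measurable E -> measurable_fun setT (fun w => m w (at_sample E w `&` B)) ->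
      \int[P0]_w m w (at_sample E w `&` B) < +oo ->
      P0.-integrable setT (fun w => m w (at_sample E w `&` B)).
    move=> _ mE mm mfin; apply/integrableP; split=> //.
    by under eq_integral do rewrite gee0_abs//.
  have lt (m : Ot -> {measure set (R * Rd) -> \bar R}) E : E `<=` D -> measurable E ->
      measurable_fun setT (fun w => m w (at_sample E w `&` B)) ->
      measurable_fun setT (fun w => m w (at_sample D w `&` B)) ->
      \int[P0]_w m w (at_sample D w `&` B) < +oo ->
      \int[P0]_w m w (at_sample E w `&` B) < +oo.
    move=> ED mE me md; apply: le_lt_trans; apply: ge0_le_integral => // w _.
    apply: le_measure; rewrite ?in_setE.
    + by apply: measurableI => //; exact: measurable_at_sample.
    + by apply: measurableI => //; exact: measurable_at_sample.
    + by move=> x [Ex Bx]; split=> //; exact: ED.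
  have [_ _ kDm lDm eD] := DH.
  split.
  + exact: measurableD.
  + by move=> x [/D1].
  + by under eq_fun do rewrite diff//; exact: emeasurable_funB.
  + by under eq_fun do rewrite diff//; exact: emeasurable_funB.
  + under eq_integral do rewrite diff//.
    under [RHS]eq_integral do rewrite diff//.
    have lD : \int[P0]_w l w (at_sample D w `&` B) < +oo by rewrite -eD.
    by rewrite !integralB ?e1 ?e2//; apply: small => //; apply: lt => //.
- move=> F ndF HF.
  have mF n : measurable (F n) by have [] := HF n.
  have lim (m : Ot -> {measure set (R * Rd) -> \bar R}) w :
      m w (at_sample (F n) w `&` B) @[n --> \oo] -->
      m w (at_sample (\bigcup_i F i) w `&` B).
    have -> : at_sample (\bigcup_i F i) w `&` B = \bigcup_i (at_sample (F i) w `&` B).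
      by rewrite -setI_bigcupl.
    have mFB n : measurable (at_sample (F n) w `&` B).
      by apply: measurableI => //; exact: measurable_at_sample.
    apply: nondecreasing_cvg_mu => //; first exact: bigcup_measurable.
    move=> i j ij; apply/subsetPset => x [Fx Bx]; split=> //.
    by have /subsetPset := ndF _ _ ij; exact.
  have conv (m : Ot -> {measure set (R * Rd) -> \bar R}) :
     (forall n, measurable_fun setT (fun w => m w (at_sample (F n) w `&` B))) ->
     \int[P0]_w m w (at_sample (\bigcup_i F i) w `&` B) =
     limn (fun n => \int[P0]_w m w (at_sample (F n) w `&` B)).
    move=> mm; rewrite -monotone_convergence//.
      by apply: eq_integral => w _; apply/esym/cvg_lim => //; exact: lim.
    move=> w _ i j ij; apply: le_measure; rewrite ?in_setE.
    + by apply: measurableI => //; exact: measurable_at_sample.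
    + by apply: measurableI => //; exact: measurable_at_sample.
    + by apply: setSI => x; have /subsetPset := ndF _ _ ij; exact.
  split.
  + exact: bigcup_measurable.
  + by move=> x [i _]; have [_ + _ _ _] := HF i; exact.
  + apply: (emeasurable_fun_cvg (fun n w => k w (at_sample (F n) w `&` B))) => [n|w _].
      by have [] := HF n.
    exact: lim.
  + apply: (emeasurable_fun_cvg (fun n w => l w (at_sample (F n) w `&` B))) => [n|w _].
      by have [] := HF n.
    exact: lim.
  + rewrite !conv; [|by move=> n; have [] := HF n|by move=> n; have [] := HF n].
    by congr (limn _); apply/funext => n; have [] := HF n.
Qed.

End uniqueness.
End compensation.

Section time_space.
Context {R : realType} {d : nat}.
Local Notation Rd := (borel 'rV[R]_d).
Local Notation leb := (@lebesgue_measure R).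
Local Open Scope ereal_scope.
Variable mu : {sigma_finite_measure set Rd -> \bar R}.

(** The product measure, as a measure on the type that carries the jump
    measures; Lebesgue measure lives on another copy of [R]. *)
Definition time_space : set (R * Rd) -> \bar R := leb \x mu.

Let time_space0 : time_space set0 = 0.
Proof. exact: measure0. Qed.

Let time_space_ge0 C : 0 <= time_space C.
Proof. exact: measure_ge0. Qed.

Let time_space_sigma_additive : semi_sigma_additive time_space.
Proof. exact: (@measure_semi_sigma_additive _ _ _ (leb \x mu)). Qed.

HB.instance Definition _ := isMeasure.Build _ _ _ time_space
  time_space0 time_space_ge0 time_space_sigma_additive.

End time_space.

Section noise_compensation.
Context {R : realType} {d : nat} {dO} {Ot : measurableType dO}.
Variable P0 : probability Ot R.
Local Notation Rd := (borel 'rV[R]_d).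
Local Notation leb := (@lebesgue_measure R).
Local Open Scope ereal_scope.
Variables (mu : {sigma_finite_measure set Rd -> \bar R})
  (W : R -> Ot -> Rd) (J : Ot -> cadlag R d)
  (N : Ot -> {measure set (R * Rd) -> \bar R}).
Hypothesis hN : driving_noise P0 mu W J N.

Let mW t : (0 <= t)%R -> measurable_fun setT (W t).
Proof. by case: hN => -[mW _ _ _] _ _ _ _; exact: mW. Qed.

Let mJ t : (0 <= t)%R -> measurable_fun setT ((fun w => J w t) : Ot -> Rd).
Proof. by case: hN => _ [[mJ _ _ _] _] _ _ _; exact: mJ. Qed.

Let iJ : indep_increments P0 (fun t w => J w t).
Proof. by case: hN => _ [[_ _ iJ _] _] _ _ _. Qed.

Let WJ : indep P0 (sigma_process `[0%R, +oo[ W) (sigma_process `[0%R, +oo[ (fun t w => J w t)).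
Proof. by case: hN. Qed.

Let NJ : jump_measure J N.
Proof. by case: hN => _ _ _ [NJ _] _. Qed.

Let mN C : measurable C -> measurable_fun setT (fun w => N w C).
Proof. by case: hN => _ _ _ [_ [mN _ _ _]] _; exact: mN. Qed.

Local Notation prodm := (time_space mu).

Definition window (j : nat) : set Rd := [set z | (j.+1%:R^-1 <= `|z : 'rV[R]_d|)%R].

Hypothesis mu_window : forall j, mu (window j) < +oo.

Lemma measurable_window j : measurable (window j).
Proof.
rewrite -[window j]setTI.
by have := measurable_normV measurableT (measurable_itv `[(j.+1%:R^-1 : R)%R, +oo[);
  rewrite set_itvE.
Qed.

Lemma window_bigcup : \bigcup_j window j = [set~ (0 : Rd)%R].
Proof.
apply/seteqP; split=> z /=.
  by move=> [j _] jz z0; move: jz; rewrite /window /= z0 normr0 leNgt invr_gt0 ltr0n.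
move=> /eqP; rewrite -normr_gt0 => /ltr_add_invr[j]; rewrite add0r => /ltW jz.
by exists j.
Qed.

Lemma window_mono i j : (i <= j)%N -> window i `<=` window j.
Proof.
by move=> ij z; apply: le_trans; rewrite lef_pV2 ?posrE// ler_nat.
Qed.

Lemma N_rectangle w s t (C : set Rd) : (0 <= s)%R -> measurable C ->
  N w (`]s, t] `*` C) = jump_count `]s, t] (J w) C.
Proof.
move=> s0 mC; rewrite NJ; last exact: measurableX.
congr esum; apply/seteqP; split=> u /=; first by move=> [u0 j0 [ut Cu]]; split.
move=> [ut j0 Cu]; split=> //; move: ut; rewrite /= in_itv /= => /andP[su _].
exact: le_lt_trans su.
Qed.

Lemma N_window_fin w T j : N w (`]0%R, T] `*` window j) < +oo.
Proof.
rewrite N_rectangle//; last exact: measurable_window.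
rewrite jump_count_finite ?ltry//.
by apply: (@finite_jumps_in _ _ (window j) j.+1%:R^-1) => //; rewrite invr_gt0.
Qed.

Lemma prodm_window_fin T j : prodm (`]0%R, T] `*` window j) < +oo.
Proof.
rewrite /time_space product_measure1E//; last exact: measurable_window.
apply: lte_mul_pinfty => //.
suff : leb `]0%R, T] \is a fin_num by [].
by rewrite lebesgue_measure_itv; case: ifP.
Qed.

Lemma mean_N_rectangle s t (C : set Rd) : (0 <= s)%R -> measurable C ->
  C `<=` [set~ 0%R] -> prodm (`]s, t] `*` C) < +oo ->
  \int[P0]_w N w (`]s, t] `*` C) = prodm (`]s, t] `*` C).
Proof.
move=> s0 mC C0 fin; have mD : measurable (`]s, t] `*` C : set (R * Rd)) by exact: measurableX.
have nuE : intensity mu (`]s, t] `*` C) = prodm (`]s, t] `*` C).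
  rewrite /intensity -/prodm; congr (prodm _); apply/seteqP; split=> x; first by move=> [].
  move=> [/= x1 x2]; split=> //; split => /=; last exact: C0.
  by move: x1; rewrite !in_itv /= => /andP[sx _]; rewrite (le_lt_trans s0).
have [l l0 lE] : exists2 l : R, (0 <= l)%R & prodm (`]s, t] `*` C) = l%:E.
  exists (fine (prodm (`]s, t] `*` C))); first exact: fine_ge0.
  by rewrite fineK// ge0_fin_numE.
rewrite lE; apply: poisson_mean => //; first exact: mN.
case: hN => _ _ _ [_ [_ + _ _]] _ => /(_ _ mD) h k.
by rewrite h nuE lE ?ltry.
Qed.

Lemma predictable_measurable (G : set (R * Ot * Rd)) :
  predictable_field_sigma P0 W J G ->
  measurable G /\ G `<=` (`]0%R, +oo[ `*` setT) `*` setT.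
Proof.
have mD : measurable ((`]0%R, +oo[ `*` setT) `*` setT : set (R * Ot * Rd)).
  by apply: measurableX => //; exact: measurableX.
set D := _ `*` setT => pG; apply: (pG [set G | measurable G /\ G `<=` D]); split.
  split; first by split; [exact: measurable0|exact: sub0set].
    by move=> A [mA AD]; split; [exact: measurableD|move=> x []].
  move=> F FD; split; first by apply: bigcupT_measurable => n; have [] := FD n.
  by move=> x [n _ Fx]; have [_] := FD n; exact.
move=> _ [s [t [F [C [/andP[s0 st] /filtration_measurable mF mC ->]]]]]; split.
  by apply: measurableX => //; apply: measurableX => //; exact: mF.
move=> x [[/= x1 _] _]; split => //; split=> //=.
by move: x1; rewrite !in_itv /= => /andP[sx _]; rewrite (le_lt_trans s0).
Qed.

Let rect (T : R) (j : nat) : set (R * Rd) := `]0%R, T] `*` window j.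

Let rect_section s t (F : set Ot) (C : set Rd) T j w : (0 <= s)%R ->
  at_sample ((`]s, t] `*` F) `*` C) w `&` rect T j =
  if w \in F then `]s, (Num.min t T)] `*` (C `&` window j) else set0.
Proof.
move=> s0; apply/seteqP; split=> -[r z] /=.
  move=> [[[/= rst Fw] Cz] [/= rT wz]]; rewrite mem_set//; split=> //=.
  move: rst rT; rewrite !in_itv /= le_min => /andP[-> ->] /andP[_ ->].
  by [].
case: ifPn => // /set_mem Fw [/= + [Cz wz]]; rewrite in_itv /= le_min => /and3P[sr rt rT].
by split; split => //=; rewrite in_itv /= ?sr// (le_lt_trans s0).
Qed.

(** On rectangles this is the mean of a Poisson variable that is independent of
    the past. *)
Lemma compensation_rect s t F (C : set Rd) T j : (0 <= s)%R -> filtration P0 W J s F ->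
  measurable C ->
  let G := (`]s, t] `*` F) `*` C in
  [/\ measurable_fun setT (fun w => N w (at_sample G w `&` rect T j)),
      measurable_fun setT (fun w => prodm (at_sample G w `&` rect T j)) &
      \int[P0]_w N w (at_sample G w `&` rect T j) =
      \int[P0]_w prodm (at_sample G w `&` rect T j)].
Proof.
move=> s0 Fs mC G; have mF : measurable F by exact: (filtration_measurable mW mJ Fs).
set D : set (R * Rd) := `]s, (Num.min t T)] `*` (C `&` window j).
have mCj : measurable (C `&` window j) by apply: measurableI => //; exact: measurable_window.
have mD : measurable D by exact: measurableX.
have secE (m : Ot -> {measure set (R * Rd) -> \bar R}) w :
    m w (at_sample G w `&` rect T j) = ((fun w => m w D) \_ F) w.
  by rewrite /G rect_section// patchE; case: ifP => // _; rewrite measure0.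
have mND : measurable_fun setT (fun w => N w D) by exact: mN.
have Dfin : prodm D < +oo.
  apply: le_lt_trans (prodm_window_fin T j); apply: le_measure; rewrite ?in_setE//.
    by apply: measurableX => //; exact: measurable_window.
  move=> [r z] [+ [Cz wz]]; rewrite /= !in_itv /= le_min => /and3P[sr rt rT].
  by split=> //; rewrite /= ?in_itv /= (le_lt_trans s0 sr).
split.
- by under eq_fun do rewrite secE; apply/(measurable_restrictT _ mF); exact: measurable_funTS.
- under eq_fun do rewrite (secE (fun=> prodm)).
  by apply/(measurable_restrictT _ mF); exact: measurable_cst.
- under eq_integral do rewrite secE.
  under [RHS]eq_integral do rewrite (secE (fun=> prodm)).
  rewrite -!integral_mkcond integral_cst// muleC.
  rewrite integral_indep//.
    rewrite mean_N_rectangle//.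
    move=> z [_] /= wz z0; move: wz; rewrite /window /= z0 normr0 leNgt invr_gt0 ltr0n.
    by [].
  move=> B mB.
  have NDE : (fun w => N w D) = (fun w => jump_count `]s, (Num.min t T)] (J w) (C `&` window j)).
    by apply/funext => w; exact: N_rectangle.
  by rewrite NDE; exact: (indep_filtration mW mJ iJ WJ _ s0 mCj mB Fs).
Qed.

(** The predictable rectangles are stable under intersection, and both measures
    are finite on a window, so that the rectangles determine the mean. *)
Lemma compensation_window (G : set (R * Ot * Rd)) T j :
  predictable_field_sigma P0 W J G ->
  [/\ measurable_fun setT (fun w => N w (at_sample G w `&` rect T j)),
      measurable_fun setT (fun w => prodm (at_sample G w `&` rect T j)) &
      \int[P0]_w N w (at_sample G w `&` rect T j) =
      \int[P0]_w prodm (at_sample G w `&` rect T j)].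
Proof.
move=> pG; set D := (`]0%R, +oo[ `*` setT) `*` setT : set (R * Ot * Rd).
have FT s : filtration P0 W J s setT by exact: (@measurableT _ (g_sigma_algebraType _)).
have mrect : measurable (rect T j) by apply: measurableX => //; exact: measurable_window.
have DE w : at_sample D w `&` rect T j =
    at_sample ((`]0%R, T] `*` setT) `*` setT) w `&` rect T j.
  apply/seteqP; split=> -[r z] [] /=.
    by move=> _ [/= rT wz]; split.
  move=> [[/= rT _] _] h; split=> //; split=> //; split=> //=.
  by move: rT; rewrite !in_itv /= => /andP[->].
have [mND mpD eqD] := compensation_rect T T j (lexx 0%R) (FT 0%R) measurableT.
have mD : measurable D by apply: measurableX => //; exact: measurableX.
have DH : [/\ measurable_fun setT (fun w => N w (at_sample D w `&` rect T j)),
      measurable_fun setT (fun w => prodm (at_sample D w `&` rect T j)) &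
      \int[P0]_w N w (at_sample D w `&` rect T j) =
      \int[P0]_w prodm (at_sample D w `&` rect T j)].
  split.
  - by under eq_fun do rewrite DE.
  - by under eq_fun do rewrite DE.
  - by under eq_integral do rewrite DE; under [RHS]eq_integral do rewrite DE.
have [mN' mp' eq'] := DH.
pose Gs : set (set (R * Ot * Rd)) := [set G | exists s t F C,
  [/\ (0 <= s <= t)%R, filtration P0 W J s F, measurable C & G = (`]s, t] `*` F) `*` C]].
have GsI : setI_closed Gs.
  move=> _ _ [s1 [t1 [F1 [C1 [/andP[s10 st1] f1 c1 ->]]]]]
             [s2 [t2 [F2 [C2 [/andP[s20 st2] f2 c2 ->]]]]].
  pose s := Num.max s1 s2; pose t := Num.max s (Num.min t1 t2).
  exists s, t, (F1 `&` F2), (C1 `&` C2); split.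
  - by apply/andP; split; [rewrite /s le_max s10|rewrite /t le_max lexx].
  - apply: g_sigma_algebraI.
      by apply: filtration_le f1; rewrite /s le_max lexx.
    by apply: filtration_le f2; rewrite /s le_max lexx orbT.
  - exact: measurableI.
  - apply/seteqP; split=> -[[r w] z] /=.
      move=> [[[r1 w1] z1] [[r2 w2] z2]]; split=> //; split=> //.
      move: r1 r2; rewrite /= !in_itv /= => /andP[? rt1] /andP[? rt2].
      rewrite /t /s gt_max; apply/andP; split; first by apply/andP.
      by rewrite le_max !le_min rt1 rt2 orbT.
    move=> [[+ [w1 w2]] [z1 z2]]; rewrite /= in_itv /= /t => /andP[sr].
    rewrite le_max leNgt sr /= le_min => /andP[rt1 rt2].
    by move: sr; rewrite /s gt_max => /andP[r1 r2]; split; split=> //; split=> //=;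
      rewrite in_itv /= ?r1 ?r2.
have Gsub E : Gs E -> measurable E /\ E `<=` D.
  by move=> GE; apply: predictable_measurable; exact: sub_sigma_algebra.
have H := unique_on_samples mrect (fun w => N_window_fin w T j)
  (fun=> prodm_window_fin T j) GsI mD Gsub.
case: (fun h1 h2 h3 => H P0 h1 h2 h3 G pG); last by move=> _ _ ? ? ?; split.
- move=> E GE; have [mE ED] := Gsub E GE.
  move: GE => [s [t [F [C [/andP[s0 st] Fs mC EE]]]]].
  have := compensation_rect t T j s0 Fs mC.
  by rewrite -EE => -[? ? ?]; split.
- by split.
- rewrite eq'; apply: (@le_lt_trans _ _ (prodm (rect T j))); last exact: prodm_window_fin.
  apply: (@le_trans _ _ (\int[P0]_w (cst (prodm (rect T j)) w))).
    apply: ge0_le_integral => // w _; apply: le_measure; rewrite ?in_setE.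
    + by apply: measurableI => //; exact: measurable_at_sample.
    + exact: mrect.
    + exact: subIsetr.
  rewrite integral_cst// [X in _ * X](_ : _ = 1) ?mule1//; exact: probability_setT.
Qed.

Lemma setX_window T : (`]0%R, T] `*` [set~ 0%R] : set (R * Rd)) = \bigcup_j rect T j.
Proof.
rewrite -window_bigcup; apply/seteqP; split=> -[r z] /=.
  by move=> [rT [j _ jz]]; exists j.
by move=> [j _ [rT jz]]; split=> //; exists j.
Qed.

(** Monotone limit over the windows, which exhaust the complement of the origin,
    where both measures may be infinite. *)
Lemma compensation (G : set (R * Ot * Rd)) T : predictable_field_sigma P0 W J G ->
  let B := `]0%R, T] `*` [set~ 0%R] : set (R * Rd) in
  [/\ measurable_fun setT (fun w => N w (at_sample G w `&` B)),
      measurable_fun setT (fun w => prodm (at_sample G w `&` B)) &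
      \int[P0]_w N w (at_sample G w `&` B) =
      \int[P0]_w prodm (at_sample G w `&` B)].
Proof.
move=> pG B; have [mG _] := predictable_measurable pG.
have mrect j : measurable (rect T j) by apply: measurableX => //; exact: measurable_window.
have msec j w : measurable (at_sample G w `&` rect T j).
  by apply: measurableI => //; exact: measurable_at_sample.
have mono (m : {measure set (R * Rd) -> \bar R}) w :
    nondecreasing_seq (fun j => m (at_sample G w `&` rect T j)).
  move=> i j ij; apply: le_measure; rewrite ?in_setE//.
  by apply: setIS => -[r z] [? ?]; split=> //; exact: (window_mono ij).
have lim (m : {measure set (R * Rd) -> \bar R}) w :
    m (at_sample G w `&` rect T j) @[j --> \oo] --> m (at_sample G w `&` B).
  rewrite /B setX_window setI_bigcupr; apply: nondecreasing_cvg_mu => //.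
    exact: bigcup_measurable.
  move=> i j ij; apply/subsetPset; apply: setIS => -[r z] [? ?].
  by split=> //; exact: (window_mono ij).
have conv (m : Ot -> {measure set (R * Rd) -> \bar R}) :
    (forall j, measurable_fun setT (fun w => m w (at_sample G w `&` rect T j))) ->
    measurable_fun setT (fun w => m w (at_sample G w `&` B)) /\
    \int[P0]_w m w (at_sample G w `&` B) =
    limn (fun j => \int[P0]_w m w (at_sample G w `&` rect T j)).
  move=> mm; split.
    apply: (emeasurable_fun_cvg (fun j w => m w (at_sample G w `&` rect T j))) => [j|w _].
      exact: mm.
    exact: (lim (m w) w).
  rewrite -monotone_convergence//.
  by apply: eq_integral => w _; apply/esym/cvg_lim => //; exact: (lim (m w) w).
have [mNB NB] := conv N (fun j => let: And3 h _ _ := compensation_window T j pG in h).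
have [mpB pB] := conv (fun=> prodm) (fun j => let: And3 _ h _ := compensation_window T j pG in h).
split => //; rewrite NB pB; congr (limn _); apply/funext => j.
by have [] := compensation_window T j pG.
Qed.

End noise_compensation.

(** * Integrals over the jump times and their left limits *)

Section integral_left_limit.
Context {R : realType} {dX} {X : measurableType dX}.
Variables (m : {measure set X -> \bar R}) (p : X -> R) (E : set X).
Hypotheses (mp : measurable_fun setT p) (mE : measurable E).
Variables (u : R) (h : X -> R).
Hypothesis u0 : 0 < u.

Let S (i : interval R) : set X := E `&` p @^-1` [set` i].

Hypothesis ih : m.-integrable (S `]0, u[) (EFin \o h).

Let mS i : measurable (S i).
Proof. by apply: measurableI => //; rewrite -[_ @^-1` _]setTI; exact: mp. Qed.

Let S_split r : 0 < r -> r < u -> S `]0, u[ = S `]0, r] `|` S `]r, u[.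
Proof.
move=> r0 ru; rewrite /S -setIUr -preimage_setU; congr (_ `&` _ @^-1` _).
by rewrite -itv_bndbnd_setU// bnd_simp ltW.
Qed.

Let S_disj r : [disjoint S `]0, r] & S `]r, u[].
Proof.
apply/disj_setPS => x [[_]]; rewrite /= !in_itv /= => /andP[_ pr] [_ /=].
by rewrite in_itv /= ltNge pr.
Qed.

(** The integral of [`|h|] over the times in [`]r, u[] vanishes as [r] increases
    to [u], by monotone convergence over the times in [`]0, r]]. *)
Lemma integral_left_limit :
  \int[m]_(x in S `]0, r]) h x @[r --> u^'-] --> \int[m]_(x in S `]0, u[) h x.
Proof.
have mh : measurable_fun (S `]0, u[) h by apply/measurable_EFinP; exact: measurable_int ih.
pose G (A : set X) : \bar R := (\int[m]_(x in A) `|h x|%:E)%E.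
have GS : (G (S `]0%R, u[) < +oo)%E by case/integrableP : ih.
(* increases to [u] inside [`]0, u[] *)
pose rn n : R := u - u * n.+2%:R^-1.
have rn_lt n : rn n < u by rewrite /rn ltrBlDr ltrDl mulr_gt0// invr_gt0.
have rn_gt n : 0 < rn n by rewrite /rn subr_gt0 -[ltRHS]mulr1 ltr_pM2l// invf_lt1 ?ltr1n.
have S_sub r : r < u -> S `]0, r] `<=` S `]0, u[.
  move=> ru x [Ex]; rewrite /= !in_itv /= => /andP[p0 pr]; split=> //=.
  by rewrite in_itv /= p0 (le_lt_trans pr).
have Sr_sub r : 0 <= r -> S `]r, u[ `<=` S `]0, u[.
  move=> r0 x [Ex]; rewrite /= !in_itv /= => /andP[rp pu]; split=> //=.
  by rewrite in_itv /= pu (le_lt_trans r0).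
have Scup : S `]0, u[ = \bigcup_n S `]0, (rn n)].
  apply/seteqP; split=> x; last by move=> [n _]; exact: S_sub.
  move=> [Ex]; rewrite /= in_itv /= => /andP[p0 pu].
  have e0 : 0 < (u - p x) / u by rewrite divr_gt0// subr_gt0.
  have [n ne] := ltr_add_invr e0; rewrite add0r in ne.
  exists n => //; split=> //=; rewrite in_itv /= p0 /rn lerBrDr -lerBrDl.
  rewrite mulrC -ler_pdivlMr//; apply: le_trans (ltW ne).
  by rewrite lef_pV2 ?posrE// ler_nat.
have cvgG : G (S `]0, (rn n)]) @[n --> \oo] --> G (S `]0, u[).
  rewrite Scup; apply: ge0_nondecreasing_set_cvg_integral => //.
  - move=> i j ij; apply/subsetPset => x [Ex]; rewrite /= !in_itv /= => /andP[p0 pi].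
    split=> //=; rewrite in_itv /= p0; apply: le_trans pi _.
    by rewrite /rn lerD2l lerN2 ler_pM2l// lef_pV2 ?posrE// ler_nat.
  - move=> n; apply/measurable_EFinP; apply: measurableT_comp => //.
    by apply: measurable_funS mh => //; exact: S_sub.
have mSh A : measurable A -> A `<=` S `]0, u[ ->
    measurable_fun A (fun x => `|h x|%:E).
  move=> mA AS; apply/measurable_EFinP; apply: measurableT_comp => //.
  by apply: measurable_funS mh.
have GSn n : G (S `]0, (rn n)]) \is a fin_num.
  rewrite ge0_fin_numE ?integral_ge0//; apply: le_lt_trans GS.
  apply: ge0_subset_integral => //; last exact: S_sub.
  exact: mSh.
apply/cvgrPdist_lt => e e0.
have [n Gn] : exists n, (G (S `]0%R, u[) - G (S `]0%R, (rn n)]) < e%:E)%E.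
  have GSf : G (S `]0, u[) \is a fin_num by rewrite ge0_fin_numE// integral_ge0.
  apply: contrapT => /forallNP nG.
  have nG' k : (e%:E <= G (S `]0%R, u[) - G (S `]0%R, (rn k)]))%E.
    by rewrite leNgt; apply/negP; exact: nG.
  have : (G (S `]0%R, u[) <= G (S `]0%R, u[) - e%:E)%E.
    rewrite -{1}(cvg_lim _ cvgG)//; apply: lime_le; first by apply/cvg_ex; eexists; exact: cvgG.
    by apply: nearW => n; rewrite leeBrDr// addeC -leeBrDr//; exact: nG'.
  rewrite leNgt; apply/negP/negPn; rewrite lteBlDr//.
  by rewrite lteDl.
near=> r.
have ru : r < u by near: r; exact: nbhs_left_lt.
have rnr : rn n < r by near: r; exact: nbhs_left_gt.
have r0 : 0 < r by rewrite (lt_trans (rn_gt n)).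
have ih' : m.-integrable (S `]r, u[) (EFin \o h).
  by apply: integrableS ih => //; apply: Sr_sub; exact: ltW.
rewrite (S_split r0 ru) Rintegral_setU//; last by rewrite -S_split.
rewrite addrC addKr.
apply: le_lt_trans (le_normr_Rintegral _ ih') _ => //.
rewrite -lte_fin; apply: le_lt_trans Gn.
have -> : G (S `]0, u[) = (G (S `]0%R, (rn n)]) + G (S `](rn n), u[))%E.
  rewrite /G (S_split (rn_gt n) (rn_lt n)) ge0_integral_setU// -?S_split//.
  exact: mSh.
rewrite [X in (_ <= X)%E]addeAC subee// add0e.
have rnu : S `]r, u[ `<=` S `](rn n), u[.
  move=> x [Ex]; rewrite /= !in_itv /= => /andP[rp pu]; split=> //=.
  by rewrite in_itv /= pu (lt_trans rnr).
rewrite /Rintegral fineK.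
  apply: ge0_subset_integral => //.
  by apply: mSh => //; apply: Sr_sub; exact: ltW.
by case/integrableP : ih' => _ ih'; rewrite ge0_fin_numE// integral_ge0.
Unshelve. all: by end_near. Qed.

End integral_left_limit.

Section time_space_integral.
Context {R : realType} {d : nat}.
Local Notation Rd := (borel 'rV[R]_d).
Local Notation leb := (@lebesgue_measure R).
Local Open Scope ereal_scope.
Variable mu : {sigma_finite_measure set Rd -> \bar R}.

Lemma integral_time_space (phi : R * Rd -> \bar R) : (forall x, 0 <= phi x) ->
  measurable_fun setT phi ->
  \int[time_space mu]_x phi x = \int[leb]_s \int[mu]_z phi (s, z).
Proof.
move=> phi0 mphi.
have mid : measurable_fun setT ((fun x => x) : measurableTypeR R * Rd -> R * Rd).
  by move=> _ C mC; rewrite setTI; exact: mC.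
have mphi' : measurable_fun setT (phi : measurableTypeR R * Rd -> \bar R) by exact: mphi.
rewrite (@eq_measure_integral _ _ _ setT (image_on measurableT mid (leb \x mu))).
  rewrite integral_image_on//.
  exact: (fubini_tonelli1 _ mphi' phi0).
by move=> C mC _; rewrite image_onE// setTI.
Qed.

Lemma integral_time_space_itv (T : R) (phi : R * Rd -> \bar R) :
  (forall x, 0 <= phi x) ->
  measurable_fun (`]0%R, T] `*` [set~ 0%R] : set (R * Rd)) phi ->
  \int[time_space mu]_(x in `]0%R, T] `*` [set~ 0%R]) phi x =
  \int[leb]_(s in `]0%R, T]) \int[mu]_(z in [set~ 0%R]) phi (s, z).
Proof.
move=> phi0 mphi.
have m0 : measurable ([set~ 0%R] : set Rd) by apply: measurableC; exact: borel_set1.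
have mB : measurable (`]0%R, T] `*` [set~ 0%R] : set (R * Rd)) by exact: measurableX.
rewrite integral_mkcond integral_time_space; last 2 first.
- by move=> x; rewrite patchE; case: ifP.
- exact/(measurable_restrictT _ mB).
rewrite [RHS]integral_mkcond; apply: eq_integral => s _.
rewrite patchE; case: ifPn => [/set_mem s0|/negP s0].
  rewrite [RHS]integral_mkcond; apply: eq_integral => z _; rewrite !patchE.
  suff -> : ((s, z) \in `]0%R, T] `*` [set~ 0%R]) = (z \in [set~ 0%R]) by [].
  apply/idP/idP => /set_mem; first by move=> [_ ?]; exact/mem_set.
  by move=> z0; apply/mem_set; split.
rewrite integral0_eq// => z _; rewrite patchE; case: ifPn => // /set_mem[s1 _].
by exfalso; apply: s0; exact/mem_set.
Qed.

(** Markov's inequality *)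
Lemma measure_away_fin (m : {measure set Rd -> \bar R}) (C : set Rd) (c : R) :
  \int[m]_(z in [set~ 0%R]) (enorm z)%:E < +oo -> measurable C -> (0 < c)%R ->
  (forall z, C z -> (c <= enorm z)%R) -> m C < +oo.
Proof.
move=> mfin mC c0 Cc.
have m0 : measurable ([set~ 0%R] : set Rd) by apply: measurableC; exact: borel_set1.
have enorm0 (z : 'rV[R]_d) : (0 <= enorm z)%R by exact: sqrtr_ge0.
have C0 : C `<=` [set~ 0%R].
  move=> z /Cc /= + z0; rewrite z0 /enorm big1 ?sqrtr0 ?leNgt ?c0// => i _.
  by rewrite mxE expr0n.
have : c%:E * m C < +oo.
  apply: le_lt_trans mfin; rewrite -integral_cst//.
  apply: (@le_trans _ _ (\int[m]_(z in C) (enorm z)%:E)).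
    apply: ge0_le_integral => //.
    - by move=> z _; rewrite lee_fin ltW.
    - by apply/measurable_EFinP/measurable_funTS; exact: measurable_enorm.
  apply: ge0_subset_integral => //.
    by apply/measurable_EFinP/measurable_funTS; exact: measurable_enorm.
  by move=> z _; rewrite lee_fin.
move=> h; rewrite ltNge leye_eq; apply/eqP => mCy; move: h.
by rewrite mCy gt0_muley ?lte_fin// ltxx.
Qed.

End time_space_integral.

Lemma subset_esum {R : realType} {T : choiceType} (I1 I2 : set T) (a : T -> \bar R) :
  (forall i, 0 <= a i)%E -> I1 `<=` I2 ->
  (\esum_(i in I1) a i <= \esum_(i in I2) a i)%E.
Proof.
move=> a0 I12; rewrite esum_mkcond [leRHS]esum_mkcond; apply: le_esum => i _.
case: ifPn => [/set_mem I1i|_]; first by rewrite mem_set//; exact: I12.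
by case: ifP.
Qed.

Section controlled.
Context {R : realType} {d : nat} {dO} {Ot : measurableType dO}.
Variable P0 : probability Ot R.
Local Notation Rd := (borel 'rV[R]_d).
Local Notation leb := (@lebesgue_measure R).
Local Open Scope ereal_scope.
Variables (mu : {sigma_finite_measure set Rd -> \bar R})
  (W : R -> Ot -> Rd) (J : Ot -> cadlag R d)
  (N : Ot -> {measure set (R * Rd) -> \bar R}).
Hypothesis hN : driving_noise P0 mu W J N.
Hypothesis mu_fin : \int[mu]_(z in [set~ 0%R]) (enorm z)%:E < +oo.
Variable thd : R -> Ot -> Rd -> Rd.
Hypothesis pthd : predictable_field P0 W J thd.

Definition jump_domain (T : R) : set (R * Rd) := `]0%R, T] `*` [set~ 0%R].

Lemma measurable_jump_domain T : measurable (jump_domain T).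
Proof. by apply: measurableX => //; apply: measurableC; exact: borel_set1. Qed.

Let mu_window j : mu (@window R d j) < +oo.
Proof.
apply: (measure_away_fin mu_fin (measurable_window j) (c := j.+1%:R^-1%R)) => //.
by move=> z; move/le_trans; apply; exact: norm_le_enorm.
Qed.

Let field_event (C : set Rd) : set (R * Ot * Rd) :=
  ((`]0%R, +oo[ `*` setT) `*` setT) `&` [set x | C (thd x.1.1 x.1.2 x.2)].

Let field_event_predictable C : measurable C ->
  predictable_field_sigma P0 W J (field_event C).
Proof. by move=> mC; exact: pthd. Qed.

Let at_field C w T : at_sample (field_event C) w `&` jump_domain T =
  jump_domain T `&` (fun x => thd x.1 w x.2) @^-1` C.
Proof.
apply/seteqP; split=> -[s z] /=; first by move=> [[_ /= Cz] [h1 h2]]; split.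
move=> [[/= h1 h2] Cz]; split=> //; split=> //; split=> //; split => //=.
by move: h1; rewrite !in_itv /= => /andP[->].
Qed.

Lemma measurable_field w T :
  measurable_fun (jump_domain T) (fun x : R * Rd => thd x.1 w x.2).
Proof.
move=> mT C mC; rewrite -at_field; apply: measurableI => //.
apply: measurable_at_sample.
have [] // := predictable_measurable hN (field_event_predictable mC).
Qed.

Let jump_law T w := image_on (measurable_jump_domain T) (@measurable_field w T) (N w).
Let mean_law T w := image_on (measurable_jump_domain T) (@measurable_field w T) (time_space mu).

Let comp T C : measurable C -> 
  [/\ measurable_fun setT (fun w => jump_law T w C),
      measurable_fun setT (fun w => mean_law T w C) &
      \int[P0]_w jump_law T w C = \int[P0]_w mean_law T w C].
Proof.
move=> mC; have [h1 h2 h3] := compensation hN mu_window T (field_event_predictable mC).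
have e1 w : jump_law T w C = N w (at_sample (field_event C) w `&` jump_domain T).
  by rewrite image_onE// at_field.
have e2 w : mean_law T w C = time_space mu (at_sample (field_event C) w `&` jump_domain T).
  by rewrite image_onE// at_field.
split.
- by under eq_fun do rewrite e1.
- by under eq_fun do rewrite e2.
- by under eq_integral do rewrite e1; under [RHS]eq_integral do rewrite e2.
Qed.

Lemma measurable_jump_integral T (phi : Rd -> \bar R) : (forall z, 0 <= phi z) ->
  measurable_fun setT phi ->
  measurable_fun setT (fun w => \int[N w]_(x in jump_domain T) phi (thd x.1 w x.2)).
Proof.
move=> phi0 mphi.
rewrite (_ : (fun _ => _) = (fun w => \int[jump_law T w]_z phi z)).
  by apply: measurable_fun_integral_kernel => // C /(comp T)[].
by apply/funext => w; rewrite integral_image_on.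
Qed.

(** The compensation formula, which holds for sets, extends to functions because
    both sides are integrals against mixtures of image measures. *)
Lemma mean_jump_integral T (phi : Rd -> \bar R) : (forall z, 0 <= phi z) ->
  measurable_fun setT phi ->
  \int[P0]_w \int[N w]_(x in jump_domain T) phi (thd x.1 w x.2) =
  \int[P0]_w \int[leb]_(s in `]0%R, T]) \int[mu]_(z in [set~ 0%R]) phi (thd s w z).
Proof.
move=> phi0 mphi.
transitivity (\int[P0]_w \int[jump_law T w]_z phi z).
  by apply: eq_integral => w _; rewrite integral_image_on.
transitivity (\int[P0]_w \int[mean_law T w]_z phi z).
  have m1 C : measurable C -> measurable_fun setT (fun w => jump_law T w C).
    by move=> /(comp T)[].
  have m2 C : measurable C -> measurable_fun setT (fun w => mean_law T w C).
    by move=> /(comp T)[].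
  by apply/eqP; rewrite eq_le; apply/andP; split;
    apply: le_integral_kernel => // C /(comp T)[_ _ ->].
apply: eq_integral => w _; rewrite integral_image_on//.
rewrite (@integral_time_space_itv _ _ mu T (fun x => phi (thd x.1 w x.2)))//.
apply: (measurable_comp measurableT) => //; last exact: measurable_field.
Qed.

(** The event may bear on a jump of the noise together with its image by the
    control, so that it can tell from which noise jumps [C] is reached. *)
Lemma mean_jump_count T (C E : set Rd) : measurable C -> measurable E ->
  let H w := jump_domain T `&` [set x | C (thd x.1 w x.2) /\ E x.2] in
  measurable_fun setT (fun w => N w (H w)) /\
  \int[P0]_w N w (H w) = \int[P0]_w time_space mu (H w).
Proof.
move=> mC mE H.
pose D := (`]0%R, +oo[ `*` setT) `*` setT : set (R * Ot * Rd).
pose G := field_event C `&` (D `&` [set x | E x.2]).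
have pD : predictable_field_sigma P0 W J (D `&` [set x | E x.2]).
  have -> : D `&` [set x | E x.2] = \bigcup_n ((`]0%R, n%:R] `*` setT) `*` E).
    apply/seteqP; split=> -[[s w] z] /=.
      move=> [[[/= s0 _] _] Ez]; exists (Num.truncn s).+1 => //; split=> //; split=> //=.
      move: s0; rewrite !in_itv /= => /andP[s0 _]; rewrite s0 /= ltW//.
      exact: truncnS_gt.
    move=> [n _ [[/= sn _] Ez]]; split=> //; split=> //; split=> //=.
    by move: sn; rewrite !in_itv /= => /andP[->].
  apply: sigma_algebra_bigcup => n; apply: sub_sigma_algebra.
  exists 0%R, n%:R, setT, E; split=> //; first by rewrite lexx ler0n.
  exact: (@measurableT _ (g_sigma_algebraType _)).
have pG : predictable_field_sigma P0 W J G.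
  have sub A : predictable_field_sigma P0 W J A -> A `<=` D.
    by move=> /(predictable_measurable hN)[].
  have pC := field_event_predictable mC.
  have [DT DD DI DII] := (@sigma_algebraP _ D (predictable_field_sigma P0 W J) sub).1
    (smallest_sigma_algebra _ _).
  exact: DII.
have GH w : at_sample G w `&` jump_domain T = H w.
  rewrite /H; apply/seteqP; split=> -[s z] /=.
    by move=> [[[_ /= Cz] [_ /= Ez]] h]; split.
  move=> [h [Cz Ez]]; split=> //.
  have s0 : s \in `]0%R, +oo[ by move: h => -[/=]; rewrite !in_itv /= => /andP[->].
  by split; split=> //; split.
have [h1 _ h3] := compensation hN mu_window T pG.
split; first by under eq_fun do rewrite -GH.
by under eq_integral do rewrite -GH; under [RHS]eq_integral do rewrite -GH.
Qed.

End controlled.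

(** * Jumps of the controlled process *)

Lemma cvg_rV {R : realType} {d : nat} {T : Type} (F : set_system T) {FF : ProperFilter F}
    (f : T -> 'rV[R]_d) (l : 'rV[R]_d) :
  (forall i, f x 0 i @[x --> F] --> l 0 i) -> f x @[x --> F] --> l.
Proof.
move=> fl; apply/cvgrPdist_lt => e e0.
have : \forall x \near F, forall i, `|l 0 i - f x 0 i| < e.
  by apply: filter_forall => i; have /cvgrPdist_lt := fl i; apply.
by apply: filterS => x fx; apply/norm_ltP => // i; rewrite !mxE; exact: fx.
Qed.

Lemma ge0_le_integral_any {R : realType} {dX} {X : measurableType dX}
    (m : {measure set X -> \bar R}) (D : set X) (f g : X -> \bar R) :
  (forall x, D x -> 0 <= f x)%E -> (forall x, D x -> f x <= g x)%E ->
  (\int[m]_(x in D) f x <= \int[m]_(x in D) g x)%E.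
Proof.
move=> f0 fg; have g0 x : D x -> (0 <= g x)%E by move=> Dx; exact: le_trans (f0 _ Dx) (fg _ Dx).
rewrite !ge0_integralE// ge_ereal_sup// => _ [h /= hf] <-.
apply: ereal_sup_ubound; exists h => //= x; apply: le_trans (hf x) _.
by rewrite !patchE; case: ifPn => [/set_mem/fg|_].
Qed.

Lemma ae_lty {R : realType} {dX} {X : measurableType dX}
    (m : {measure set X -> \bar R}) (f : X -> \bar R) :
  (forall x, 0 <= f x)%E -> measurable_fun setT f ->
  (\int[m]_x f x < +oo)%E -> {ae m, forall x, (f x < +oo)%E}.
Proof.
move=> f0 mf fy.
have : m.-integrable setT f.
  by apply/integrableP; split=> //; under eq_integral do rewrite gee0_abs//.
move=> /integrable_ae => /(_ measurableT); apply: filterS => x /(_ I).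
by rewrite ge0_fin_numE.
Qed.

Section jump_integral_path.
Context {R : realType} {d : nat}.
Local Notation Rd := (borel 'rV[R]_d).
Local Notation leb := (@lebesgue_measure R).
(** One sample point: [n] is the jump measure of the path [j]. *)
Variables (j : cadlag R d) (n : {measure set (R * Rd) -> \bar R}).
Hypothesis nj : forall C, measurable C -> n C =
  (\esum_(s in [set s | [/\ (0 < s)%R, jump j s <> 0%R & C (s, jump j s)]]) 1)%E.
Variable h : R * Rd -> R.

Let at_time (u : R) : set (R * Rd) := [set u] `*` [set~ 0].

Let m_at_time u : measurable (at_time u).
Proof. by apply: measurableX => //; apply: measurableC; exact: borel_set1. Qed.

Lemma jump_measure_at_time u : 0 < u -> measurable_fun (at_time u) h ->
  \int[n]_(x in at_time u) h x = if jump j u == 0 then 0 else h (u, jump j u).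
Proof.
move=> u0 mh; have mhE : measurable_fun (at_time u) (EFin \o h) by exact/measurable_EFinP.
have nA A : measurable A -> A `<=` at_time u ->
    n A = if (u, jump j u) \in A then 1%E else 0%E.
  move=> mA Au; rewrite nj//; case: ifPn => [/set_mem Aj|/negP Aj].
    rewrite (_ : [set s | _] = [set u]) ?esum_set1//.
    apply/seteqP; split=> s /=; first by move=> [_ _ /Au[]].
    by move=> ->; split=> //; have [] := Au _ Aj.
  rewrite (_ : [set s | _] = set0) ?esum_set0//.
  rewrite -subset0 => s [_ _ As]; apply: Aj; apply/mem_set.
  by have [/= su _] := Au _ As; rewrite -su.
rewrite /Rintegral; case: ifPn => [/eqP j0|j0].
  rewrite (@eq_measure_integral _ _ _ _ (mzero : {measure set (R * Rd) -> \bar R})).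
    by rewrite integral_measure_zero.
  move=> A mA Au; rewrite nA// memNset// => /Au[_ /=]; rewrite j0; exact.
rewrite (@eq_measure_integral _ _ _ _ (\d_((u, jump j u) : R * Rd))).
  rewrite integral_dirac// diracE mem_set ?mul1e//=.
  by split => //=; exact/eqP.
move=> A mA Au; rewrite (_ : n A = ((u, jump j u) \in A)%:R%:E); first exact/esym/diracE.
by rewrite nA//; case: ifP.
Qed.

Lemma jump_integral_left_limit u : 0 < u ->
  n.-integrable (jump_domain u : set (R * Rd)) (EFin \o h) ->
  \int[n]_(x in jump_domain r) h x @[r --> u^'-] -->
  \int[n]_(x in jump_domain u) h x - (if jump j u == 0 then 0 else h (u, jump j u)).
Proof.
move=> u0 ih.
pose E : set (R * Rd) := setT `*` [set~ 0].
have mE : measurable E by apply: measurableX => //; apply: measurableC; exact: borel_set1.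
have dE (i : interval R) : E `&` fst @^-1` [set` i] = [set` i] `*` [set~ (0 : Rd)].
  by apply/seteqP; split=> x; [move=> [[_ ?] ?]|move=> [? ?]].
have mI (i : interval R) : measurable ([set` i] `*` [set~ 0] : set (R * Rd)).
  by rewrite -dE; apply: measurableI => //; rewrite -[_ @^-1` _]setTI; exact: measurable_fst.
have split_u : jump_domain u = (`]0, u[ `*` [set~ (0 : Rd)]) `|` at_time u.
  apply/seteqP; split=> -[s z] /=.
    move=> [/= + z0]; rewrite in_itv /= le_eqVlt => /andP[s0 /predU1P[->|su]]; first by right.
    by left; split=> //=; rewrite in_itv /= s0.
  move=> [[/= + z0]|[/= -> z0]]; last by split=> //=; rewrite in_itv /= u0 lexx.
  by rewrite in_itv /= => /andP[s0 /ltW su]; split=> //=; rewrite in_itv /= s0.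
have ih' : n.-integrable (`]0, u[ `*` [set~ 0] : set (R * Rd)) (EFin \o h).
  apply: integrableS ih => //; first exact: (mI `]0, u]).
  by rewrite split_u; exact: subsetUl.
have mh : measurable_fun (at_time u) h.
  have := measurable_int _ ih => /measurable_EFinP; apply: measurable_funS => //.
    exact: (mI `]0, u]).
  by rewrite split_u; exact: subsetUr.
rewrite -jump_measure_at_time// split_u Rintegral_setU//; last 2 first.
- by rewrite -split_u.
- by apply/disj_setPS => -[s z] [[/= su _] [/= sE _]]; move: su; rewrite sE in_itv /= ltxx andbF.
rewrite addrK.
have := @integral_left_limit R _ _ n fst E measurable_fst mE u h u0; rewrite dE => /(_ ih').
by under eq_fun do rewrite dE.
Qed.

End jump_integral_path.

Section controlled_jump.
Context {R : realType} {d : nat} {dO} {Ot : measurableType dO}.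
Variable P0 : probability Ot R.
Local Notation Rd := (borel 'rV[R]_d).
Local Notation leb := (@lebesgue_measure R).
Variables (mu : {sigma_finite_measure set Rd -> \bar R})
  (W : R -> Ot -> Rd) (J : Ot -> cadlag R d)
  (N : Ot -> {measure set (R * Rd) -> \bar R}).
Hypothesis hN : driving_noise P0 mu W J N.
Hypothesis mu_fin : (\int[mu]_(z in [set~ 0%R]) (enorm z)%:E < +oo)%E.
Variables (U : set ({measure set Rd -> \bar R} * 'rV[R]_d * 'M[R]_d))
  (g : {measure set Rd -> \bar R} -> Rd -> Rd)
  (thd : R -> Ot -> Rd -> Rd) (th1 : R -> Ot -> 'rV[R]_d) (th2 : R -> Ot -> 'M[R]_d).
Hypothesis hadm : admissible P0 W J mu U g thd th1 th2.

Let pthd : predictable_field P0 W J thd. Proof. by case: hadm. Qed.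

Let enorm_ge0 (z : 'rV[R]_d) : 0 <= enorm z. Proof. exact: sqrtr_ge0. Qed.

Let frob2_ge0 (Q : 'M[R]_d) : 0 <= frob2 Q.
Proof.
rewrite /frob2 /mxtrace; apply: sumr_ge0 => i _; rewrite mxE; apply: sumr_ge0 => k _.
by rewrite mxE -expr2 sqr_ge0.
Qed.

Let menorm : measurable_fun setT (fun z : Rd => (enorm z)%:E).
Proof. by apply/measurable_EFinP; exact: measurable_enorm. Qed.

Let adm_fin (T : R) (f : R -> Ot -> \bar R) :
  (forall s w, 0 <= f s w)%E ->
  (forall s w, f s w <= (enorm (th1 s w))%:E + (frob2 (th2 s w))%:E +
         \int[mu]_(z in [set~ 0%R]) (enorm (thd s w z))%:E)%E ->
  (\int[P0]_w \int[leb]_(s in `]0%R, T]) f s w < +oo)%E.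
Proof.
move=> f0 fb; case: hadm => _ _ _ _ /(_ T); apply: le_lt_trans.
apply: ge0_le_integral_any => w _; first by apply: integral_ge0 => s _; exact: f0.
by apply: ge0_le_integral_any => s _; [exact: f0|exact: fb].
Qed.

Let field_integrable : {ae P0, forall w, forall n : nat,
  (\int[N w]_(x in jump_domain n%:R) (enorm (thd x.1 w x.2))%:E < +oo)%E}.
Proof.
apply: ae_foralln => n; apply: ae_lty.
- by move=> w; apply: integral_ge0 => x _; rewrite lee_fin.
- by apply: (measurable_jump_integral hN mu_fin pthd n%:R (phi := fun z => (enorm z)%:E)) => // z; rewrite lee_fin.
rewrite (mean_jump_integral hN mu_fin pthd n%:R (phi := fun z => (enorm z)%:E))//.
apply: adm_fin => s w; first by apply: integral_ge0 => z _; rewrite lee_fin.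
by rewrite leeDr// -EFinD lee_fin addr_ge0.
Qed.

Let drift_integrable : {ae P0, forall w, forall n : nat,
  (\int[leb]_(s in `]0%R, n%:R]) (enorm (th1 s w))%:E < +oo)%E}.
Proof.
apply: ae_foralln => n; apply: ae_lty.
- by move=> w; apply: integral_ge0 => x _; rewrite lee_fin.
- case: hadm => -[_ mth1] _ _ _ _.
  pose A : set (Ot * measurableTypeR R) := setT `*` `]0, n%:R].
  have mA : measurable A by exact: measurableX.
  pose f := (fun y : Ot * measurableTypeR R => (enorm (th1 y.2 y.1))%:E) \_ A.
  have mf : measurable_fun setT f.
    apply/(measurable_restrictT _ mA).
    have mg : measurable_fun A (fun y : Ot * measurableTypeR R => (y.2, y.1) : R * Ot).
      apply: measurable_funTS; apply: measurable_fun_pair; first exact: measurable_snd.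
      exact: measurable_fst.
    have sub : (fun y : Ot * measurableTypeR R => (y.2, y.1) : R * Ot) @` A `<=` `]0, +oo[ `*` setT.
      move=> _ [[w s] [_ /= s0] <-]; split => //=.
      by move: s0; rewrite !in_itv /= => /andP[->].
    have mF : measurable (`]0, +oo[ `*` setT : set (R * Ot)) by exact: measurableX.
    exact: (measurableT_comp menorm (measurable_comp mF sub mth1 mg)).
  have f0 x : (0 <= f x)%E by rewrite /f patchE; case: ifP => // _; rewrite lee_fin.
  have := measurable_fun_fubini_tonelli_F (m2 := leb) f mf f0.
  rewrite (_ : fubini_F leb f = (fun w => \int[leb]_(s in `]0%R, n%:R]) (enorm (th1 s w))%:E)%E)//.
  apply/funext => w; rewrite /fubini_F [RHS]integral_mkcond; apply: eq_integral => s _.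
  rewrite /f !patchE; suff -> : ((w, s) \in A) = (s \in `]0, n%:R]%classic) by [].
  by apply/idP/idP => /set_mem; [move=> [_ ?]; exact/mem_set|move=> ?; apply/mem_set].
apply: adm_fin => s w; first by rewrite lee_fin.
rewrite -addeA leeDl// adde_ge0// ?lee_fin//.
by apply: integral_ge0 => z _; rewrite lee_fin.
Qed.

Variable B : Ot -> cadlag R d.
Hypothesis hB : levy_ito_integral P0 W J N thd th1 th2 B.

(** The drift and the stochastic integral are continuous, and the jump of the
    integral against the jump measure is the mass that it puts on one instant. *)
Lemma controlled_jump : {ae P0, forall w, forall u, 0 < u ->
  jump (B w) u = if jump (J w) u == 0 then 0 else thd u w (jump (J w) u)}.
Proof.
have [I [_ Icont _] hBI] := hB.
have nj : jump_measure J N by case: hN => _ _ _ [].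
apply: filterS3 field_integrable drift_integrable hBI => w ithd ith1 BE u u0.
have [n un] : exists n : nat, u <= n%:R.
  by exists (Num.truncn u).+1; exact/ltW/truncnS_gt.
have n0 : 0 < n%:R :> R by exact: lt_le_trans un.
have mth1 : measurable_fun (`]0, n%:R] : set (measurableTypeR R)) (fun s => th1 s w : Rd).
  case: hadm => -[_ mth1] _ _ _ _.
  have mg : measurable_fun (`]0, n%:R] : set (measurableTypeR R))
      (fun s : measurableTypeR R => (s, w) : R * Ot).
    apply: measurable_funTS; apply: measurable_fun_pair; first exact: measurable_id.
    exact: measurable_cst.
  have sub : (fun s : measurableTypeR R => (s, w) : R * Ot) @` `]0, n%:R] `<=` `]0, +oo[ `*` setT.
    move=> _ [s /= s0 <-]; split => //=.
    by move: s0; rewrite !in_itv /= => /andP[->].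
  have mF : measurable (`]0, +oo[ `*` setT : set (R * Ot)) by exact: measurableX.
  exact: (measurable_comp mF sub mth1 mg).
have ci (z : 'rV[R]_d) i : (`|(z 0 i)%:E| <= `|(enorm z)%:E|)%E.
  by rewrite /= lee_fin (ger0_norm (enorm_ge0 z)); apply: le_trans (coord_le_norm z i) (norm_le_enorm z).
have ith i : leb.-integrable `]0, u] (EFin \o (fun s => th1 s w 0 i)).
  have : leb.-integrable `]0, n%:R] (EFin \o (fun s => th1 s w 0 i)).
    apply: (@le_integrable _ _ _ leb _ _ _ (fun s => (enorm (th1 s w))%:E)) => //.
    - by apply/measurable_EFinP; apply: (measurableT_comp (measurable_coord i)).
    - by move=> s _; exact: ci.
    - apply/integrableP; split; first exact: (measurableT_comp menorm).
      by under eq_integral do rewrite gee0_abs ?lee_fin//; exact: ith1.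
  apply: integrableS => // s /=; rewrite !in_itv /= => /andP[-> su].
  exact: le_trans un.
have inj i : (N w).-integrable (jump_domain u : set (R * Rd))
    (EFin \o (fun x => (thd x.1 w x.2 : 'rV[R]_d) 0 i)).
  have mf := @measurable_field _ _ _ _ _ _ _ _ _ hN _ pthd w n%:R.
  have : (N w).-integrable (jump_domain n%:R : set (R * Rd))
      (EFin \o (fun x => (thd x.1 w x.2 : 'rV[R]_d) 0 i)).
    apply: (@le_integrable _ _ _ (N w) _ (@measurable_jump_domain R d n%:R) _ (fun x => (enorm (thd x.1 w x.2))%:E)) => //.
    - by apply/measurable_EFinP; apply: (measurableT_comp (measurable_coord i)).
    - by move=> x _; exact: ci.
    - apply/integrableP; split; first exact: (measurableT_comp menorm).
      by under eq_integral do rewrite gee0_abs ?lee_fin//; exact: ithd.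
  apply: integrableS => //; try exact: measurable_jump_domain.
  move=> [s z] [/= + z0]; rewrite in_itv /= => /andP[s0 su]; split=> //=.
  by rewrite in_itv /= s0 (le_trans su).
apply: jump_unique.
have nearB : {near u^'-, (fun r => \row_i (\int[leb]_(s in `]0, r]) th1 s w 0 i) +
    I r w + jump_integral N thd r w) =1 (fun r => B w r)}.
  near=> r; rewrite BE//; apply: ltW; near: r; exact: nbhs_left_gt.
apply: cvg_trans (near_eq_cvg nearB) _.
rewrite BE ?ltW//; apply: cvg_rV => i.
have drift : \int[leb]_(s in `]0, r]) th1 s w 0 i @[r --> u^'-] -->
    \int[leb]_(s in `]0, u]) th1 s w 0 i.
  have mid : measurable_fun setT ((fun s => s) : measurableTypeR R -> R).
    by move=> _ C mC; rewrite setTI; exact: mC.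
  have ith' : leb.-integrable `]0, u[ (EFin \o (fun s => th1 s w 0 i)).
    apply: integrableS (ith i) => // s /=; rewrite !in_itv /= => /andP[-> su].
    exact: ltW.
  have := @integral_left_limit R _ (measurableTypeR R) leb _ setT mid measurableT u
    (fun s => th1 s w 0 i) u0.
  rewrite setTI => /(_ ith'); under eq_fun do rewrite setTI.
  by rewrite (Rintegral_itv_bndo_bndc ith').
have ito : I r w 0 i @[r --> u^'-] --> (I u w : 'rV[R]_d) 0 i.
  have uu : u < u + 1 by rewrite ltrDl.
  have sub : [set` `[0, (u + 1)]] `<=` [set` `[0, +oo[ : interval R].
    by move=> r /=; rewrite !in_itv /= => /andP[->].
  have Ic : {for u, continuous (I ^~ w : R -> 'rV[R]_d)}.
    apply: (@within_continuous_continuous R R 'rV[R]_d 0 (u + 1)).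
    - exact: lt_trans uu.
    - exact: (continuous_subspaceW sub (Icont w)).
    - by rewrite in_itv /= u0.
  have Il := cvg_at_left_filter Ic.
  exact: (cvg_comp _ (fun z : 'rV[R]_d => z 0 i) Il (@coord_continuous _ _ _ 0 i _)).
have jmp := jump_integral_left_limit (nj w) u0 (inj i).
rewrite (_ : (fun _ => _) = (fun r => (\int[leb]_(s in `]0, r]) th1 s w 0 i +
    (I r w : 'rV[R]_d) 0 i) + \int[N w]_(x in jump_domain r) (thd x.1 w x.2 : 'rV[R]_d) 0 i)); last first.
  by apply/funext => r; rewrite !mxE.
set l := (X in _ --> X); set x := (if _ then _ else _) in jmp.
rewrite (_ : l = (\int[leb]_(s in `]0, u]) th1 s w 0 i + (I u w : 'rV[R]_d) 0 i) +
    (\int[N w]_(x in jump_domain u) (thd x.1 w x.2 : 'rV[R]_d) 0 i - x)).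
  exact: cvgD (cvgD drift ito) jmp.
by rewrite /l /x !mxE addrA; case: ifP => _; rewrite ?mxE.
Unshelve. all: by end_near. Qed.

End controlled_jump.

(** * Laws of controlled processes *)


(** Integrals of nonnegative functions are lower integrals, which null sets do not
    affect, whether or not the functions are measurable. *)
Lemma ae_le_integral_any {R : realType} {dX} {X : measurableType dX}
    (m : {measure set X -> \bar R}) (D : set X) (f g : X -> \bar R) :
  (forall x, D x -> 0 <= f x)%E -> (forall x, D x -> 0 <= g x)%E ->
  {ae m, forall x, D x -> (f x <= g x)%E} ->
  (\int[m]_(x in D) f x <= \int[m]_(x in D) g x)%E.
Proof.
move=> f0 g0 [Z [mZ Z0 Zfg]].
rewrite ge0_integralE// ge_ereal_sup// => _ [h /= hf] <-.
have mh : measurable_fun setT (fun x : X => (h x)%:E) by exact/measurable_EFinP.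
have h0 x : (0 <= (h x)%:E)%E by rewrite lee_fin.
rewrite -integralT_nnsfun (ge0_negligible_integral mZ)//.
rewrite integral_mkcond [leRHS]integral_mkcond.
apply: ge0_le_integral_any => x _; first by apply: erestrict_ge0 => y _; exact: h0.
rewrite patchE; case: ifPn => [/set_mem[_ Zx]|_]; last by apply: erestrict_ge0 => y; exact: g0.
apply: le_trans (hf x) _; rewrite !patchE; case: ifPn => [/set_mem Dx|_]; last exact: lexx.
by apply: contrapT => fg; apply: Zx; apply: Zfg => /= /(_ Dx) /fg.
Qed.

Lemma integrable_tail {R : realType} {dX} {X : measurableType dX}
    (m : {measure set X -> \bar R}) (f : X -> \bar R) (e : R) :
  (forall x, 0 <= f x)%E -> measurable_fun setT f ->
  (\int[m]_x f x < +oo)%E -> 0 < e ->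
  exists n : nat, (\int[m]_(x in [set x | (n%:R%:E < f x)%E]) f x < e%:E)%E.
Proof.
move=> f0 mf fy e0.
pose D n := [set x | (n%:R%:E < f x)%E].
have mD n : measurable (D n).
  by rewrite /D -[X in measurable X]setTI; exact: emeasurable_fun_o_infty.
have intf : m.-integrable setT f.
  by apply/integrableP; split=> //; under eq_integral do rewrite gee0_abs//.
have mfD n : measurable_fun setT (f \_ (D n)).
  by apply/(measurable_restrictT _ (mD n)); exact: measurable_funTS.
have to0 : {ae m, forall x, setT x -> (f \_ (D n)) x @[n --> \oo] --> (cst 0%E x : \bar R)}.
  apply: filterS (ae_lty f0 mf fy) => x fxy _; apply: cvg_near_cst.
  near=> n; rewrite patchE; case: ifPn => // /set_mem; rewrite /D /= => nf.
  exfalso; move: nf; rewrite -[f x]fineK ?ge0_fin_numE// lte_fin ltNge => /negP; apply.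
  near: n; exact: nbhs_infty_ger.
have dom : {ae m, forall x n, setT x -> (`|(f \_ (D n)) x| <= f x)%E}.
  apply/aeW => x n _; rewrite patchE; case: ifP => _; last by rewrite abse0.
  by rewrite gee0_abs.
have [_ _] := dominated_convergence measurableT mfD (@measurable_cst _ _ _ _ _ _) to0 intf dom.
rewrite integral0 => cv0.
have [n _ nP] : \forall n \near \oo, (\int[m]_x (f \_ (D n)) x < e%:E)%E.
  by apply: (cv0 [set y | (y < e%:E)%E]); apply: open_ereal_lt'; rewrite lte_fin.
by exists n; rewrite -/(D n) integral_mkcond; exact: nP (leqnn n).
Unshelve. all: by end_near. Qed.

Section controlled_law.
Context {R : realType} {d : nat} {dO} {Ot : measurableType dO}.
Variable P0 : probability Ot R.
Local Notation Rd := (borel 'rV[R]_d).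
Local Notation leb := (@lebesgue_measure R).
Local Notation path_space := (borel (cadlag R d)).
Local Open Scope ereal_scope.
Variables (mu : {sigma_finite_measure set Rd -> \bar R})
  (W : R -> Ot -> Rd) (J : Ot -> cadlag R d)
  (N : Ot -> {measure set (R * Rd) -> \bar R}).
Hypothesis hN : driving_noise P0 mu W J N.
Hypothesis mu_fin : \int[mu]_(z in [set~ 0%R]) (enorm z)%:E < +oo.
Variables (U : set ({measure set Rd -> \bar R} * 'rV[R]_d * 'M[R]_d))
  (g : {measure set Rd -> \bar R} -> Rd -> Rd).
Hypothesis U0 : U !=set0.
Hypothesis hg : transport_family (levy_part U) mu g.
Variables (A : set Rd) (e : R).
Hypotheses (mA : measurable A) (e0 : (0 < e)%R)
  (Ae : forall z, A z -> (e <= `|z : 'rV[R]_d|)%R).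
Variable t : R.
Hypothesis t0 : (0 < t)%R.

Let notA0 : ~ A 0%R.
Proof. by move=> /Ae; rewrite normr0 leNgt e0. Qed.

Let m0 : measurable ([set~ 0%R] : set Rd).
Proof. by apply: measurableC; exact: borel_set1. Qed.

Let restrictA_ge0 (phi : Rd -> \bar R) : (forall z, 0 <= phi z) -> forall z, 0 <= (phi \_ A) z.
Proof. by move=> phi0 z; apply: erestrict_ge0 => y _. Qed.

Let measurable_restrictA (phi : Rd -> \bar R) : measurable_fun setT phi ->
  measurable_fun setT (phi \_ A).
Proof. by move=> mphi; apply/(measurable_restrictT _ mA); exact: measurable_funTS. Qed.

(** [g v] maps 0 to 0, which lies outside [A]: removing the origin from the
    domain of integration changes nothing. *)
Lemma transport_integral v (phi : Rd -> \bar R) : levy_part U v ->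
  (forall z, 0 <= phi z) -> measurable_fun setT phi ->
  \int[mu]_(z in [set~ 0%R]) (phi \_ A) (g v z) = \int[v]_(z in A) phi z.
Proof.
move=> Vv phi0 mphi; have [mgv gv0 vE] := hg.1 v Vv.
have mgv' : measurable_fun ([set~ 0%R] : set Rd) (g v) by exact: measurable_funTS.
rewrite -(integral_image_on m0 mgv' mu (restrictA_ge0 phi0))//; last exact: measurable_restrictA.
rewrite -integral_mkcond; apply: eq_measure_integral => C mC CA.
rewrite image_onE// vE//; last by move/CA/notA0.
congr (mu _); apply/seteqP; split=> z /=; first by move=> [].
by move=> Cz; split=> // z0; move: Cz; rewrite z0 gv0 => /CA.
Qed.

(** The transport maps bring into [A] only points of size at least some [eta],
    the same for all of them, and noise jumps of that size are finite in mean. *)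
Lemma large_noise_jumps : exists nJ : Ot -> \bar R,
  [/\ forall w, 0 <= nJ w, measurable_fun setT nJ, \int[P0]_w nJ w < +oo &
    exists2 eta : R, (forall v z, levy_part U v -> A (g v z) -> (eta <= enorm z)%R) &
      nJ = fun w => N w (`]0%R, t] `*` [set z | (eta <= enorm z)%R])].
Proof.
have [eta eta0 etaP] := hg.2 e e0.
pose C : set Rd := [set z | (eta <= enorm z)%R].
have mC : measurable C.
  rewrite /C (_ : [set z | _] = enorm @^-1` `[eta, +oo[).
    by rewrite -[_ @^-1` _]setTI; exact: measurable_enorm.
  by apply/seteqP; split=> z /=; rewrite in_itv /= andbT.
have C0 : C `<=` [set~ 0%R].
  move=> z /= Cz z0; move: Cz; rewrite /C /= z0 leNgt => /negP; apply.
  rewrite /enorm big1 ?sqrtr0// => i _; by rewrite mxE expr0n.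
have muC : mu C < +oo by apply: (measure_away_fin mu_fin mC eta0).
have mD : measurable (`]0%R, t] `*` C : set (R * Rd)) by exact: measurableX.
have mN : measurable_fun setT (fun w => N w (`]0%R, t] `*` C)).
  by case: hN => _ _ _ [_ [mN _ _ _]] _; exact: mN.
exists (fun w => N w (`]0%R, t] `*` C)); split=> //; last first.
  exists eta => // v z Vv Av; apply: (etaP v) => //.
  exact: le_trans (Ae Av) (norm_le_enorm _).
have fin : time_space mu (`]0%R, t] `*` C) < +oo.
  rewrite /time_space product_measure1E//; apply: lte_mul_pinfty => //.
  suff : leb `]0%R, t] \is a fin_num by [].
  by rewrite lebesgue_measure_itv; case: ifP.
by rewrite (mean_N_rectangle hN).
Qed.

Section one_law.
Variables (thd : R -> Ot -> Rd -> Rd) (th1 : R -> Ot -> 'rV[R]_d)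
  (th2 : R -> Ot -> 'M[R]_d) (B : Ot -> path_space).
Hypothesis hadm : admissible P0 W J mu U g thd th1 th2.
Hypothesis hB : levy_ito_integral P0 W J N thd th1 th2 B.
Hypothesis mB : measurable_fun setT B.

Let pthd : predictable_field P0 W J thd. Proof. by case: hadm. Qed.

Let mthd w : measurable_fun (jump_domain t) (fun x : R * Rd => thd x.1 w x.2).
Proof. exact: (@measurable_field _ _ _ _ _ _ _ _ _ hN _ pthd w t). Qed.

Let thdE : {ae P0, forall w, {ae leb, forall s, (0 < s)%R ->
  exists2 v, levy_part U v & thd s w = g v}}.
Proof.
case: hadm => _ _ _ + _; apply: filterS => w; apply: (@filterS _ _ (ae_filter_ringOfSetsType leb)) => s h s0.
by have [v [p [Q [Up -> _ _]]]] := h s0; exists v => //; exists p, Q.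
Qed.

(** Every jump of the controlled process is the image by the control of a jump
    of the driving noise, at the same time. *)
Lemma jump_count_le : {ae P0, forall w, forall C, measurable C ->
  jump_count `]0%R, t] (B w : cadlag R d) C <=
  N w (jump_domain t `&` (fun x => thd x.1 w x.2) @^-1` C)}.
Proof.
apply: filterS (controlled_jump hN mu_fin hadm hB) => w jB C mC.
have nj : jump_measure J N by case: hN => _ _ _ [].
rewrite nj; last by apply: mthd => //; exact: measurable_jump_domain.
apply: subset_esum => // u [/= ut Bu Cu].
have u0 : (0 < u)%R by move: ut; rewrite in_itv /= => /andP[].
move: Bu Cu; rewrite jB//; case: ifPn => // j0 _ Cu.
by split=> //; [exact/eqP|split=> //; split=> //=; exact/eqP].
Qed.

(** The compensation formula turns jumps of the noise into the reference
    measure [mu], whose image by the current control is one of the Levy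
    measures of the uncertainty set. *)
Lemma mean_jumps_le (phi : Rd -> \bar R) : (forall z, 0 <= phi z) ->
  measurable_fun setT phi ->
  \int[P0]_w \int[jump_count `]0%R, t] (B w : cadlag R d)]_(z in A) phi z <=
  ereal_sup [set \int[v]_(z in A) phi z | v in levy_part U] * t%:E.
Proof.
move=> phi0 mphi; set S := ereal_sup _.
have S0 : 0 <= S.
  have [[[v p] Q] Uv] := U0.
  apply: (@le_trans _ _ (\int[v]_(z in A) phi z)); first exact: integral_ge0.
  by apply: ereal_sup_ubound; exists v => //; exists p, Q.
apply: (@le_trans _ _ (\int[P0]_w \int[N w]_(x in jump_domain t) (phi \_ A) (thd x.1 w x.2))).
  apply: ae_le_integral_any => [w _|w _|]; first exact: integral_ge0.
    by apply: integral_ge0 => x _; exact: restrictA_ge0.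
  apply: filterS jump_count_le => w jw _.
  rewrite -(integral_image_on (measurable_jump_domain t) (@mthd w) (N w) (restrictA_ge0 phi0)); last first.
    exact: measurable_restrictA.
  rewrite [leLHS]integral_mkcond; apply: ge0_le_measure_integral => //.
  - by move=> C mC; rewrite image_onE//; exact: jw.
  - exact: restrictA_ge0.
  - exact: measurable_restrictA.
rewrite (mean_jump_integral hN mu_fin pthd t (restrictA_ge0 phi0) (measurable_restrictA mphi)).
apply: (@le_trans _ _ (\int[P0]_w (S * t%:E))); last first.
  by rewrite integral_cst// [X in _ * X](_ : _ = 1) ?mule1//; exact: probability_setT.
have intS : \int[leb]_(s in `]0%R, t]) S = S * t%:E.
  have lebt : leb `]0%R, t] = t%:E by rewrite lebesgue_measure_itv/= lte_fin t0 oppr0 adde0.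
  by rewrite integral_cst// [X in _ * X](_ : _ = t%:E).
apply: ae_le_integral_any => [w _|w _|].
- by apply: integral_ge0 => s _; apply: integral_ge0 => z _; exact: restrictA_ge0.
- by rewrite mule_ge0// lee_fin ltW.
apply: filterS thdE => w gw _; rewrite -intS.
apply: ae_le_integral_any => [s _|//|].
  by apply: integral_ge0 => z _; exact: restrictA_ge0.
move: gw; apply: (@filterS _ _ (ae_filter_ringOfSetsType leb)) => s gs /=; rewrite in_itv /= => /andP[/gs[v Vv ->] _].
by rewrite transport_integral//; apply: ereal_sup_ubound; exists v.
Qed.

(** By the compensation formula, noise jumps smaller than [eta] reach [A] with
    mean number 0, because almost every control is a transport map. *)
Lemma jump_count_le_noise (eta : R) :
  (forall v z, levy_part U v -> A (g v z) -> (eta <= enorm z)%R) ->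
  {ae P0, forall w, jump_count `]0%R, t] (B w : cadlag R d) A <=
    N w (`]0%R, t] `*` [set z | (eta <= enorm z)%R])}.
Proof.
move=> etaP; pose E : set Rd := [set z | (enorm z < eta)%R].
have mE : measurable E.
  rewrite /E (_ : [set z | _] = enorm @^-1` `]-oo, eta[).
    by rewrite -[_ @^-1` _]setTI; exact: measurable_enorm.
  by apply/seteqP; split=> z /=; rewrite in_itv.
have mEc : measurable [set z : Rd | (eta <= enorm z)%R].
  rewrite (_ : [set z | _] = ~` E); first exact: measurableC.
  by apply/seteqP; split=> z /=; rewrite /E /= leNgt => /negP.
pose H w := jump_domain t `&` [set x | A (thd x.1 w x.2) /\ E x.2].
have mH w : measurable (H w).
  rewrite /H (_ : _ `&` _ = (jump_domain t `&` (fun x => thd x.1 w x.2) @^-1` A) `&` (setT `*` E)).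
    apply: measurableI; last exact: measurableX.
    by apply: mthd => //; exact: measurable_jump_domain.
  by apply/seteqP; split=> x; [move=> [? [? ?]]|move=> [[? ?] [_ ?]]].
have [mNH NH] := mean_jump_count hN mu_fin pthd t mA mE.
have H0 : {ae P0, forall w, N w (H w) = 0}.
  have : ae_eq P0 setT (fun w => N w (H w)) (cst 0).
    apply/(ae_eq_integral_abs P0 measurableT); first exact: mNH.
    under eq_integral do rewrite gee0_abs//.
    rewrite NH; apply/eqP; rewrite eq_le integral_ge0// andbT.
    rewrite -[leRHS](@integral0 _ _ _ P0 setT); apply: ae_le_integral_any => //.
    apply: filterS thdE => w gw _ /=.
    rewrite -/(H w) (_ : H w = H w `&` jump_domain t); last by rewrite setIAC setIid.
    rewrite -integral_indic//; last exact: measurable_jump_domain.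
    rewrite /jump_domain integral_time_space_itv; last 2 first.
    - by move=> x; rewrite lee_fin.
    - by apply/measurable_EFinP; apply: measurable_funTS; exact: measurable_indic.
    rewrite -[leRHS](@integral0 _ _ _ leb `]0%R, t]); apply: ae_le_integral_any => //.
      by move=> s _; apply: integral_ge0 => z _; rewrite lee_fin.
    move: gw; apply: (@filterS _ _ (ae_filter_ringOfSetsType leb)) => s gs /=.
    rewrite in_itv /= => /andP[/gs[v Vv thv] _].
    rewrite integral0_eq// => z _; rewrite indicE memNset// => -[_ /= []].
    by rewrite thv => /(etaP _ _ Vv); rewrite /E /= leNgt => /negP.
  by apply: filterS => w /(_ I).
apply: filterS2 jump_count_le H0 => w /(_ A mA) jA Hw.
apply: le_trans jA _; rewrite -[leRHS]adde0 -Hw.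
have mDE : measurable (`]0%R, t] `*` [set z : Rd | (eta <= enorm z)%R] : set (R * Rd)) by exact: measurableX.
apply: le_trans (measureU2 _ mDE (mH w)); apply: le_measure.
- by apply/mem_set; apply: mthd => //; exact: measurable_jump_domain.
- by apply/mem_set; exact: measurableU.
move=> [s z] [[/= st z0] Az]; have [ez|ez] := leP eta (enorm z).
  by left.
by right; split=> //; split.
Qed.

End one_law.
End controlled_law.

(** * The Poisson integral as an operator *)

Section poisson_operator.
Context {R : realType} {d : nat} {dO} {Ot : measurableType dO}.
Variable P0 : probability Ot R.
Local Notation Rd := (borel 'rV[R]_d).
Local Notation path_space := (borel (cadlag R d)).
Local Open Scope ereal_scope.
Variables (mu : {sigma_finite_measure set Rd -> \bar R})
  (W : R -> Ot -> Rd) (J : Ot -> cadlag R d)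
  (N : Ot -> {measure set (R * Rd) -> \bar R}).
Hypothesis hN : driving_noise P0 mu W J N.
Hypothesis mu_fin : \int[mu]_(z in [set~ 0%R]) (enorm z)%:E < +oo.
Variables (U : set ({measure set Rd -> \bar R} * 'rV[R]_d * 'M[R]_d))
  (g : {measure set Rd -> \bar R} -> Rd -> Rd).
Hypothesis U0 : U !=set0.
Hypothesis hg : transport_family (levy_part U) mu g.
Variables (A : set Rd) (e : R).
Hypotheses (mA : measurable A) (e0 : (0 < e)%R)
  (Ae : forall z, A z -> (e <= `|z : 'rV[R]_d|)%R).
Variable t : R.
Hypothesis t0 : (0 < t)%R.

Local Notation I := (poisson_integral A t).
Local Notation laws := (laws P0 W J N mu U g).
Local Notation norm_levy := (upper_norm (levy_part U) A).

Let mI f : measurable_fun setT f -> measurable_fun setT (I f : path_space -> R).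
Proof. exact: measurable_poisson_integral mA e0 Ae t f. Qed.

Lemma law_integral (B : Ot -> path_space) (P : {measure set path_space -> \bar R})
    (F : path_space -> \bar R) : measurable_fun setT B ->
  (forall C, measurable C -> P C = P0 (B @^-1` C)) ->
  measurable_fun setT F -> (forall w, 0 <= F w) ->
  \int[P]_w F w = \int[P0]_w F (B w).
Proof.
move=> mB PE mF F0.
rewrite (eq_measure_integral (pushforward P0 B))//; last by move=> C mC _; exact: PE.
by rewrite ge0_integral_pushforward.
Qed.

(** The inequality on which everything rests: it compares the upper norm of a
    Poisson integral with that of its integrand. *)
Lemma mean_poisson_integral_le P (f : Rd -> R) : laws P -> measurable_fun setT f ->
  \int[P]_w `|I f w|%:E <= norm_levy f * t%:E.
Proof.
move=> [thd [th1 [th2 [B [hadm mB hB PE]]]]] mf.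
have mnf : measurable_fun setT (fun z => `|f z|%R) by exact: measurableT_comp.
rewrite (law_integral mB PE)//; last first.
  by apply/measurable_EFinP; apply: measurableT_comp => //; exact: mI.
apply: le_trans (mean_jumps_le hN mu_fin U0 hg mA e0 Ae t0 hadm hB (phi := fun z => `|f z|%:E) _ _) => //.
  apply: ge0_le_integral_any => w _ //.
  rewrite -(poisson_integral_jump_count mA e0 Ae)// lee_fin.
  exact: poisson_integral_norm e0 Ae t f (B w).
exact/measurable_EFinP.
Qed.

(** A single noise count dominates the numbers of jumps under all laws, which
    are therefore uniformly integrable: cutting the integral off at a large
    number of jumps makes it bounded, at a small uniform cost. *)
Lemma poisson_integral_truncation (phi : Rd -> R) (K c : R) :
  measurable_fun setT phi -> (forall z, `|phi z| <= K)%R -> (0 < c)%R ->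
  exists G : path_space -> R,
    [/\ rv_on t G, (exists b : R, forall w, (`|G w| <= b)%R) &
        forall P, laws P -> \int[P]_w `|I phi w - G w|%:E <= c%:E].
Proof.
move=> mphi phiK c0.
have K0 : (0 <= K)%R by exact: le_trans (phiK 0%R).
have [nJ [nJ0 mnJ nJfin [eta etaP nJE]]] := large_noise_jumps hN mu_fin hg e0 Ae t.
have K1 : (0 < K + 1)%R by rewrite ltr_wpDl.
have [n nP] := integrable_tail nJ0 mnJ nJfin (divr_gt0 c0 K1).
pose j : path_space -> R := I (cst 1%R).
have mj : measurable_fun setT j by exact: mI.
have IK w : (`|I phi w| <= K * j w)%R.
  apply: le_trans (poisson_integral_norm e0 Ae t phi w) _.
  rewrite /j !(poisson_integralE e0 Ae) mulr_sumr; apply: ler_sum => u _.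
  by rewrite mulr1.
pose G w := if (j w <= n%:R)%R then I phi w else 0%R.
have mG : measurable_fun setT G.
  apply: measurable_fun_ifT; [|exact: mI|exact: measurable_cst].
  exact: measurable_fun_ler.
exists G; split.
- split=> // w; rewrite /G /j.
  by rewrite !(poisson_integral_stopped A t).
- exists (K * n%:R)%R => w; rewrite /G; case: ifPn => [jn|_].
    exact: le_trans (IK w) (ler_wpM2l K0 jn).
  by rewrite normr0 mulr_ge0.
move=> P [thd [th1 [th2 [B [hadm mB hB PE]]]]].
rewrite (law_integral mB PE)//; last first.
  apply/measurable_EFinP; apply: measurableT_comp => //.
  by apply: measurable_funB => //; exact: mI.
apply: (@le_trans _ _ (\int[P0]_(w in [set w | n%:R%:E < nJ w]) (K%:E * nJ w))).
  rewrite [leRHS]integral_mkcond; apply: ae_le_integral_any => [//|w _|].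
    by apply: erestrict_ge0 => x _; rewrite mule_ge0.
  have := jump_count_le_noise hN mu_fin mA t hadm hB etaP.
  apply: filterS => w jw _.
  have {}jw : (j (B w))%:E <= nJ w.
    apply: le_trans; last by rewrite nJE; exact: jw.
    rewrite (poisson_integral_jump_count mA e0 Ae t (B w) (f := cst 1%R))//.
    rewrite [leLHS](_ : _ = 1%E * jump_count `]0%R, t] (B w : cadlag R d) A) ?mul1e//.
    by rewrite (integral_cst _ mA 1%E) mul1e.
  rewrite patchE /G; have [jn|jn] := leP (j (B w)) n%:R; last first.
    rewrite subr0 mem_set /=; last exact: lt_le_trans jw.
    apply: (@le_trans _ _ (K * j (B w))%:E); first by rewrite lee_fin.
    by rewrite EFinM lee_wpmul2l.
  rewrite subrr normr0; case: ifP => // _; by rewrite mule_ge0.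
rewrite ge0_integralZl//; last 2 first.
- by rewrite -[X in measurable X]setTI; exact: emeasurable_fun_o_infty.
- exact: measurable_funTS.
apply: (@le_trans _ _ (K%:E * (c / (K + 1))%:E)); first by rewrite lee_wpmul2l// ltW.
rewrite -EFinM lee_fin mulrCA ger_pMr// ler_pdivrMr// mul1r lerDl//.
Qed.

(** Approximate the integrand by a bounded one, then cut its integral off. *)
Lemma L1b_poisson_integral f : L1b_levy U A f -> L1b_Omega P0 W J N mu U g t (I f).
Proof.
move=> [[mf f0] fapprox]; split.
  split; [exact: mI|exact: poisson_integral_stopped].
move=> eps eps0; have eps2 : (0 < eps / 2)%R by rewrite divr_gt0.
have [phi [[mphi phi0] [K phiK] fphi]] := fapprox (eps / 2 / t)%R (divr_gt0 eps2 t0).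
have [G [rvG bG GP]] := poisson_integral_truncation mphi phiK (divr_gt0 eps2 (ltr0Sn R 1)).
exists G; split=> //.
have mG : measurable_fun setT G by case: rvG.
apply: (@le_lt_trans _ _ (norm_levy (f \- phi)%R * t%:E + (eps / 2 / 2)%:E)).
  apply: ge_ereal_sup => _ [P lP <-].
  have mfphi : measurable_fun setT (f \- phi)%R by exact: measurable_funB.
  have mIfphi := mI mfphi.
  have mIG : measurable_fun setT (fun w => `|I phi w - G w|%:E).
    apply/measurable_EFinP; apply: measurableT_comp => //.
    by apply: measurable_funB => //; exact: mI.
  have mnI : measurable_fun setT (fun w => `|I (f \- phi)%R w|%:E).
    by apply/measurable_EFinP; exact: measurableT_comp.
  apply: le_trans (leeD (mean_poisson_integral_le lP mfphi) (GP P lP)).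
  rewrite -ge0_integralD//; apply: ge0_le_integral_any => // w _.
  rewrite -EFinD lee_fin (poisson_integralB e0 Ae) /=.
  by apply: le_trans (ler_normD _ _); rewrite addrA subrK.
rewrite [ltRHS](_ : _ = (eps / 2 / t)%:E * t%:E + (eps / 2)%:E); last first.
  by rewrite -EFinM -EFinD divfK ?gt_eqF// -splitr.
apply: lteD; first by rewrite lte_pmul2r//; exact: fphi.
by rewrite lte_fin ltr_pdivrMr// ltr_pMr// ltr1n.
Qed.

(** Off the event that some jump falls into the exceptional set, both integrals
    are the same sum; the mean number of such jumps is 0. *)
Lemma qs_eq_poisson_integral f h :
  qs_eq (levy_part U) f h -> qs_eq laws (I f) (I h).
Proof.
move=> [B [mB B0 fh]].
have mI1 : measurable_fun setT (I \1_B : path_space -> R).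
  by apply: mI; exact: measurable_indic.
have I1_ge0 w : (0 <= I \1_B w)%R.
  by rewrite (poisson_integralE e0 Ae) sumr_ge0.
exists (I \1_B @^-1` [set~ 0%R]); split.
- rewrite -[X in measurable X]setTI; apply: mI1 => //; exact: measurableC.
- move=> P lP.
  have : ae_eq P setT (EFin \o I \1_B) (cst 0).
    apply/(ae_eq_integral_abs P measurableT); first exact/measurable_EFinP.
    apply/eqP; rewrite eq_le integral_ge0// andbT.
    apply: le_trans (mean_poisson_integral_le lP (measurable_indic mB)) _.
    rewrite mule_le0_ge0//; last by rewrite lee_fin ltW.
    apply: ge_ereal_sup => _ [v Vv <-].
    under eq_integral do rewrite ger0_norm//.
    by rewrite integral_indic// -(B0 v Vv); apply: measureIl.
  move=> I0; apply: measure_negligible; last by apply: negligibleS I0 => w /= w0 /(_ Logic.I) [].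
  by rewrite -[X in measurable X]setTI; apply: mI1 => //; exact: measurableC.
- move=> w /contrapT.
  rewrite !(poisson_integralE e0 Ae) => /eqP; rewrite psumr_eq0// => /allP IB.
  apply: eq_big_seq => u uS; apply: fh => Bu.
  by have := IB u uS; rewrite /= indicE mem_set// oner_eq0.
Qed.

End poisson_operator.

Theorem proposition22 (R : realType) (d : nat)
    (U : set ({measure set (borel 'rV[R]_d) -> \bar R} * 'rV[R]_d * 'M[R]_d))
    (mu : {sigma_finite_measure set (borel 'rV[R]_d) -> \bar R})
    (g : {measure set (borel 'rV[R]_d) -> \bar R} ->
         borel 'rV[R]_d -> borel 'rV[R]_d)
    (dO : measure_display) (Ot : measurableType dO) (P0 : probability Ot R)
    (W : R -> Ot -> borel 'rV[R]_d) (J : Ot -> cadlag R d)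
    (N : Ot -> {measure set (R * borel 'rV[R]_d) -> \bar R})
    (hU : uncertainty_set U)
    (hmu : reference_measure mu)
    (hg : transport_family (levy_part U) mu g)
    (hN : driving_noise P0 mu W J N)
    (A : set (borel 'rV[R]_d)) (mA : measurable A)
    (A0 : ~ closure (A : set 'rV[R]_d) 0) (t : R) (t0 : 0 < t) :
  continuous_operator
    (levy_part U) A (L1b_levy U A)
    (laws P0 W J N mu U g) setT (L1b_Omega P0 W J N mu U g t)
    (poisson_integral A t).
Proof.
have [e e0 Ae] := not_closure_away A0.
have U0 : U !=set0 by case: hU.
have mu_fin : (\int[mu]_(z in [set~ 0%R]) (enorm z)%:E < +oo)%E by case: hmu.
split.
- by move=> f; exact: (L1b_poisson_integral hN mu_fin U0 hg mA e0 Ae t0).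
- by move=> f h _ _; exact: (qs_eq_poisson_integral hN mu_fin U0 hg mA e0 Ae t0).
- move=> a b f h _ _; exists set0; split=> // w _.
  exact: poisson_integral_lin e0 Ae t a b f h w.
move=> f [[mf _] _] eps eps0; exists (eps / t); first exact: divr_gt0.
move=> h [[mh _] _] fh; apply: (@le_lt_trans _ _ (upper_norm (levy_part U) A (f \- h)%R * t%:E)%E).
  apply: ge_ereal_sup => _ [P lP <-].
  have -> : poisson_integral A t f \- poisson_integral A t h = poisson_integral A t (f \- h).
    by apply/funext => w; rewrite /= (poisson_integralB e0 Ae).
  by apply: (mean_poisson_integral_le hN mu_fin U0 hg mA e0 Ae t0 lP); exact: measurable_funB.
by rewrite (_ : eps%:E = (eps / t)%:E * t%:E)%E ?lte_pmul2r// -EFinM divfK ?gt_eqF.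
Qed.
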